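(* Assume $0\in\mathcal{A}$. Then there exist $\delta>0$ and constants $\tilde R_\alpha\in[0,\infty)$, $\alpha\in\mathbb{N}$, such that for every solution $u(\cdot)$ of the NSE lying in $\mathcal{A}$, the function $A^{\alpha/2}u(\zeta)$ is $H_{\mathbb{C}}$-valued analytic in the strip $\mathcal{S}(\delta)$ and satisfies $|A^{\alpha/2}u(\zeta)|\le \tilde R_\alpha\,\nu\kappa_0^{\alpha}$ for all $\zeta\in\mathcal{S}(\delta)$ and all $\alpha\in\mathbb{N}$. Here $u(\zeta)$ denotes the analytic extension of $u$, which satisfies the NSE with complexified time $\frac{du(\zeta)}{d\zeta}+\nu Au(\zeta)+B(u(\zeta),u(\zeta))=g$.
   Context: Setting: 2D incompressible Navier–Stokes equations on $\Omega=[0,L]^2$ with periodic boundary conditions, viscosity $\nu>0$, $\kappa_0=2\pi/L$. $H$ is the closure in $L^2(\Omega)^2$ of the $\mathbb{R}^2$-valued trigonometric polynomials $v$ with $\nabla\cdot v=0$ and $\int_\Omega v\,dx=0$, with the $L^2$ inner product $(\cdot,\cdot)$ and norm $|\cdot|$. $A=-\Delta$ is the Stokes operator on $H$ (positive, self-adjoint, compact inverse, eigenvalues $\kappa_0^2\le\lambda_1\le\lambda_2\le\dots$), $A^\sigma$ are its powers defined spectrally, $\mathcal{D}(A^\sigma)$ their domains. $B(u,v)=\mathcal{P}((u\cdot\nabla)v)$ with $\mathcal{P}$ the Leray projection, and $g\in H$ is a fixed time-independent force. The NSE is $\frac{du}{dt}+\nu Au+B(u,u)=g$ in $H$. The global attractor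 $\mathcal{A}$ is the set of all $u_0\in H$ for which there exists a solution $u(t)$ of the NSE defined for all $t\in\mathbb{R}$ with $u(0)=u_0$ and $\sup_{t\in\mathbb{R}}|u(t)|<\infty$; ''a solution in $\mathcal{A}$'' means such a solution $u(t)$, $t\in\mathbb{R}$. Complexification: $H_{\mathbb{C}}=H+iH$ with the induced complex Hilbert structure, $D_{\mathbb{C}}=D+iD$ for subspaces $D\subset H$, and $A$, $B$ are extended complex-linearly / complex-bilinearly. For $\delta>0$, $\mathcal{S}(\delta)=\{\zeta\in\mathbb{C}:|\Im\zeta|<\delta\}$. *)

(* Defs.v *)
(* Stdlib reals + Coquelicot complex numbers [C].
   The phase space H of the 2D periodic NSE is represented through Fourier
   coefficients: u(x) = sum_{k in Z^2} w k * exp(i kappa0 k.x), with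
   w : Z*Z -> C*C. *)
From Stdlib Require Import Reals Lra ZArith List.
From Coquelicot Require Import Coquelicot.
Import ListNotations.

Open Scope R_scope.

Definition zlist (N : nat) : list Z :=
  map (fun i => (Z.of_nat i - Z.of_nat N)%Z) (seq 0 (2 * N + 1)).
Definition box (N : nat) : list (Z * Z) := list_prod (zlist N) (zlist N).

Definition rsum (f : Z * Z -> R) (l : list (Z * Z)) : R :=
  fold_right (fun k acc => f k + acc) 0 l.

Definition C2 := (C * C)%type.
Definition c2zero : C2 := (RtoC 0, RtoC 0).
Definition c2add (v w : C2) : C2 := (Cplus (fst v) (fst w), Cplus (snd v) (snd w)).
Definition c2sub (v w : C2) : C2 := (Cminus (fst v) (fst w), Cminus (snd v) (snd w)).
Definition c2scal (a : C) (w : C2) : C2 := (Cmult a (fst w), Cmult a (snd w)).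
Definition c2conj (w : C2) : C2 := (Cconj (fst w), Cconj (snd w)).
Definition c2norm2 (w : C2) : R := (Cmod (fst w))^2 + (Cmod (snd w))^2.
Definition c2dot (v w : C2) : C := Cplus (Cmult (fst v) (fst w)) (Cmult (snd v) (snd w)).
Definition kvec (k : Z * Z) : C2 := (RtoC (IZR (fst k)), RtoC (IZR (snd k))).
Definition ksq (k : Z * Z) : R := IZR (fst k) ^ 2 + IZR (snd k) ^ 2.
Definition zneg (k : Z * Z) : Z * Z := ((- fst k)%Z, (- snd k)%Z).
Definition zsub (k j : Z * Z) : Z * Z := ((fst k - fst j)%Z, (snd k - snd j)%Z).

Definition csum2 (f : Z * Z -> C2) (l : list (Z * Z)) : C2 :=
  fold_right (fun k acc => c2add (f k) acc) c2zero l.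

Definition FC := (Z * Z -> C2)%type.
Definition fczero : FC := fun _ => c2zero.

Definition l2_fin (w : FC) : Prop :=
  exists M : R, forall N : nat, rsum (fun k => c2norm2 (w k)) (box N) <= M.

(* H_C = H + iH: mean zero, divergence free, square summable *)
Definition inHC (w : FC) : Prop :=
  w (0%Z, 0%Z) = c2zero /\
  (forall k, c2dot (kvec k) (w k) = RtoC 0) /\
  l2_fin w.

(* H: additionally real-valued fields *)
Definition inH (w : FC) : Prop :=
  inHC w /\ forall k, w (zneg k) = c2conj (w k).

(* |w| <= r in H_C, with |w|^2 = int_{[0,L]^2} |u|^2 = L^2 sum_k |w k|^2 *)
Definition Hnorm_le (L : R) (w : FC) (r : R) : Prop :=
  0 <= r /\ forall N : nat, L ^ 2 * rsum (fun k => c2norm2 (w k)) (box N) <= r ^ 2.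

(* A^{alpha/2} w : the Stokes operator A = -Delta has symbol kappa0^2 |k|^2 *)
Definition Apow (kappa0 : R) (alpha : nat) (w : FC) : FC :=
  fun k => c2scal (RtoC ((kappa0 * sqrt (ksq k)) ^ alpha)) (w k).

Definition leray (k : Z * Z) (w : C2) : C2 :=
  if (Z.eqb (fst k) 0 && Z.eqb (snd k) 0)%bool then c2zero
  else c2sub w (c2scal (Cdiv (c2dot (kvec k) w) (RtoC (ksq k))) (kvec k)).

Definition series_to (f : Z * Z -> C2) (s : C2) : Prop :=
  (exists M : R, forall N : nat,
      rsum (fun j => sqrt (c2norm2 (f j))) (box N) <= M) /\
  (forall eps : R, 0 < eps -> exists N0 : nat, forall N : nat,
      (N0 <= N)%nat -> c2norm2 (c2sub (csum2 f (box N)) s) < eps).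

Definition advect_term (kappa0 : R) (u v : FC) (k j : Z * Z) : C2 :=
  c2scal (c2dot (u j) (c2scal (Cmult (RtoC kappa0) (0, 1)%R) (kvec (zsub k j))))
         (v (zsub k j)).

(* B_is kappa0 u v k b :  b is the k-th Fourier coefficient of
   B(u,v) = P((u . grad) v)  (the series converging absolutely) *)
Definition B_is (kappa0 : R) (u v : FC) (k : Z * Z) (b : C2) : Prop :=
  exists s : C2, series_to (advect_term kappa0 u v k) s /\ b = leray k s.

Definition Amode (kappa0 : R) (w : FC) (k : Z * Z) : C2 :=
  c2scal (RtoC (kappa0 ^ 2 * ksq k)) (w k).

Definition has_deriv_R (f : R -> C2) (t : R) (d : C2) : Prop :=
  forall eps : R, 0 < eps -> exists eta : R, 0 < eta /\
    forall h : R, h <> 0 -> Rabs h < eta ->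
      c2norm2 (c2sub (c2scal (RtoC (/ h)) (c2sub (f (t + h)) (f t))) d) < eps.

Definition has_deriv_HC (U : C -> FC) (z : C) (D : FC) : Prop :=
  inHC D /\
  forall eps : R, 0 < eps -> exists eta : R, 0 < eta /\
    forall h : C, h <> RtoC 0 -> Cmod h < eta ->
      forall N : nat,
        rsum (fun k => c2norm2 (c2sub (c2scal (Cinv h)
                    (c2sub (U (Cplus z h) k) (U z k))) (D k))) (box N) <= eps.

Definition in_strip (delta : R) (z : C) : Prop := Rabs (Im z) < delta.

Definition HC_analytic_on_strip (delta : R) (U : C -> FC) : Prop :=
  forall z, in_strip delta z -> inHC (U z) /\ exists D, has_deriv_HC U z D.

(* u : R -> H is a solution of  du/dt + nu A u + B(u,u) = g  for all t in R.
   We use the (strong) class: u(t) in H, locally bounded in V = D(A^{1/2}),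
   every Fourier mode differentiable with the Galerkin-form equation. *)
Definition is_NSE_solution (nu L : R) (g : FC) (u : R -> FC) : Prop :=
  let kappa0 := 2 * PI / L in
  (forall t, inH (u t)) /\
  (forall T : R, exists M : R, forall t, Rabs t <= T ->
       Hnorm_le L (Apow kappa0 1 (u t)) M) /\
  (forall (t : R) (k : Z * Z), exists b : C2,
       B_is kappa0 (u t) (u t) k b /\
       has_deriv_R (fun s => u s k) t
         (c2sub (c2sub (g k) (c2scal (RtoC nu) (Amode kappa0 (u t) k))) b)).

Definition solution_in_attractor (nu L : R) (g : FC) (u : R -> FC) : Prop :=
  is_NSE_solution nu L g u /\
  exists M : R, forall t : R, Hnorm_le L (u t) M.

Definition in_attractor (nu L : R) (g : FC) (u0 : FC) : Prop :=
  exists u : R -> FC, solution_in_attractor nu L g u /\ u 0 = u0.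

(* Main.v *)
Require Import Defs.
From Stdlib Require Import Reals Lra Lia Psatz ZArith List Permutation.
From Stdlib Require Import FunctionalExtensionality ClassicalEpsilon.
From Coquelicot Require Import Coquelicot.
Import ListNotations.
Open Scope R_scope.

(** Write each Fourier coefficient as [u_k = (k^perp / |k|) v_k] with [v_k] complex; the
    equation becomes [v_k' = g_k - lam_k v_k - B(v, v)_k] with [lam_k = nu kappa0^2 |k|^2],
    and everything is estimated through pointwise decay [|v_k| <= M / rho_k^m],
    [rho_k^2 = 1 + |k_1| + |k_2|].

    Duhamel's formula mode by mode gains decay: a bound in [V] gives [m = 4], and from
    [m >= 4] one reaches [m + 1] as long as [g] permits. For the trajectory through [0] the
    same formula read backwards bounds [g_k] by [B(v, v)_k], so [g] inherits the decay of
    [B(v, v)] and the bootstrap shows that [g] decays faster than any power. All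
    trajectories are then smooth, locally uniformly in time. The energy and enstrophy balances
    (exact up to [O(1/N)] on the box of size [N]) give a bound in [V] uniform over the attractor,
    hence uniform decay of every order.

    The Taylor coefficients [a_n] of [v] in time satisfy
    [(n+1) a_(n+1) = [n=0] g - lam a_n - sum_(i<=n) B(a_i, a_(n-i))]. Modes with [lam_k] large
    compared to [n] are controlled by the damping over the whole real line, the others by this
    recursion, so [a_n] grows at most geometrically and [sum_n a_n(t) (i y)^n] defines the
    extension to a strip. On each horizontal line the extension solves the same real-time
    equation, so the decay bootstrap applies again and gives all orders on the same strip. *)

(** The half powers of the frequency in [rho] are forced by the start of the bootstrap. A bound in
    [V] only makes [|v_k|] of size [|k|^-2], and in the plane the convolution of [|k|^-2] with
    itself loses a logarithm. Counting in half powers lets the convolution lose one unit; the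
    balance is then minus 2 for the derivative, minus 1 for the convolution, plus 4 for [1 / lam], a
    net gain of one. Order 7 recurs because 5 makes lattice sums converge and 2 pays for one more
    power of [|k|]. The Taylor estimate is implicit: the two extreme terms of the Cauchy product
    contain the coefficient that is being estimated. It closes because the bilinear term costs only
    [sqrt lam] while the damping returns [lam], so on high modes a small factor [1 / sqrt lam]
    survives. Trajectories are complete and bounded on the whole line, hence a supremum over all
    times can be compared with itself at an earlier time. *)

(** * Finite real and complex sums over lists *)

Definition lsum {A} (f : A -> R) (l : list A) : R :=
  fold_right (fun k acc => f k + acc) 0 l.
Definition csum {A} (f : A -> C) (l : list A) : C :=
  fold_right (fun k acc => Cplus (f k) acc) (RtoC 0) l.

Lemma lsum_ext {A} (f g : A -> R) l :
  (forall x, In x l -> f x = g x) -> lsum f l = lsum g l.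
Proof.
  induction l as [|a l IH]; simpl; intros H; [reflexivity|].
  rewrite (H a), IH; auto.
Qed.

Lemma lsum_le {A} (f g : A -> R) l :
  (forall x, In x l -> f x <= g x) -> lsum f l <= lsum g l.
Proof.
  induction l as [|a l IH]; simpl; intros H; [lra|].
  pose proof (H a (or_introl eq_refl)). pose proof (IH (fun x h => H x (or_intror h))).
  lra.
Qed.

Lemma lsum_const0 {A} (l : list A) : lsum (fun _ => 0) l = 0.
Proof. induction l; simpl; lra. Qed.

Lemma lsum_nonneg {A} (f : A -> R) l : (forall x, In x l -> 0 <= f x) -> 0 <= lsum f l.
Proof. intros H. rewrite <- (lsum_const0 l). now apply lsum_le. Qed.

Lemma lsum_plus {A} (f g : A -> R) l : lsum (fun x => f x + g x) l = lsum f l + lsum g l.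
Proof. induction l; simpl; lra. Qed.

Lemma lsum_scal {A} c (f : A -> R) l : lsum (fun x => c * f x) l = c * lsum f l.
Proof. induction l as [|a l IH]; simpl; [lra|rewrite IH; lra]. Qed.

Lemma lsum_app {A} (f : A -> R) l l' : lsum f (l ++ l') = lsum f l + lsum f l'.
Proof. induction l as [|a l IH]; simpl; [lra|rewrite IH; lra]. Qed.

Lemma lsum_perm {A} (f : A -> R) l l' : Permutation l l' -> lsum f l = lsum f l'.
Proof. induction 1; simpl; lra. Qed.

Lemma lsum_map {A B} (f : B -> R) (h : A -> B) l :
  lsum f (map h l) = lsum (fun x => f (h x)) l.
Proof. induction l as [|a l IH]; simpl; [lra|rewrite IH; lra]. Qed.

Lemma lsum_list_prod {A B} (f : A * B -> R) l l' :
  lsum f (list_prod l l') = lsum (fun a => lsum (fun b => f (a, b)) l') l.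
Proof.
  induction l as [|a l IH]; simpl; [reflexivity|].
  now rewrite lsum_app, IH, lsum_map.
Qed.

Lemma lsum_incl {A} (f : A -> R) l l' :
  NoDup l -> incl l l' -> (forall x, In x l' -> 0 <= f x) -> lsum f l <= lsum f l'.
Proof.
  intros Hnd; revert l'. induction Hnd as [|a l Ha Hnd IH]; intros l' Hi Hf; simpl.
  - now apply lsum_nonneg.
  - destruct (in_split a l') as (l1 & l2 & ->); [apply Hi; now left|].
    rewrite lsum_app; simpl.
    assert (lsum f l <= lsum f (l1 ++ l2)).
    { apply IH.
      - intros x Hx. assert (Hx' := Hi x (or_intror Hx)).
        apply in_app_or in Hx'. apply in_or_app.
        destruct Hx' as [|[->|]]; auto. contradiction.
      - intros x Hx. apply Hf. apply in_app_or in Hx. apply in_or_app. simpl. tauto. }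
    rewrite lsum_app in H. lra.
Qed.

Lemma csum_ext {A} (f g : A -> C) l :
  (forall x, In x l -> f x = g x) -> csum f l = csum g l.
Proof.
  induction l as [|a l IH]; simpl; intros H; [reflexivity|].
  rewrite (H a), IH; auto.
Qed.

Lemma csum_const0 {A} (l : list A) : csum (fun _ => RtoC 0) l = RtoC 0.
Proof. induction l as [|a l IH]; simpl; [reflexivity|rewrite IH; ring]. Qed.

Lemma csum_plus {A} (f g : A -> C) l :
  csum (fun x => Cplus (f x) (g x)) l = Cplus (csum f l) (csum g l).
Proof. induction l as [|a l IH]; simpl; [ring|rewrite IH; ring]. Qed.

Lemma csum_scal {A} c (f : A -> C) l :
  csum (fun x => Cmult c (f x)) l = Cmult c (csum f l).
Proof. induction l as [|a l IH]; simpl; [ring|rewrite IH; ring]. Qed.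

Lemma csum_app {A} (f : A -> C) l l' : csum f (l ++ l') = Cplus (csum f l) (csum f l').
Proof. induction l as [|a l IH]; simpl; [ring|rewrite IH; ring]. Qed.

Lemma csum_perm {A} (f : A -> C) l l' : Permutation l l' -> csum f l = csum f l'.
Proof.
  induction 1 as [|x l l' _ IH|x y l|l l' l'' _ IH1 _ IH2]; simpl.
  - reflexivity.
  - now rewrite IH.
  - ring.
  - congruence.
Qed.

Lemma csum_map {A B} (f : B -> C) (h : A -> B) l :
  csum f (map h l) = csum (fun x => f (h x)) l.
Proof. induction l as [|a l IH]; simpl; [reflexivity|now rewrite IH]. Qed.

Lemma csum_swap {A B} (f : A -> B -> C) l l' :
  csum (fun a => csum (f a) l') l = csum (fun b => csum (fun a => f a b) l) l'.
Proof.
  induction l as [|a l IH]; simpl.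
  - now rewrite csum_const0.
  - rewrite IH. now rewrite csum_plus.
Qed.

Lemma csum_Re {A} (f : A -> C) l : Re (csum f l) = lsum (fun x => Re (f x)) l.
Proof. induction l as [|a l IH]; simpl; [reflexivity|]. now rewrite <- IH. Qed.

Lemma csum_Im {A} (f : A -> C) l : Im (csum f l) = lsum (fun x => Im (f x)) l.
Proof. induction l as [|a l IH]; simpl; [reflexivity|]. now rewrite <- IH. Qed.

Lemma csum_Cmod {A} (f : A -> C) l : Cmod (csum f l) <= lsum (fun x => Cmod (f x)) l.
Proof.
  induction l as [|a l IH]; simpl.
  - rewrite Cmod_0. lra.
  - eapply Rle_trans; [apply Cmod_triangle|]. lra.
Qed.

(** * Limits and absolutely convergent sums *)

Definition clim (u : nat -> C) (l : C) : Prop :=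
  is_lim_seq (fun n => Re (u n)) (Re l) /\ is_lim_seq (fun n => Im (u n)) (Im l).

Lemma C_eq (a b : C) : Re a = Re b -> Im a = Im b -> a = b.
Proof. destruct a, b; simpl; intros; congruence. Qed.

Lemma clim_ext u v l : (forall n, u n = v n) -> clim u l -> clim v l.
Proof.
  intros H [a b]; split; [refine (is_lim_seq_ext _ _ _ _ a)|refine (is_lim_seq_ext _ _ _ _ b)];
  intros n; now rewrite H.
Qed.

Lemma clim_ext_loc u v l :
  (exists N, forall n, (N <= n)%nat -> u n = v n) -> clim u l -> clim v l.
Proof.
  intros [N H] [a b]; split;
   [refine (is_lim_seq_ext_loc _ _ _ _ a)|refine (is_lim_seq_ext_loc _ _ _ _ b)];
  exists N; intros n Hn; now rewrite H.
Qed.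

Lemma clim_const c : clim (fun _ => c) c.
Proof. split; apply is_lim_seq_const. Qed.

Lemma clim_plus u v l m : clim u l -> clim v m -> clim (fun n => Cplus (u n) (v n)) (Cplus l m).
Proof. intros [a b] [a' b']; split; simpl; now apply is_lim_seq_plus'. Qed.

Lemma clim_scal c u l : clim u l -> clim (fun n => Cmult c (u n)) (Cmult c l).
Proof.
  intros [a b]; split; simpl.
  - apply is_lim_seq_minus'; apply (is_lim_seq_scal_l _ _ (Finite _)); assumption.
  - apply is_lim_seq_plus'; apply (is_lim_seq_scal_l _ _ (Finite _)); assumption.
Qed.

Lemma Re_le_Cmod (z : C) : Rabs (Re z) <= Cmod z.
Proof. eapply Rle_trans; [|apply Rmax_Cmod]. apply Rmax_l. Qed.

Lemma Im_le_Cmod (z : C) : Rabs (Im z) <= Cmod z.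
Proof. eapply Rle_trans; [|apply Rmax_Cmod]. apply Rmax_r. Qed.

Lemma Re_conj_mult (z w : C) : Re (Cmult (Cconj z) w) = Re z * Re w + Im z * Im w.
Proof. destruct z, w; simpl; ring. Qed.

Lemma Cmod2 (z : C) : Cmod z ^ 2 = Re z ^ 2 + Im z ^ 2.
Proof.
  unfold Cmod. rewrite pow2_sqrt; [reflexivity|].
  destruct z; simpl; nra.
Qed.

Lemma Re_conj_le (z w : C) : Re z * Re w + Im z * Im w <= Cmod z * Cmod w.
Proof.
  rewrite <- Re_conj_mult. rewrite <- (Cmod_conj z), <- Cmod_mult.
  eapply Rle_trans; [apply Rle_abs|apply Re_le_Cmod].
Qed.

(** Testing against the conjugate of the limit: [|l|^2] is the limit of [Re (conj l * u n)], which
    is at most [|l| * S]. Only limits of real and imaginary parts are involved. *)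
Lemma clim_bound u l S :
  (exists N, forall n, (N <= n)%nat -> Cmod (u n) <= S) -> clim u l -> Cmod l <= S.
Proof.
  intros [N H] [a b].
  destruct (Rle_or_lt (Cmod l) 0) as [h|h].
  { eapply Rle_trans; [exact h|]. eapply Rle_trans; [apply Cmod_ge_0|apply (H N); lia]. }
  assert (Hl : is_lim_seq (fun n => Re l * Re (u n) + Im l * Im (u n)) (Cmod l ^ 2)).
  { rewrite Cmod2. replace (Re l ^ 2 + Im l ^ 2) with (Re l * Re l + Im l * Im l) by ring.
    apply is_lim_seq_plus'; apply (is_lim_seq_scal_l _ _ (Finite _)); assumption. }
  assert (Cmod l ^ 2 <= Cmod l * S).
  { change (Rbar_le (Cmod l ^ 2) (Cmod l * S)).
    refine (is_lim_seq_le_loc _ _ _ _ _ Hl (is_lim_seq_const _)).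
    exists N; intros n Hn. eapply Rle_trans; [apply Re_conj_le|].
    apply Rmult_le_compat_l; [lra|now apply H]. }
  simpl in H0. nra.
Qed.

(** The exhausting family is a parameter because two kinds of series occur: lattice sums along [box]
    and power series along [seq 0]. *)
Definition exhaust {A} (l : nat -> list A) : Prop :=
  (forall N, NoDup (l N)) /\ (forall N M, (N <= M)%nat -> incl (l N) (l M)).

Definition abs_bounded {A} (l : nat -> list A) (f : A -> C) (S : R) : Prop :=
  forall N, lsum (fun x => Cmod (f x)) (l N) <= S.

(** A total function: if the partial sums diverge the value is meaningless. It acquires meaning
    through [Csum_correct] or [Csum_unique]. *)
Definition Csum {A} (l : nat -> list A) (f : A -> C) : C :=
  (real (Lim_seq (fun N => Re (csum f (l N)))), real (Lim_seq (fun N => Im (csum f (l N))))).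

Lemma lsum_nonneg_cv {A} (l : nat -> list A) (f : A -> R) S :
  exhaust l -> (forall x, 0 <= f x) -> (forall N, lsum f (l N) <= S) ->
  ex_finite_lim_seq (fun N => lsum f (l N)).
Proof.
  intros [H1 H2] Hf HS. apply ex_finite_lim_seq_incr with S; [|exact HS].
  intros n. apply lsum_incl; auto.
Qed.

(** Write [f] as [(f + |f|) - |f|]: both parts are nonnegative, so their sums along an increasing
    family are monotone and bounded. *)
Lemma lsum_abs_cv {A} (l : nat -> list A) (f : A -> R) S :
  exhaust l -> (forall N, lsum (fun x => Rabs (f x)) (l N) <= S) ->
  ex_finite_lim_seq (fun N => lsum f (l N)).
Proof.
  intros He HS.
  destruct (lsum_nonneg_cv l (fun x => Rabs (f x)) S) as [a Ha]; auto.
  { intros; apply Rabs_pos. }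
  destruct (lsum_nonneg_cv l (fun x => f x + Rabs (f x)) (2 * S)) as [b Hb]; auto.
  { intros x. pose proof (Rle_abs (- f x)). rewrite Rabs_Ropp in H. lra. }
  { intros N. apply Rle_trans with (lsum (fun x => 2 * Rabs (f x)) (l N)).
    - apply lsum_le. intros x _. pose proof (Rle_abs (f x)). lra.
    - rewrite lsum_scal. pose proof (HS N). lra. }
  exists (b - a). eapply is_lim_seq_ext; [|apply is_lim_seq_minus'; [exact Hb|exact Ha]].
  intros N. simpl. rewrite lsum_plus. lra.
Qed.

Lemma Csum_correct {A} (l : nat -> list A) (f : A -> C) S :
  exhaust l -> abs_bounded l f S -> clim (fun N => csum f (l N)) (Csum l f).
Proof.
  intros He HS. unfold Csum.
  assert (a : ex_finite_lim_seq (fun N => Re (csum f (l N)))).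
  { destruct (lsum_abs_cv l (fun x => Re (f x)) S) as [a Ha]; auto.
    - intros N. eapply Rle_trans; [|apply (HS N)].
      apply lsum_le; intros; apply Re_le_Cmod.
    - exists a. eapply is_lim_seq_ext; [|exact Ha]. intros N; now rewrite csum_Re. }
  assert (b : ex_finite_lim_seq (fun N => Im (csum f (l N)))).
  { destruct (lsum_abs_cv l (fun x => Im (f x)) S) as [a' Ha]; auto.
    - intros N. eapply Rle_trans; [|apply (HS N)].
      apply lsum_le; intros; apply Im_le_Cmod.
    - exists a'. eapply is_lim_seq_ext; [|exact Ha]. intros N; now rewrite csum_Im. }
  split; cbn [Re Im fst snd].
  - destruct a as [a Ha]. now rewrite (is_lim_seq_unique _ _ Ha).
  - destruct b as [b Hb]. now rewrite (is_lim_seq_unique _ _ Hb).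
Qed.

Lemma Csum_unique {A} (l : nat -> list A) (f : A -> C) s :
  clim (fun N => csum f (l N)) s -> Csum l f = s.
Proof.
  intros [a b]. apply C_eq; unfold Csum; cbn [Re Im fst snd].
  - now rewrite (is_lim_seq_unique _ _ a).
  - now rewrite (is_lim_seq_unique _ _ b).
Qed.

Lemma Csum_ext {A} (l : nat -> list A) (f g : A -> C) :
  (forall x, f x = g x) -> Csum l f = Csum l g.
Proof. intros H. replace g with f; [reflexivity|]. now apply functional_extensionality. Qed.

Lemma Csum_bound {A} (l : nat -> list A) (f : A -> C) S :
  exhaust l -> abs_bounded l f S -> Cmod (Csum l f) <= S.
Proof.
  intros He HS. refine (clim_bound _ _ _ _ (Csum_correct l f S He HS)).
  exists 0%nat; intros n _. eapply Rle_trans; [apply csum_Cmod|apply HS].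
Qed.

Lemma Csum_plus {A} (l : nat -> list A) (f g : A -> C) S T :
  exhaust l -> abs_bounded l f S -> abs_bounded l g T ->
  Csum l (fun x => Cplus (f x) (g x)) = Cplus (Csum l f) (Csum l g).
Proof.
  intros He HS HT. apply Csum_unique.
  eapply clim_ext; [intros n; symmetry; apply csum_plus|].
  apply clim_plus; eapply Csum_correct; eauto.
Qed.

Lemma Csum_scal {A} (l : nat -> list A) c (f : A -> C) S :
  exhaust l -> abs_bounded l f S ->
  Csum l (fun x => Cmult c (f x)) = Cmult c (Csum l f).
Proof.
  intros He HS. apply Csum_unique.
  eapply clim_ext; [intros n; symmetry; apply csum_scal|].
  apply clim_scal; eapply Csum_correct; eauto.
Qed.

Lemma abs_bounded_le {A} (l : nat -> list A) (f g : A -> C) S :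
  (forall x, Cmod (f x) <= Cmod (g x)) -> abs_bounded l g S -> abs_bounded l f S.
Proof.
  intros H HS N. eapply Rle_trans; [|apply (HS N)]. apply lsum_le; auto.
Qed.

Lemma abs_bounded_lsum {A} (l : nat -> list A) (f : A -> C) (h : A -> R) S :
  (forall x, Cmod (f x) <= h x) -> (forall N, lsum h (l N) <= S) -> abs_bounded l f S.
Proof.
  intros H HS N. eapply Rle_trans; [|apply (HS N)]. apply lsum_le; auto.
Qed.

(** * Boxes in the lattice *)

Lemma in_zlist N z : In z (zlist N) <-> (- Z.of_nat N <= z <= Z.of_nat N)%Z.
Proof.
  unfold zlist. rewrite in_map_iff. split.
  - intros (i & <- & Hi). apply in_seq in Hi. lia.
  - intros H. exists (Z.to_nat (z + Z.of_nat N)). split; [lia|]. apply in_seq. lia.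
Qed.

Lemma NoDup_zlist N : NoDup (zlist N).
Proof.
  unfold zlist. apply FinFun.Injective_map_NoDup; [|apply seq_NoDup].
  intros a b H. lia.
Qed.

Lemma in_box N k :
  In k (box N) <-> (Z.abs (fst k) <= Z.of_nat N /\ Z.abs (snd k) <= Z.of_nat N)%Z.
Proof.
  unfold box. destruct k as [a b]. rewrite in_prod_iff, !in_zlist. simpl. lia.
Qed.

Lemma NoDup_list_prod {A B} (l : list A) (l' : list B) :
  NoDup l -> NoDup l' -> NoDup (list_prod l l').
Proof.
  intros H H'. induction H as [|a l Ha H IH]; simpl; [constructor|].
  apply NoDup_app; auto.
  - apply FinFun.Injective_map_NoDup; auto. intros x y E; congruence.
  - intros [x y] Hx Hy. apply in_map_iff in Hx. destruct Hx as (z & E & _).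
    apply in_prod_iff in Hy. injection E as <- <-. tauto.
Qed.

Lemma NoDup_box N : NoDup (box N).
Proof. apply NoDup_list_prod; apply NoDup_zlist. Qed.

Lemma exhaust_box : exhaust box.
Proof.
  split; [apply NoDup_box|]. intros N M H k. rewrite !in_box. lia.
Qed.

Lemma exhaust_seq : exhaust (seq 0).
Proof.
  split; [intros; apply seq_NoDup|]. intros N M H k. rewrite !in_seq. lia.
Qed.

Lemma zneg_inv k : zneg (zneg k) = k.
Proof. destruct k; unfold zneg; simpl. f_equal; lia. Qed.

Lemma zsub_inv k j : zsub k (zsub k j) = j.
Proof. destruct k, j; unfold zsub; simpl. f_equal; lia. Qed.

Lemma box_neg_perm N : Permutation (map zneg (box N)) (box N).
Proof.
  apply NoDup_Permutation.
  - apply FinFun.Injective_map_NoDup; [|apply NoDup_box].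
    intros a b H. rewrite <- (zneg_inv a), H. apply zneg_inv.
  - apply NoDup_box.
  - intros k. rewrite in_map_iff, in_box. split.
    + intros (x & <- & H). apply in_box in H. unfold zneg; simpl. lia.
    + intros H. exists (zneg k). split; [apply zneg_inv|].
      apply in_box. unfold zneg; simpl. lia.
Qed.

(** The map [j -> k - j] is an involution, and it sends a box into a larger box on which the bound
    [S] is still available. *)
Lemma lsum_box_shift (f : Z * Z -> R) k S :
  (forall j, 0 <= f j) -> (forall N, lsum f (box N) <= S) ->
  forall N, lsum (fun j => f (zsub k j)) (box N) <= S.
Proof.
  intros Hf HS N. rewrite <- (lsum_map f (zsub k)).
  eapply Rle_trans; [|apply (HS (N + Z.to_nat (Z.abs (fst k)) + Z.to_nat (Z.abs (snd k)))%nat)].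
  apply lsum_incl; auto.
  - apply FinFun.Injective_map_NoDup; [|apply NoDup_box].
    intros a b H. rewrite <- (zsub_inv k a), H. apply zsub_inv.
  - intros x Hx. apply in_map_iff in Hx. destruct Hx as (j & <- & Hj).
    apply in_box in Hj. apply in_box. unfold zsub; simpl. lia.
Qed.

(** * Weights and convolution estimates *)

(** A substitute for [|k|] that is subadditive, at least 1 even at the origin, and comparable to
    [|k|] elsewhere. Its square root [rho] allows integer exponents to count half powers of the
    frequency. *)
Definition pk (k : Z * Z) : R := 1 + Rabs (IZR (fst k)) + Rabs (IZR (snd k)).
Definition rho (k : Z * Z) : R := sqrt (pk k).
Definition nrm (k : Z * Z) : R := sqrt (ksq k).
Definition dec (m : nat) (M : R) (w : Z * Z -> C) : Prop :=
  forall k, Cmod (w k) <= M / rho k ^ m.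

Lemma pk_ge1 k : 1 <= pk k.
Proof. unfold pk. pose proof (Rabs_pos (IZR (fst k))). pose proof (Rabs_pos (IZR (snd k))). lra. Qed.

Lemma rho_ge1 k : 1 <= rho k.
Proof. unfold rho. rewrite <- sqrt_1. apply sqrt_le_1_alt, pk_ge1. Qed.

Lemma rho_sq k : rho k ^ 2 = pk k.
Proof. unfold rho. apply pow2_sqrt. pose proof (pk_ge1 k). lra. Qed.

Lemma rho_pow_ge1 k m : 1 <= rho k ^ m.
Proof. apply pow_R1_Rle, rho_ge1. Qed.

Lemma pk_sub k j : pk k <= pk j + pk (zsub k j).
Proof.
  unfold pk, zsub; simpl. rewrite !minus_IZR.
  pose proof (Rabs_triang (IZR (fst j)) (IZR (fst k) - IZR (fst j))).
  pose proof (Rabs_triang (IZR (snd j)) (IZR (snd k) - IZR (snd j))).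
  replace (IZR (fst j) + (IZR (fst k) - IZR (fst j))) with (IZR (fst k)) in H by ring.
  replace (IZR (snd j) + (IZR (snd k) - IZR (snd j))) with (IZR (snd k)) in H0 by ring.
  lra.
Qed.

Lemma rho_sub k j : rho k <= rho j + rho (zsub k j).
Proof.
  pose proof (rho_ge1 k). pose proof (rho_ge1 j). pose proof (rho_ge1 (zsub k j)).
  pose proof (rho_sq k). pose proof (rho_sq j). pose proof (rho_sq (zsub k j)).
  pose proof (pk_sub k j). nra.
Qed.

Lemma ksq_nonneg k : 0 <= ksq k.
Proof. unfold ksq. nra. Qed.

Lemma nrm_nonneg k : 0 <= nrm k.
Proof. apply sqrt_pos. Qed.

Lemma nrm_sq k : nrm k ^ 2 = ksq k.
Proof. apply pow2_sqrt, ksq_nonneg. Qed.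

Lemma ksq_le_pk k : ksq k <= pk k ^ 2.
Proof.
  unfold ksq, pk. rewrite <- (pow2_abs (IZR (fst k))), <- (pow2_abs (IZR (snd k))).
  pose proof (Rabs_pos (IZR (fst k))). pose proof (Rabs_pos (IZR (snd k))). nra.
Qed.

Lemma nrm_le_pk k : nrm k <= pk k.
Proof.
  pose proof (nrm_sq k). pose proof (ksq_le_pk k). pose proof (nrm_nonneg k).
  pose proof (pk_ge1 k). nra.
Qed.

Lemma IZR_sq_ge1 z : z <> 0%Z -> 1 <= IZR z ^ 2.
Proof.
  intros H. rewrite <- (pow2_abs (IZR z)), <- abs_IZR.
  assert (1 <= IZR (Z.abs z)) by (apply IZR_le; lia). nra.
Qed.

Lemma ksq_ge1 k : k <> (0, 0)%Z -> 1 <= ksq k.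
Proof.
  intros H. unfold ksq. destruct k as [a b]; cbn [fst snd].
  destruct (Z.eq_dec a 0) as [->|Ha].
  - assert (b <> 0%Z) by (intros ->; apply H; reflexivity).
    pose proof (IZR_sq_ge1 b H0). nra.
  - pose proof (IZR_sq_ge1 a Ha). nra.
Qed.

Lemma nrm_ge1 k : k <> (0, 0)%Z -> 1 <= nrm k.
Proof. intros H. unfold nrm. rewrite <- sqrt_1. apply sqrt_le_1_alt, ksq_ge1, H. Qed.

Lemma nrm0 : nrm (0, 0)%Z = 0.
Proof. transitivity (sqrt 0); [|apply sqrt_0]. unfold nrm, ksq; simpl. f_equal. ring. Qed.

Lemma pk_le_nrm k : k <> (0, 0)%Z -> pk k <= 3 * nrm k.
Proof.
  intros H. pose proof (nrm_ge1 k H). pose proof (nrm_sq k). unfold ksq in H1. unfold pk.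
  rewrite <- (pow2_abs (IZR (fst k))), <- (pow2_abs (IZR (snd k))) in H1.
  pose proof (Rabs_pos (IZR (fst k))). pose proof (Rabs_pos (IZR (snd k))).
  assert (Rabs (IZR (fst k)) <= nrm k) by nra.
  assert (Rabs (IZR (snd k)) <= nrm k) by nra. lra.
Qed.

(** * Summability of the weights and discrete convolutions *)

Definition quart (x : R) : R := sqrt (sqrt x).

Lemma quart_pow4 x : 0 <= x -> quart x ^ 4 = x.
Proof.
  intros H. unfold quart. replace (sqrt (sqrt x) ^ 4) with ((sqrt (sqrt x) ^ 2) ^ 2) by ring.
  rewrite pow2_sqrt by apply sqrt_pos. now apply pow2_sqrt.
Qed.

Lemma quart_ge1 x : 1 <= x -> 1 <= quart x.
Proof.
  intros H. unfold quart. rewrite <- sqrt_1. apply sqrt_le_1_alt.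
  rewrite <- sqrt_1. now apply sqrt_le_1_alt.
Qed.

(** With [x], [y] the fourth roots of consecutive numbers this is the integral comparison of
    [n^(-5/4)] with the increments of [-4 n^(-1/4)]. It follows from factoring [y^4 - x^4 = 1]. *)
Lemma inv5_telescope x y : 1 <= x -> x <= y -> y ^ 4 = x ^ 4 + 1 -> / y ^ 5 <= 4 * (/ x - / y).
Proof.
  intros Hx Hy H.
  assert (Hxy : 1 <= (y - x) * (4 * y ^ 3)).
  { assert (E : (y - x) * (y ^ 3 + y ^ 2 * x + y * x ^ 2 + x ^ 3) = 1) by nra.
    rewrite <- E at 1. apply Rmult_le_compat_l; [lra|].
    assert (x ^ 2 <= y ^ 2) by (apply pow_incr; lra).
    assert (x ^ 3 <= y ^ 3) by (apply pow_incr; lra).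
    assert (y ^ 2 * x <= y ^ 2 * y) by (apply Rmult_le_compat_l; nra).
    assert (y * x ^ 2 <= y * y ^ 2) by (apply Rmult_le_compat_l; nra). nra. }
  replace (4 * (/ x - / y)) with (4 * (y - x) / (x * y)) by (field; lra).
  apply Rmult_le_reg_r with (x * y ^ 5); [apply Rmult_lt_0_compat; [lra|apply pow_lt; lra]|].
  replace (/ y ^ 5 * (x * y ^ 5)) with x by (field; lra).
  replace (4 * (y - x) / (x * y) * (x * y ^ 5)) with ((y - x) * (4 * y ^ 3) * y) by (field; lra).
  nra.
Qed.

Lemma lsum_inv5_nat n :
  lsum (fun i => / quart (1 + INR i) ^ 5) (seq 0 (S n)) <= 5 - 4 / quart (1 + INR n).
Proof.
  induction n as [|n IH].
  - assert (E : quart (1 + INR 0) = 1).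
    { simpl INR. rewrite Rplus_0_r. unfold quart. now rewrite !sqrt_1. }
    cbn [seq lsum fold_right]. rewrite E. lra.
  - rewrite seq_S, lsum_app. cbn [lsum fold_right]. change (0 + S n)%nat with (S n).
    pose proof (pos_INR n).
    pose proof (inv5_telescope (quart (1 + INR n)) (quart (1 + INR (S n)))).
    rewrite S_INR in *.
    rewrite !quart_pow4 in H0 by lra.
    assert (1 <= quart (1 + INR n)) by (apply quart_ge1; lra).
    assert (quart (1 + INR n) <= quart (1 + (INR n + 1))).
    { unfold quart. do 2 apply sqrt_le_1_alt. lra. }
    specialize (H0 H1 H2 ltac:(lra)). lra.
Qed.

Lemma lsum_inv5_zlist N :
  lsum (fun z => / quart (1 + Rabs (IZR z)) ^ 5) (zlist N) <= 10.
Proof.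
  set (f := fun z => / quart (1 + Rabs (IZR z)) ^ 5).
  apply Rle_trans with
    (lsum f (map Z.of_nat (seq 0 (S N)) ++ map (fun i => (- Z.of_nat i)%Z) (seq 0 (S N)))).
  - apply lsum_incl.
    + apply NoDup_zlist.
    + intros z Hz. apply in_zlist in Hz. apply in_or_app. rewrite !in_map_iff.
      destruct (Z_le_gt_dec 0 z).
      * left. exists (Z.to_nat z). rewrite in_seq. lia.
      * right. exists (Z.to_nat (- z)). rewrite in_seq. lia.
    + intros z _. unfold f. apply Rlt_le, Rinv_0_lt_compat, pow_lt.
      pose proof (Rabs_pos (IZR z)). pose proof (quart_ge1 (1 + Rabs (IZR z))). lra.
  - rewrite lsum_app, !lsum_map.
    assert (E : forall i, f (Z.of_nat i) = / quart (1 + INR i) ^ 5).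
    { intros i. unfold f. rewrite <- INR_IZR_INZ, Rabs_pos_eq; [reflexivity|apply pos_INR]. }
    assert (E' : forall i, f (- Z.of_nat i)%Z = / quart (1 + INR i) ^ 5).
    { intros i. rewrite <- E. unfold f. now rewrite opp_IZR, Rabs_Ropp. }
    rewrite (lsum_ext (fun x => f (Z.of_nat x)) (fun i => / quart (1 + INR i) ^ 5)) by auto.
    rewrite (lsum_ext (fun x => f (- Z.of_nat x)%Z) (fun i => / quart (1 + INR i) ^ 5)) by auto.
    pose proof (lsum_inv5_nat N).
    assert (0 < / quart (1 + INR N)).
    { apply Rinv_0_lt_compat. pose proof (pos_INR N). pose proof (quart_ge1 (1 + INR N)). lra. }
    unfold Rdiv in H. lra.
Qed.

(** The variables separate through [(1 + |a| + |b|)^2 >= (1 + |a|) (1 + |b|)], that is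
    [rho >= q a * q b] with fourth roots [q]. The double sum is then at most the square of the
    one-dimensional bound 10. *)
Lemma lsum_inv5_rho N : lsum (fun k => / rho k ^ 5) (box N) <= 100.
Proof.
  unfold box. rewrite lsum_list_prod.
  set (q := fun z => quart (1 + Rabs (IZR z))).
  apply Rle_trans with
    (lsum (fun a => lsum (fun b => / q a ^ 5 * / q b ^ 5) (zlist N)) (zlist N)).
  - apply lsum_le; intros a _; apply lsum_le; intros b _.
    rewrite <- Rinv_mult, <- Rpow_mult_distr.
    pose proof (Rabs_pos (IZR a)). pose proof (Rabs_pos (IZR b)).
    assert (1 <= q a) by (apply quart_ge1; lra). assert (1 <= q b) by (apply quart_ge1; lra).
    apply Rinv_le_contravar; [apply pow_lt; nra|].
    apply pow_incr. split; [nra|].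
    assert (E : (q a * q b) ^ 4 <= rho (a, b) ^ 4).
    { rewrite Rpow_mult_distr. unfold q. rewrite !quart_pow4 by lra.
      replace (rho (a, b) ^ 4) with ((rho (a, b) ^ 2) ^ 2) by ring.
      rewrite rho_sq. unfold pk; simpl. nra. }
    pose proof (rho_ge1 (a, b)).
    destruct (Rle_or_lt (q a * q b) (rho (a, b))) as [h|h]; [exact h|exfalso].
    set (x := rho (a, b)) in *. set (y := q a * q b) in *.
    assert (x ^ 2 < y ^ 2) by nra. assert (0 <= x ^ 2) by nra.
    replace (y ^ 4) with (y ^ 2 * y ^ 2) in E by ring.
    replace (x ^ 4) with (x ^ 2 * x ^ 2) in E by ring. nra.
  - rewrite (lsum_ext _ (fun a => lsum (fun b => / q b ^ 5) (zlist N) * / q a ^ 5)).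
    2:{ intros a _. rewrite lsum_scal. ring. }
    rewrite lsum_scal. pose proof (lsum_inv5_zlist N).
    fold (q) in H. change (lsum (fun b => / q b ^ 5) (zlist N) <= 10) in H.
    assert (0 <= lsum (fun b => / q b ^ 5) (zlist N)).
    { apply lsum_nonneg. intros z _. apply Rlt_le, Rinv_0_lt_compat, pow_lt.
      pose proof (Rabs_pos (IZR z)). pose proof (quart_ge1 (1 + Rabs (IZR z))). unfold q. lra. }
    nra.
Qed.

Lemma inv_rho_pos k m : 0 < / rho k ^ m.
Proof. apply Rinv_0_lt_compat. pose proof (rho_pow_ge1 k m). lra. Qed.

Lemma inv_rho_anti k m n : (n <= m)%nat -> / rho k ^ m <= / rho k ^ n.
Proof.
  intros H. apply Rinv_le_contravar.
  - pose proof (rho_pow_ge1 k n). lra.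
  - apply Rle_pow; [apply rho_ge1|exact H].
Qed.

Lemma lsum_inv_rho m N : (5 <= m)%nat -> lsum (fun k => / rho k ^ m) (box N) <= 100.
Proof.
  intros H. eapply Rle_trans; [|apply (lsum_inv5_rho N)].
  apply lsum_le. intros k _. now apply inv_rho_anti.
Qed.

(** Replacing the larger base by the smaller one leaves the smaller base with total exponent
    [m + n >= 5]. *)
Lemma inv_pow_min x y m n :
  1 <= x -> 1 <= y -> (5 <= m + n)%nat -> / (x ^ m * y ^ n) <= / x ^ 5 + / y ^ 5.
Proof.
  intros Hx Hy H.
  assert (P : forall z l, 1 <= z -> 0 < / z ^ l).
  { intros z l Hz. apply Rinv_0_lt_compat, pow_lt. lra. }
  pose proof (P x 5%nat Hx). pose proof (P y 5%nat Hy).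
  destruct (Rle_or_lt x y) as [h|h].
  - apply Rle_trans with (/ x ^ 5); [|lra].
    apply Rinv_le_contravar; [apply pow_lt; lra|].
    apply Rle_trans with (x ^ (m + n)); [now apply Rle_pow|].
    rewrite pow_add. apply Rmult_le_compat_l; [apply pow_le; lra|apply pow_incr; lra].
  - apply Rle_trans with (/ y ^ 5); [|lra].
    apply Rinv_le_contravar; [apply pow_lt; lra|].
    apply Rle_trans with (y ^ (m + n)); [now apply Rle_pow|].
    rewrite pow_add. apply Rmult_le_compat_r; [apply pow_le; lra|apply pow_incr; lra].
Qed.

(** Since [rho k] is at most twice the larger of the two other weights, [r] powers can be moved onto
    [k] from one of the factors. The exponents left over, [m - r] and [m], add up to at least 5. *)
Lemma inv_rho_conv m r k j : (r <= m)%nat -> (r + 5 <= 2 * m)%nat ->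
  / rho j ^ m * / rho (zsub k j) ^ m <=
  2 ^ r * 2 / rho k ^ r * (/ rho j ^ 5 + / rho (zsub k j) ^ 5).
Proof.
  intros H1 H2. set (x := rho j). set (y := rho (zsub k j)). set (w := rho k).
  assert (Hx : 1 <= x) by apply rho_ge1. assert (Hy : 1 <= y) by apply rho_ge1.
  assert (Hw : 1 <= w) by apply rho_ge1. assert (Hs : w <= x + y) by apply rho_sub.
  assert (px := pow_lt x r ltac:(lra)). assert (py := pow_lt y r ltac:(lra)).
  assert (pw := pow_lt w r ltac:(lra)).
  assert (Hr : w ^ r <= 2 ^ r * (x ^ r + y ^ r)).
  { destruct (Rle_or_lt x y).
    - apply Rle_trans with ((2 * y) ^ r); [apply pow_incr; lra|].
      rewrite Rpow_mult_distr. apply Rmult_le_compat_l; [apply pow_le|]; lra.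
    - apply Rle_trans with ((2 * x) ^ r); [apply pow_incr; lra|].
      rewrite Rpow_mult_distr. apply Rmult_le_compat_l; [apply pow_le|]; lra. }
  assert (E1 : / (x ^ (m - r) * y ^ m) <= / x ^ 5 + / y ^ 5) by (apply inv_pow_min; auto; lia).
  assert (E2 : / (x ^ m * y ^ (m - r)) <= / x ^ 5 + / y ^ 5) by (apply inv_pow_min; auto; lia).
  replace (2 ^ r * 2 / w ^ r * (/ x ^ 5 + / y ^ 5)) with
    (2 ^ r / w ^ r * (2 * (/ x ^ 5 + / y ^ 5))) by (unfold Rdiv; ring).
  apply Rle_trans with (2 ^ r / w ^ r * (/ (x ^ (m - r) * y ^ m) + / (x ^ m * y ^ (m - r)))).
  2:{ apply Rmult_le_compat_l; [|lra]. apply Rlt_le, Rdiv_lt_0_compat; [apply pow_lt; lra|exact pw]. }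
  replace (/ (x ^ (m - r) * y ^ m) + / (x ^ m * y ^ (m - r))) with
    ((x ^ r + y ^ r) * (/ x ^ m * / y ^ m)).
  2:{ replace (x ^ m) with (x ^ r * x ^ (m - r)) by (rewrite <- pow_add; f_equal; lia).
      replace (y ^ m) with (y ^ r * y ^ (m - r)) by (rewrite <- pow_add; f_equal; lia).
      assert (0 < x ^ (m - r)) by (apply pow_lt; lra). assert (0 < y ^ (m - r)) by (apply pow_lt; lra).
      field. lra. }
  assert (0 < / x ^ m) by (apply Rinv_0_lt_compat, pow_lt; lra).
  assert (0 < / y ^ m) by (apply Rinv_0_lt_compat, pow_lt; lra).
  replace (2 ^ r / w ^ r * ((x ^ r + y ^ r) * (/ x ^ m * / y ^ m))) with
    ((2 ^ r * (x ^ r + y ^ r)) / w ^ r * (/ x ^ m * / y ^ m)) by (unfold Rdiv; ring).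
  rewrite <- (Rmult_1_l (/ x ^ m * / y ^ m)) at 1.
  apply Rmult_le_compat_r; [nra|].
  apply Rmult_le_reg_r with (w ^ r); [exact pw|].
  unfold Rdiv. rewrite Rmult_assoc, Rinv_l by lra. lra.
Qed.

Lemma lsum_inv_rho_shift k N : lsum (fun j => / rho (zsub k j) ^ 5) (box N) <= 100.
Proof.
  apply (lsum_box_shift (fun j => / rho j ^ 5)); [|apply lsum_inv5_rho].
  intros j. apply Rlt_le, inv_rho_pos.
Qed.

(** The constant is 2 from [inv_rho_conv] times 100 for each of the two lattice sums. For [m >= 5]
    one may take [r = m], so nothing is lost; the first bootstrap step has [m = 4] and must accept
    [r = 3]. *)
Lemma conv_bound m r k N (a b : Z * Z -> R) Ma Mb :
  (r <= m)%nat -> (r + 5 <= 2 * m)%nat ->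
  (forall j, 0 <= a j <= Ma / rho j ^ m) -> (forall j, 0 <= b j <= Mb / rho j ^ m) ->
  lsum (fun j => a j * b (zsub k j)) (box N) <= 400 * 2 ^ r * Ma * Mb / rho k ^ r.
Proof.
  intros H1 H2 Ha Hb.
  assert (Pa : 0 <= Ma).
  { destruct (Ha (0, 0)%Z) as [h1 h2]. pose proof (inv_rho_pos (0, 0)%Z m). unfold Rdiv in h2. nra. }
  assert (Pb : 0 <= Mb).
  { destruct (Hb (0, 0)%Z) as [h1 h2]. pose proof (inv_rho_pos (0, 0)%Z m). unfold Rdiv in h2. nra. }
  apply Rle_trans with
    (lsum (fun j => (Ma * Mb * (2 ^ r * 2 / rho k ^ r)) *
                    (/ rho j ^ 5 + / rho (zsub k j) ^ 5)) (box N)).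
  - apply lsum_le. intros j _. rewrite Rmult_assoc.
    eapply Rle_trans; [|apply Rmult_le_compat_l; [nra|apply (inv_rho_conv m r k j H1 H2)]].
    destruct (Ha j), (Hb (zsub k j)).
    replace (Ma * Mb * (/ rho j ^ m * / rho (zsub k j) ^ m)) with
      ((Ma / rho j ^ m) * (Mb / rho (zsub k j) ^ m)) by (unfold Rdiv; ring).
    now apply Rmult_le_compat.
  - rewrite lsum_scal, lsum_plus.
    pose proof (lsum_inv5_rho N). pose proof (lsum_inv_rho_shift k N).
    pose proof (inv_rho_pos k r). pose proof (pow_lt 2 r ltac:(lra)).
    replace (400 * 2 ^ r * Ma * Mb / rho k ^ r) with
      (Ma * Mb * (2 ^ r * 2 / rho k ^ r) * 200) by (unfold Rdiv; ring).
    apply Rmult_le_compat_l; [|lra]. unfold Rdiv.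
    repeat apply Rmult_le_pos; lra.
Qed.

(** * The bilinear term in scalar form *)

Definition perp (j k : Z * Z) : R := IZR (fst j) * IZR (snd k) - IZR (snd j) * IZR (fst k).
Definition dot (j k : Z * Z) : R := IZR (fst j) * IZR (fst k) + IZR (snd j) * IZR (snd k).
(** The symbol of the projected advection term for [u_j = (j^perp / |j|) w_j]. The transport factor
    is [j^perp . (k - j)], which equals [j^perp . k]; the inner product of [(k - j)^perp] with
    [k^perp] is [k . (k - j)]. The convention that the inverse of 0 is 0 removes the zero mode in
    each of the three places. *)
Definition tau (kap : R) (k j : Z * Z) : R :=
  kap * perp j k * dot k (zsub k j) * / nrm k * / nrm j * / nrm (zsub k j).
Definition Bterm (kap : R) (w v : Z * Z -> C) (k j : Z * Z) : C :=
  Cmult (0, tau kap k j) (Cmult (w j) (v (zsub k j))).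
Definition Bf (kap : R) (w v : Z * Z -> C) (k : Z * Z) : C := Csum box (Bterm kap w v k).

Lemma abs_le_of_sq x y : 0 <= y -> x ^ 2 <= y ^ 2 -> Rabs x <= y.
Proof. intros Hy H. apply Rabs_le. nra. Qed.

Lemma perp_le j k : Rabs (perp j k) <= nrm j * nrm k.
Proof.
  pose proof (nrm_nonneg j). pose proof (nrm_nonneg k).
  apply abs_le_of_sq; [nra|]. rewrite Rpow_mult_distr, !nrm_sq. unfold perp, ksq.
  match goal with |- ?a <= ?b => assert (E : b - a = (dot j k) ^ 2) by (unfold dot; ring) end.
  pose proof (pow2_ge_0 (dot j k)). lra.
Qed.

Lemma dot_le j k : Rabs (dot j k) <= nrm j * nrm k.
Proof.
  pose proof (nrm_nonneg j). pose proof (nrm_nonneg k).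
  apply abs_le_of_sq; [nra|]. rewrite Rpow_mult_distr, !nrm_sq. unfold dot, ksq.
  match goal with |- ?a <= ?b => assert (E : b - a = (perp j k) ^ 2) by (unfold perp; ring) end.
  pose proof (pow2_ge_0 (perp j k)). lra.
Qed.

Lemma mult_inv_le1 x : 0 <= x -> 0 <= x * / x <= 1.
Proof.
  intros H. destruct (Req_dec x 0) as [->|h].
  - rewrite Rmult_0_l. lra.
  - rewrite Rinv_r by exact h. lra.
Qed.

Lemma inv_nonneg x : 0 <= x -> 0 <= / x.
Proof.
  intros [H|<-]; [now apply Rlt_le, Rinv_0_lt_compat|]. rewrite Rinv_0. lra.
Qed.

(** Cauchy-Schwarz on both products cancels [|j|], [|k - j|] and one [|k|]. The derivative thus
    falls on the output frequency [k], as in the divergence form of the nonlinearity, and can be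
    taken out of the convolution. *)
Lemma tau_le kap k j : 0 <= kap -> Rabs (tau kap k j) <= kap * nrm k.
Proof.
  intros Hk. unfold tau. rewrite !Rabs_mult, (Rabs_pos_eq kap) by exact Hk.
  set (l := zsub k j).
  pose proof (nrm_nonneg j). pose proof (nrm_nonneg k). pose proof (nrm_nonneg l).
  rewrite !(Rabs_pos_eq (/ _)) by (apply inv_nonneg; assumption).
  pose proof (perp_le j k). pose proof (dot_le k l).
  pose proof (Rabs_pos (perp j k)). pose proof (Rabs_pos (dot k l)).
  pose proof (inv_nonneg _ H). pose proof (inv_nonneg _ H0). pose proof (inv_nonneg _ H1).
  apply Rle_trans with (kap * (nrm j * nrm k) * (nrm k * nrm l) * / nrm k * / nrm j * / nrm l).
  - repeat apply Rmult_le_compat_r; auto.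
    apply Rmult_le_compat; auto.
    + apply Rmult_le_pos; auto.
    + apply Rmult_le_compat_l; auto.
  - replace (kap * (nrm j * nrm k) * (nrm k * nrm l) * / nrm k * / nrm j * / nrm l) with
      (kap * nrm k * ((nrm k * / nrm k) * (nrm j * / nrm j) * (nrm l * / nrm l))) by ring.
    rewrite <- (Rmult_1_r (kap * nrm k)) at 2.
    apply Rmult_le_compat_l; [nra|].
    pose proof (mult_inv_le1 _ H). pose proof (mult_inv_le1 _ H0). pose proof (mult_inv_le1 _ H1).
    rewrite <- (Rmult_1_r 1), <- (Rmult_1_r 1) at 1.
    apply Rmult_le_compat; try tauto; [|nra]. apply Rmult_le_pos; tauto.
Qed.

Lemma Cmod_imag x : Cmod (0, x) = Rabs x.
Proof.
  unfold Cmod; simpl. rewrite Rmult_0_l, Rmult_1_r, Rplus_0_l. apply sqrt_Rsqr_abs.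
Qed.

Lemma tau_0 kap j : tau kap (0, 0)%Z j = 0.
Proof. unfold tau. rewrite nrm0, Rinv_0. ring. Qed.

Lemma Bterm_le kap w v k j : 0 <= kap ->
  Cmod (Bterm kap w v k j) <= kap * nrm k * (Cmod (w j) * Cmod (v (zsub k j))).
Proof.
  intros Hk. unfold Bterm. rewrite !Cmod_mult, Cmod_imag.
  apply Rmult_le_compat_r; [|now apply tau_le].
  apply Rmult_le_pos; apply Cmod_ge_0.
Qed.

Lemma Bterm_bounded kap w v k S : 0 <= kap ->
  (forall N, lsum (fun j => Cmod (w j) * Cmod (v (zsub k j))) (box N) <= S) ->
  abs_bounded box (Bterm kap w v k) (kap * nrm k * S).
Proof.
  intros Hk H. eapply abs_bounded_lsum; [intros j; now apply Bterm_le|].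
  intros N. rewrite lsum_scal. apply Rmult_le_compat_l; [|apply H].
  pose proof (nrm_nonneg k). nra.
Qed.

Lemma Bf_le kap w v k S : 0 <= kap ->
  (forall N, lsum (fun j => Cmod (w j) * Cmod (v (zsub k j))) (box N) <= S) ->
  Cmod (Bf kap w v k) <= kap * nrm k * S.
Proof.
  intros Hk H. apply Csum_bound; [apply exhaust_box|]. now apply Bterm_bounded.
Qed.

Lemma dec_conv m r M M' w v k N : (r <= m)%nat -> (r + 5 <= 2 * m)%nat ->
  dec m M w -> dec m M' v ->
  lsum (fun j => Cmod (w j) * Cmod (v (zsub k j))) (box N) <= 400 * 2 ^ r * M * M' / rho k ^ r.
Proof.
  intros H1 H2 Hw Hv.
  apply (conv_bound m r k N (fun j => Cmod (w j)) (fun j => Cmod (v j))); auto;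
  intros j; (split; [apply Cmod_ge_0|]); auto.
Qed.

Lemma Bf_dec kap m r M M' w v k : 0 <= kap -> (r <= m)%nat -> (r + 5 <= 2 * m)%nat ->
  dec m M w -> dec m M' v ->
  Cmod (Bf kap w v k) <= kap * nrm k * (400 * 2 ^ r * M * M' / rho k ^ r).
Proof. intros. apply Bf_le; auto. intros. now apply dec_conv with m. Qed.

Lemma Bterm_dec_bounded kap M M' w v k : 0 <= kap -> dec 5 M w -> dec 5 M' v ->
  abs_bounded box (Bterm kap w v k) (kap * nrm k * (400 * 2 ^ 5 * M * M' / rho k ^ 5)).
Proof. intros. apply Bterm_bounded; auto. intros. apply dec_conv with 5%nat; auto. Qed.

Lemma Bf_0 kap w v : Bf kap w v (0, 0)%Z = RtoC 0.
Proof.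
  apply Csum_unique. eapply clim_ext; [|apply clim_const].
  intros n. rewrite <- (csum_const0 (box n)). apply csum_ext. intros j _.
  unfold Bterm. rewrite tau_0. change (0, 0) with (RtoC 0). ring.
Qed.

Section BfLinear.
Variables (kap M1 M2 M3 : R) (w w' v : Z * Z -> C).
Hypotheses (Hk : 0 <= kap) (H1 : dec 5 M1 w) (H2 : dec 5 M2 w') (H3 : dec 5 M3 v).

(** Decay of order 5 of all arguments makes the series defining [Bf] converge absolutely; linearity
    of the total function [Csum] is available only then. *)
Lemma Bf_plus_l k :
  Bf kap (fun j => Cplus (w j) (w' j)) v k = Cplus (Bf kap w v k) (Bf kap w' v k).
Proof.
  unfold Bf. rewrite <- (Csum_plus box _ _ _ _ exhaust_box
    (Bterm_dec_bounded kap M1 M3 w v k Hk H1 H3) (Bterm_dec_bounded kap M2 M3 w' v k Hk H2 H3)).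
  apply Csum_ext. intros j. unfold Bterm. ring.
Qed.

Lemma Bf_plus_r k :
  Bf kap v (fun j => Cplus (w j) (w' j)) k = Cplus (Bf kap v w k) (Bf kap v w' k).
Proof.
  unfold Bf. rewrite <- (Csum_plus box _ _ _ _ exhaust_box
    (Bterm_dec_bounded kap M3 M1 v w k Hk H3 H1) (Bterm_dec_bounded kap M3 M2 v w' k Hk H3 H2)).
  apply Csum_ext. intros j. unfold Bterm. ring.
Qed.

Lemma Bf_scal_l c k : Bf kap (fun j => Cmult c (w j)) v k = Cmult c (Bf kap w v k).
Proof.
  unfold Bf. rewrite <- (Csum_scal box c _ _ exhaust_box
    (Bterm_dec_bounded kap M1 M3 w v k Hk H1 H3)).
  apply Csum_ext. intros j. unfold Bterm. ring.
Qed.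

Lemma Bf_scal_r c k : Bf kap v (fun j => Cmult c (w j)) k = Cmult c (Bf kap v w k).
Proof.
  unfold Bf. rewrite <- (Csum_scal box c _ _ exhaust_box
    (Bterm_dec_bounded kap M3 M1 v w k Hk H3 H1)).
  apply Csum_ext. intros j. unfold Bterm. ring.
Qed.
End BfLinear.

(** * Complex-valued functions of a real variable *)

Definition dC (f : R -> C) (t : R) (d : C) : Prop :=
  is_derive (fun s => Re (f s)) t (Re d) /\ is_derive (fun s => Im (f s)) t (Im d).

Lemma is_derive_nonpos_decr (f df : R -> R) a b : a <= b ->
  (forall s, a <= s <= b -> is_derive f s (df s)) ->
  (forall s, a <= s <= b -> df s <= 0) -> f b <= f a.
Proof.
  intros Hab Hd Hn.
  destruct (MVT_gen f a b df) as (c & Hc & E).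
  - intros x Hx. apply Hd. rewrite Rmin_left, Rmax_right in Hx by lra. lra.
  - intros x Hx. apply derivable_continuous_pt. exists (df x). apply is_derive_Reals.
    apply Hd. rewrite Rmin_left, Rmax_right in Hx by lra. lra.
  - rewrite Rmin_left, Rmax_right in Hc by lra. pose proof (Hn c Hc). nra.
Qed.

(** Gronwall by an integrating factor: [(x s - F / lam) * exp (lam * (s - a))] is nonincreasing. *)
Lemma linear_ode_upper (x d : R -> R) lam F a b : 0 < lam -> a <= b ->
  (forall s, a <= s <= b -> is_derive x s (d s)) ->
  (forall s, a <= s <= b -> d s <= - lam * x s + F) ->
  x b <= exp (- (lam * (b - a))) * (x a - F / lam) + F / lam.
Proof.
  intros Hl Hab Hd Hle.
  assert (H : (x b - F / lam) * exp (lam * (b - a)) <= (x a - F / lam) * exp (lam * (a - a))).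
  { apply (is_derive_nonpos_decr (fun s => (x s - F / lam) * exp (lam * (s - a)))
      (fun s => (d s + lam * (x s - F / lam)) * exp (lam * (s - a)))); auto.
    - intros s Hs. pose proof (Hd s Hs).
      evar_last.
      + apply (is_derive_mult (fun s => x s - F / lam) (fun s => exp (lam * (s - a))) s (d s)
          (lam * exp (lam * (s - a)))).
        * evar_last; [apply (is_derive_minus x (fun _ => F / lam) s (d s) 0);
            [exact H|apply (is_derive_const (F / lam) s)]|]. unfold minus, plus, opp; simpl. lra.
        * auto_derive; [exact I|]. unfold Rminus. ring.
        * intros; apply Rmult_comm.
      + unfold plus, mult; simpl. ring.
    - intros s Hs. pose proof (Hle s Hs). pose proof (exp_pos (lam * (s - a))).
      replace (lam * (x s - F / lam)) with (lam * x s - F) by (field; lra). nra. }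
  replace (lam * (a - a)) with 0 in H by ring. rewrite exp_0, Rmult_1_r in H.
  pose proof (exp_pos (- (lam * (b - a)))).
  assert (E : exp (lam * (b - a)) * exp (- (lam * (b - a))) = 1).
  { rewrite <- exp_plus. rewrite <- exp_0. f_equal. ring. }
  apply Rmult_le_compat_r with (r := exp (- (lam * (b - a)))) in H; [|lra].
  rewrite Rmult_assoc, E in H. lra.
Qed.

Lemma dC_lin p q f t d : dC f t d ->
  is_derive (fun s => p * Re (f s) + q * Im (f s)) t (p * Re d + q * Im d).
Proof.
  intros [H1 H2].
  apply (is_derive_plus (fun s => p * Re (f s)) (fun s => q * Im (f s))).
  - now apply (is_derive_scal (fun s => Re (f s))).
  - now apply (is_derive_scal (fun s => Im (f s))).
Qed.

(** The modulus need not be differentiable, so the equation is tested with the fixed number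
    [conj (y t)]. The real function [x s = Re (conj (y t) * y s)] satisfies a scalar inequality and
    equals [|y t|^2] at the final time; division by [|y t|] finishes. Replacing the exponential by
    [1 / (1 + lam * T)] keeps later estimates rational. *)
Lemma dC_linear_ode (y d : R -> C) lam F t T : 0 < lam -> 0 <= T ->
  (forall s, t - T <= s <= t -> dC y s (d s)) ->
  (forall s, t - T <= s <= t -> Cmod (Cplus (d s) (Cmult (RtoC lam) (y s))) <= F) ->
  Cmod (y t) <= Cmod (y (t - T)) / (1 + lam * T) + F / lam.
Proof.
  intros Hl HT Hd HF.
  assert (F0 : 0 <= F).
  { eapply Rle_trans; [apply Cmod_ge_0|apply (HF t)]. lra. }
  assert (LT : 0 <= lam * T) by nra.
  assert (FL : 0 <= F / lam) by (apply Rmult_le_pos; [lra|apply inv_nonneg; lra]).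
  assert (D0 : 0 <= Cmod (y (t - T)) / (1 + lam * T)).
  { apply Rmult_le_pos; [apply Cmod_ge_0|apply inv_nonneg; lra]. }
  set (a := Cmod (y t)).
  destruct (Rle_or_lt a 0) as [h|h]; [lra|].
  set (x := fun s => Re (y t) * Re (y s) + Im (y t) * Im (y s)).
  assert (H := linear_ode_upper x (fun s => Re (y t) * Re (d s) + Im (y t) * Im (d s))
    lam (a * F) (t - T) t Hl ltac:(lra)).
  assert (H' := H (fun s Hs => dC_lin _ _ _ _ _ (Hd s Hs))). clear H.
  assert (Hx : x t = a ^ 2) by (unfold x, a; rewrite Cmod2; ring).
  assert (Hx' : x (t - T) <= a * Cmod (y (t - T))) by apply Re_conj_le.
  rewrite Hx in H'. replace (t - (t - T)) with T in H' by ring.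
  assert (H2 : a ^ 2 <= exp (- (lam * T)) * (x (t - T) - a * F / lam) + a * F / lam).
  { apply H'. intros s Hs. pose proof (HF s Hs).
    pose proof (Re_conj_le (y t) (Cplus (d s) (Cmult (RtoC lam) (y s)))). fold a in H0.
    assert (a * Cmod (Cplus (d s) (Cmult (RtoC lam) (y s))) <= a * F)
      by (apply Rmult_le_compat_l; lra).
    assert (E1 : Re (Cplus (d s) (Cmult (RtoC lam) (y s))) = Re (d s) + lam * Re (y s))
      by (unfold Re; simpl; ring).
    assert (E2 : Im (Cplus (d s) (Cmult (RtoC lam) (y s))) = Im (d s) + lam * Im (y s))
      by (unfold Im; simpl; ring).
    rewrite E1, E2 in H0. unfold x. nra. }
  clear H'.
  pose proof (exp_pos (- (lam * T))).
  assert (H3 : exp (- (lam * T)) <= / (1 + lam * T)).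
  { rewrite exp_Ropp. apply Rinv_le_contravar; [lra|]. apply exp_ineq1_le. }
  assert (H4 : 0 <= a * F / lam) by (unfold Rdiv; rewrite Rmult_assoc; apply Rmult_le_pos; [lra|exact FL]).
  assert (H5 : a ^ 2 <= exp (- (lam * T)) * (a * Cmod (y (t - T))) + a * F / lam).
  { set (e := exp (- (lam * T))) in *. set (Q := a * F / lam) in *.
    assert (e * x (t - T) <= e * (a * Cmod (y (t - T)))) by (apply Rmult_le_compat_l; lra).
    assert (0 <= e * Q) by (apply Rmult_le_pos; lra). lra. }
  assert (H6 : exp (- (lam * T)) * (a * Cmod (y (t - T))) <=
               / (1 + lam * T) * (a * Cmod (y (t - T)))).
  { apply Rmult_le_compat_r; [|exact H3]. pose proof (Cmod_ge_0 (y (t - T))). nra. }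
  apply Rmult_le_reg_l with a; [exact h|]. simpl in H5. unfold Rdiv in *. lra.
Qed.

(** The mean value theorem fails for complex values as an equality; pairing with the conjugate of
    the error [e] itself reduces it to monotonicity of a real function. *)
Lemma dC_mvt (y d : R -> C) c K T : 0 <= T ->
  (forall s, 0 <= s <= T -> dC y s (d s)) ->
  (forall s, 0 <= s <= T -> Cmod (Cminus (d s) c) <= K) ->
  Cmod (Cminus (Cminus (y T) (y 0)) (Cmult (RtoC T) c)) <= T * K.
Proof.
  intros HT Hd HK. set (e := Cminus (Cminus (y T) (y 0)) (Cmult (RtoC T) c)). set (a := Cmod e).
  assert (K0 : 0 <= K) by (eapply Rle_trans; [apply Cmod_ge_0|apply (HK 0); lra]).
  destruct (Rle_or_lt a 0) as [h|h]; [nra|].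
  set (x := fun s => (Re e * Re (y s) + Im e * Im (y s))
                     - s * (Re e * Re c + Im e * Im c + a * K)).
  assert (H : x T <= x 0).
  { apply (is_derive_nonpos_decr x (fun s => (Re e * Re (d s) + Im e * Im (d s))
                     - (Re e * Re c + Im e * Im c + a * K))); [lra| |].
    - intros s Hs. apply (is_derive_minus (fun s => Re e * Re (y s) + Im e * Im (y s))).
      + apply dC_lin, Hd, Hs.
      + auto_derive; [exact I|]. apply Rmult_1_l.
    - intros s Hs. pose proof (Re_conj_le e (Cminus (d s) c)). fold a in H.
      assert (a * Cmod (Cminus (d s) c) <= a * K) by (apply Rmult_le_compat_l; [lra|now apply HK]).
      assert (E1 : Re (Cminus (d s) c) = Re (d s) - Re c) by reflexivity.
      assert (E2 : Im (Cminus (d s) c) = Im (d s) - Im c) by reflexivity.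
      rewrite E1, E2 in H. lra. }
  assert (E : a ^ 2 = Re e * (Re (y T) - Re (y 0) - T * Re c) + Im e * (Im (y T) - Im (y 0) - T * Im c)).
  { unfold a. rewrite Cmod2. unfold e, Re, Im; simpl. ring. }
  unfold x in H. apply Rmult_le_reg_l with a; [exact h|]. nra.
Qed.

(** * Parabolic smoothing in weighted sup norms *)

Definition lam (nu kap : R) (k : Z * Z) : R := nu * kap ^ 2 * ksq k.

Definition rhs (nu kap : R) (g w : Z * Z -> C) (k : Z * Z) : C :=
  Cminus (Cminus (g k) (Cmult (RtoC (lam nu kap k)) (w k))) (Bf kap w w k).

Definition sol (nu kap : R) (g : Z * Z -> C) (v : R -> Z * Z -> C) : Prop :=
  (forall t, v t (0, 0)%Z = RtoC 0) /\
  (forall t k, dC (fun s => v s k) t (rhs nu kap g (v t) k)).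

Lemma lam_pos nu kap k : 0 < nu -> 0 < kap -> k <> (0, 0)%Z -> 0 < lam nu kap k.
Proof.
  intros. unfold lam. pose proof (ksq_ge1 k H1). pose proof (pow_lt kap 2 H0).
  apply Rmult_lt_0_compat; [nra|lra].
Qed.

Lemma lam_0 nu kap : lam nu kap (0, 0)%Z = 0.
Proof. unfold lam, ksq; simpl. ring. Qed.

(** The gain of four orders on which the smoothing rests; 9 is the square of the 3 in
    [pk_le_nrm]. *)
Lemma inv_lam_le nu kap k : 0 < nu -> 0 < kap -> k <> (0, 0)%Z ->
  / lam nu kap k <= 9 / (nu * kap ^ 2) / rho k ^ 4.
Proof.
  intros Hn Hk H. pose proof (pow_lt kap 2 Hk).
  replace (rho k ^ 4) with (pk k ^ 2) by (rewrite <- rho_sq; ring).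
  pose proof (pk_le_nrm k H). pose proof (pk_ge1 k). pose proof (nrm_sq k).
  unfold lam. rewrite <- H3.
  assert (0 < nrm k) by lra.
  replace (9 / (nu * kap ^ 2) / pk k ^ 2) with (/ (nu * kap ^ 2 * (pk k / 3) ^ 2))
    by (field; lra).
  apply Rinv_le_contravar; [|].
  - repeat apply Rmult_lt_0_compat; lra.
  - apply Rmult_le_compat_l; [nra|]. apply pow_incr. lra.
Qed.

Lemma rhs_plus_lam nu kap g w k :
  Cplus (rhs nu kap g w k) (Cmult (RtoC (lam nu kap k)) (w k)) = Cminus (g k) (Bf kap w w k).
Proof. unfold rhs. ring. Qed.

Lemma Cmod_minus_le (a b : C) : Cmod (Cminus a b) <= Cmod a + Cmod b.
Proof. unfold Cminus. eapply Rle_trans; [apply Cmod_triangle|]. rewrite Cmod_opp. lra. Qed.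

(** A window of length one suffices: the memory of [v (t - 1)] is damped by at most [1 / lam], the
    same gain as for the forcing. *)
Lemma sol_mode_bound nu kap g v k t G H : 0 < nu -> 0 < kap -> sol nu kap g v ->
  k <> (0, 0)%Z -> Cmod (g k) <= G ->
  (forall s, t - 1 <= s <= t -> Cmod (Bf kap (v s) (v s) k) <= H) ->
  Cmod (v t k) <= (Cmod (v (t - 1) k) + G + H) / lam nu kap k.
Proof.
  intros Hn Hk [_ Hs] H0 HG HH. pose proof (lam_pos nu kap k Hn Hk H0).
  eapply Rle_trans.
  - apply (dC_linear_ode (fun s => v s k) (fun s => rhs nu kap g (v s) k) _ (G + H) t 1 H1);
    [lra|intros; apply Hs|].
    intros s Hs'. rewrite rhs_plus_lam. eapply Rle_trans; [apply Cmod_minus_le|].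
    pose proof (HH s Hs'). lra.
  - assert (Cmod (v (t - 1) k) / (1 + lam nu kap k * 1) <= Cmod (v (t - 1) k) / lam nu kap k).
    { apply Rmult_le_compat_l; [apply Cmod_ge_0|]. apply Rinv_le_contravar; lra. }
    unfold Rdiv in *. lra.
Qed.

(** Since [v 0 = 0], solving backwards recovers [g] from the bilinear term. *)
Lemma sol_through_zero_force nu kap g v k H : 0 < nu -> 0 < kap -> sol nu kap g v ->
  v 0 k = RtoC 0 -> k <> (0, 0)%Z ->
  (forall s, -1 <= s <= 0 -> Cmod (Bf kap (v s) (v s) k) <= H) ->
  Cmod (g k) <= Cmod (v (-1) k) + (1 + / lam nu kap k) * H.
Proof.
  intros Hn Hk [_ Hs] Hv0 H0 HH. pose proof (lam_pos nu kap k Hn Hk H0).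
  (* [c] is the equilibrium of the linear part. Subtracting it removes [g] from the equation and
     moves it into the two end values, where at time 0 the difference is exactly [- c]. *)
  set (l := lam nu kap k) in *. set (c := Cdiv (g k) (RtoC l)).
  assert (Hl : RtoC l <> RtoC 0) by (intros E; apply RtoC_inj in E; lra).
  assert (Hode := dC_linear_ode (fun s => Cminus (v s k) c) (fun s => rhs nu kap g (v s) k) l H 0 1
    H1 ltac:(lra)).
  cbv beta in Hode. rewrite Hv0 in Hode. replace (0 - 1) with (-1) in Hode by ring.
  assert (Ec : Cmod (Cminus (RtoC 0) c) = Cmod (g k) / l).
  { replace (Cminus (RtoC 0) c) with (Copp c) by ring. rewrite Cmod_opp. unfold c.
    rewrite Cmod_div by exact Hl. rewrite Cmod_R, Rabs_pos_eq by lra. reflexivity. }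
  rewrite Ec in Hode.
  assert (A : Cmod (g k) / l <= Cmod (Cminus (v (-1) k) c) / (1 + l * 1) + H / l).
  { apply Hode.
    - intros s _. destruct (Hs s k) as [h1 h2]. split.
      + evar_last; [apply (is_derive_minus (fun s => Re (v s k)) (fun _ => Re c) s _ 0 h1);
          apply (is_derive_const (Re c))|]. unfold minus, plus, opp; simpl. ring.
      + evar_last; [apply (is_derive_minus (fun s => Im (v s k)) (fun _ => Im c) s _ 0 h2);
          apply (is_derive_const (Im c))|]. unfold minus, plus, opp; simpl. ring.
    - intros s Hs'.
      replace (Cplus (rhs nu kap g (v s) k) (Cmult (RtoC l) (Cminus (v s k) c))) with
        (Copp (Bf kap (v s) (v s) k)).
      + rewrite Cmod_opp. apply HH. lra.
      + unfold rhs, c. fold l. field. exact Hl. }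
  assert (B : Cmod (Cminus (v (-1) k) c) <= Cmod (v (-1) k) + Cmod (g k) / l).
  { eapply Rle_trans; [apply Cmod_minus_le|]. apply Rplus_le_compat_l.
    unfold c. rewrite Cmod_div by exact Hl. rewrite Cmod_R, Rabs_pos_eq by lra. lra. }
  assert (A' : Cmod (g k) / l <= (Cmod (v (-1) k) + Cmod (g k) / l) / (1 + l) + H / l).
  { eapply Rle_trans; [exact A|]. apply Rplus_le_compat_r. rewrite Rmult_1_r.
    apply Rmult_le_compat_r; [apply inv_nonneg; lra|exact B]. }
  (* Now [|g k|] has the coefficient [1 + l] on the left and 1 on the right, so [l * |g k|] remains
     and the estimate can be solved for it. *)
  apply Rmult_le_compat_r with (r := l * (1 + l)) in A'; [|nra].
  replace (Cmod (g k) / l * (l * (1 + l))) with (Cmod (g k) * (1 + l)) in A' by (field; lra).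
  replace (((Cmod (v (-1) k) + Cmod (g k) / l) / (1 + l) + H / l) * (l * (1 + l))) with
    (l * Cmod (v (-1) k) + Cmod (g k) + (1 + l) * H) in A' by (field; lra).
  apply Rmult_le_reg_l with l; [exact H1|].
  replace (l * (Cmod (v (-1) k) + (1 + / l) * H)) with (l * Cmod (v (-1) k) + (1 + l) * H)
    by (field; lra). lra.
Qed.

(** Two orders go to the factor [|k| <= rho k ^ 2] and one to the convolution. *)
Lemma Bf_dec_drop3 kap m M w k : 0 <= kap -> (4 <= m)%nat -> dec m M w ->
  Cmod (Bf kap w w k) <= kap * (400 * 2 ^ (m - 1) * M * M) / rho k ^ (m - 3).
Proof.
  intros Hk Hm Hw.
  eapply Rle_trans; [apply (Bf_dec kap m (m - 1) M M); auto; lia|].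
  pose proof (nrm_le_pk k). rewrite <- rho_sq in H. pose proof (rho_ge1 k).
  replace (rho k ^ (m - 1)) with (rho k ^ 2 * rho k ^ (m - 3)) by (rewrite <- pow_add; f_equal; lia).
  set (c := 400 * 2 ^ (m - 1) * M * M).
  assert (Hc : 0 <= c).
  { unfold c. pose proof (pow_lt 2 (m - 1) ltac:(lra)).
    rewrite Rmult_assoc. apply Rmult_le_pos; nra. }
  pose proof (inv_rho_pos k (m - 3)). pose proof (inv_rho_pos k 2).
  unfold Rdiv. rewrite Rinv_mult.
  replace (kap * nrm k * (c * (/ rho k ^ 2 * / rho k ^ (m - 3)))) with
    ((kap * c * / rho k ^ (m - 3)) * (nrm k * / rho k ^ 2)) by ring.
  rewrite <- (Rmult_1_r (kap * c * / rho k ^ (m - 3))) at 2.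
  apply Rmult_le_compat_l.
  - clearbody c. repeat apply Rmult_le_pos; lra.
  - pose proof (rho_pow_ge1 k 2). apply Rmult_le_reg_r with (rho k ^ 2); [lra|].
    rewrite Rmult_assoc, Rinv_l by lra. lra.
Qed.

Lemma div_rho_pow_le k m a : 0 <= a -> a / rho k ^ m <= a.
Proof.
  intros Ha. unfold Rdiv. rewrite <- (Rmult_1_r a) at 2. apply Rmult_le_compat_l; [exact Ha|].
  rewrite <- Rinv_1. apply Rinv_le_contravar; [lra|apply rho_pow_ge1].
Qed.

Lemma dec_mono m M M' w : M <= M' -> dec m M w -> dec m M' w.
Proof.
  intros H Hw k. eapply Rle_trans; [apply Hw|]. unfold Rdiv.
  apply Rmult_le_compat_r; [apply Rlt_le, inv_rho_pos|exact H].
Qed.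

Lemma dec_pos m M w : dec m M w -> 0 <= M.
Proof.
  intros H. pose proof (H (0, 0)%Z). pose proof (Cmod_ge_0 (w (0, 0)%Z)).
  pose proof (inv_rho_pos (0, 0)%Z m). unfold Rdiv in H0. nra.
Qed.

Lemma dec_weaken m n M w : (n <= m)%nat -> dec m M w -> dec n M w.
Proof.
  intros H Hw k. pose proof (dec_pos _ _ _ Hw). eapply Rle_trans; [apply Hw|]. unfold Rdiv.
  apply Rmult_le_compat_l; [exact H0|]. now apply inv_rho_anti.
Qed.

(** The bilinear term and the force are both of order [m - 3], and [1 / lam] adds four. The constant
    [M'] precedes the quantifiers over [v] and [t], so the step serves both local and uniform
    bounds. *)
Lemma sol_smoothing_step nu kap m M G : 0 < nu -> 0 < kap -> (4 <= m)%nat ->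
  exists M', forall g v t, sol nu kap g v -> dec (m - 3) G g ->
    (forall s, t - 1 <= s <= t -> dec m M (v s)) -> dec (m + 1) M' (v t).
Proof.
  intros Hn Hk Hm.
  set (H := kap * (400 * 2 ^ (m - 1) * M * M)).
  exists ((Rabs M + G + H) * (9 / (nu * kap ^ 2))).
  intros g v t Hs Hg Hv k.
  assert (HM : 0 <= M) by (apply (dec_pos m M (v t)), Hv; lra).
  assert (HG := dec_pos _ _ _ Hg).
  rewrite (Rabs_pos_eq M HM).
  assert (HH : 0 <= H).
  { unfold H. pose proof (pow_lt 2 (m - 1) ltac:(lra)). apply Rmult_le_pos; [lra|].
    rewrite Rmult_assoc. apply Rmult_le_pos; nra. }
  assert (Hk2 := pow_lt kap 2 Hk).
  assert (PP : 0 < 9 / (nu * kap ^ 2)) by (apply Rdiv_lt_0_compat; nra).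
  destruct (Z.eq_dec (fst k) 0) as [e1|e1]; [destruct (Z.eq_dec (snd k) 0) as [e2|e2]|].
  1:{ assert (k = (0, 0)%Z) by (destruct k; simpl in *; congruence). subst k.
      destruct Hs as [Hs _]. rewrite Hs, Cmod_0. unfold Rdiv at 1.
      apply Rmult_le_pos; [nra|apply Rlt_le, inv_rho_pos]. }
  all: assert (H0 : k <> (0, 0)%Z) by (intros ->; simpl in *; lia).
  all: eapply Rle_trans;
    [apply (sol_mode_bound nu kap g v k t (G / rho k ^ (m - 3)) (H / rho k ^ (m - 3))); auto;
     intros s Hs'; apply Bf_dec_drop3; auto; lra|].
  all: assert (H2 := inv_lam_le nu kap k Hn Hk H0); assert (H3 := lam_pos nu kap k Hn Hk H0).
  all: assert (E : Cmod (v (t - 1) k) <= M / rho k ^ (m - 3))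
    by (apply (dec_weaken m); [lia|apply Hv; lra]).
  all: replace (rho k ^ (m + 1)) with (rho k ^ (m - 3) * rho k ^ 4)
    by (rewrite <- pow_add; f_equal; lia).
  all: pose proof (inv_rho_pos k (m - 3)).
  all: assert (0 < / lam nu kap k) by (apply Rinv_0_lt_compat; auto).
  all: apply Rle_trans with ((M + G + H) * / rho k ^ (m - 3) * (9 / (nu * kap ^ 2) / rho k ^ 4));
   [apply Rmult_le_compat; [|lra| |exact H2]|].
  all: try (unfold Rdiv; rewrite (Rinv_mult (rho k ^ (m - 3))); apply Req_le; ring).
  all: unfold Rdiv in *; try lra.
  all: pose proof (Cmod_ge_0 (v (t - 1) k)).
  all: assert (0 <= G * / rho k ^ (m - 3)) by nra.
  all: assert (0 <= H * / rho k ^ (m - 3)) by nra.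
  all: lra.
Qed.

(** * From a bound in [V] to pointwise decay of every order *)

Definition Vbound (K : R) (w : Z * Z -> C) : Prop :=
  forall N, lsum (fun k => ksq k * Cmod (w k) ^ 2) (box N) <= K.

Lemma zz_eq_dec (a b : Z * Z) : {a = b} + {a <> b}.
Proof. decide equality; apply Z.eq_dec. Defined.

Lemma in_box_large k : In k (box (Z.to_nat (Z.abs (fst k)) + Z.to_nat (Z.abs (snd k)))).
Proof. apply in_box. lia. Qed.

Lemma lsum_box_single (f : Z * Z -> R) S k :
  (forall j, 0 <= f j) -> (forall N, lsum f (box N) <= S) -> f k <= S.
Proof.
  intros Hf HS. eapply Rle_trans; [|apply (HS (Z.to_nat (Z.abs (fst k)) + Z.to_nat (Z.abs (snd k)))%nat)].
  replace (f k) with (lsum f [k]) by (simpl; ring).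
  apply lsum_incl; auto.
  - repeat constructor; simpl; tauto.
  - intros x [<-|[]]. apply in_box_large.
Qed.

Lemma Vbound_pos K w : Vbound K w -> 0 <= K.
Proof.
  intros H. eapply Rle_trans; [|apply (H 0%nat)]. apply lsum_nonneg. intros k _.
  apply Rmult_le_pos; [apply ksq_nonneg|apply pow2_ge_0].
Qed.

(** Split the weight by [pk k <= pk j + pk (k - j)], attach each share to its own factor, and use
    the arithmetic-geometric mean inequality. Each of the two resulting sums is at most [9 * K],
    with 9 again from [pk <= 3 |k|]. *)
Lemma Vbound_conv K w k : w (0, 0)%Z = RtoC 0 -> Vbound K w ->
  forall N, lsum (fun j => Cmod (w j) * Cmod (w (zsub k j))) (box N) <= 18 * K / pk k.
Proof.
  intros H0 HV N.
  set (h := fun j => 9 * (ksq j * Cmod (w j) ^ 2)).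
  assert (Hh : forall j, pk j ^ 2 * Cmod (w j) ^ 2 <= h j).
  { intros j. unfold h. rewrite <- Rmult_assoc.
    destruct (zz_eq_dec j (0, 0)%Z) as [->|hj].
    - rewrite H0, Cmod_0. simpl. lra.
    - apply Rmult_le_compat_r; [apply pow2_ge_0|]. rewrite <- nrm_sq.
      pose proof (pk_le_nrm j hj). pose proof (pk_ge1 j). nra. }
  assert (Hhp : forall j, 0 <= h j).
  { intros j. eapply Rle_trans; [|apply Hh]. apply Rmult_le_pos; apply pow2_ge_0. }
  assert (HS : forall N, lsum h (box N) <= 9 * K).
  { intros n. unfold h. rewrite lsum_scal. pose proof (HV n). lra. }
  pose proof (pk_ge1 k).
  apply Rle_trans with (lsum (fun j => / pk k * (h j + h (zsub k j))) (box N)).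
  - apply lsum_le. intros j _. apply Rmult_le_reg_l with (pk k); [lra|].
    rewrite <- Rmult_assoc, <- (Rmult_assoc _ (/ pk k)), Rinv_r, Rmult_1_l by lra.
    pose proof (Hh j). pose proof (Hh (zsub k j)). pose proof (pk_sub k j).
    pose proof (pk_ge1 j). pose proof (pk_ge1 (zsub k j)).
    set (a := Cmod (w j)) in *. set (b := Cmod (w (zsub k j))) in *.
    assert (0 <= a) by apply Cmod_ge_0. assert (0 <= b) by apply Cmod_ge_0.
    set (x := pk j) in *. set (y := pk (zsub k j)) in *.
    assert (pk k * a * b <= (x + y) * (a * b)).
    { rewrite Rmult_assoc. apply Rmult_le_compat_r; nra. }
    assert (x * (a * b) <= (x ^ 2 * a ^ 2 + b ^ 2) / 2)
      by (pose proof (pow2_ge_0 (x * a - b)); lra).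
    assert (y * (a * b) <= (y ^ 2 * b ^ 2 + a ^ 2) / 2)
      by (pose proof (pow2_ge_0 (y * b - a)); lra).
    assert (a ^ 2 <= x ^ 2 * a ^ 2).
    { rewrite <- (Rmult_1_l (a ^ 2)) at 1. apply Rmult_le_compat_r; [apply pow2_ge_0|nra]. }
    assert (b ^ 2 <= y ^ 2 * b ^ 2).
    { rewrite <- (Rmult_1_l (b ^ 2)) at 1. apply Rmult_le_compat_r; [apply pow2_ge_0|nra]. }
    lra.
  - rewrite lsum_scal, lsum_plus. pose proof (HS N).
    pose proof (lsum_box_shift h k (9 * K) Hhp HS N).
    unfold Rdiv. rewrite (Rmult_comm (18 * K)).
    apply Rmult_le_compat_l; [|lra]. apply inv_nonneg; lra.
Qed.

(** The factor [1 / pk k] gained by the convolution exactly pays for the derivative [|k|]. No decay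
    remains, but a bound uniform in [k] is enough: in [sol_V_smoothing] the factor [1 / lam] turns
    it into order 4. *)
Lemma Bf_Vbound kap K w k : 0 <= kap -> w (0, 0)%Z = RtoC 0 -> Vbound K w ->
  Cmod (Bf kap w w k) <= 18 * kap * K.
Proof.
  intros Hk H0 HV.
  eapply Rle_trans; [apply (Bf_le kap w w k _ Hk (Vbound_conv K w k H0 HV))|].
  pose proof (nrm_le_pk k). pose proof (pk_ge1 k). pose proof (Vbound_pos _ _ HV).
  replace (18 * kap * K) with (kap * K * 18 * 1) by ring.
  replace (kap * nrm k * (18 * K / pk k)) with (kap * K * 18 * (nrm k / pk k))
    by (unfold Rdiv; ring).
  apply Rmult_le_compat_l; [repeat apply Rmult_le_pos; lra|].
  apply Rmult_le_reg_r with (pk k); [lra|]. unfold Rdiv.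
  rewrite Rmult_assoc, Rinv_l by lra. lra.
Qed.

Lemma Vbound_mode K w k : w (0, 0)%Z = RtoC 0 -> Vbound K w -> Cmod (w k) <= 1 + K.
Proof.
  intros H0 HV. pose proof (Vbound_pos _ _ HV).
  destruct (zz_eq_dec k (0, 0)%Z) as [->|h]; [rewrite H0, Cmod_0; lra|].
  assert (ksq k * Cmod (w k) ^ 2 <= K).
  { apply (lsum_box_single (fun k => ksq k * Cmod (w k) ^ 2)); [|exact HV].
    intros j. apply Rmult_le_pos; [apply ksq_nonneg|apply pow2_ge_0]. }
  pose proof (ksq_ge1 k h). pose proof (Cmod_ge_0 (w k)). nra.
Qed.

Lemma sol_V_smoothing nu kap K G : 0 < nu -> 0 < kap ->
  exists M', forall g v t, sol nu kap g v -> dec 0 G g ->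
    (forall s, t - 1 <= s <= t -> Vbound K (v s)) -> dec 4 M' (v t).
Proof.
  intros Hn Hk.
  exists ((1 + K + G + 18 * kap * K) * (9 / (nu * kap ^ 2))).
  intros g v t Hs Hg Hv k.
  assert (HK : 0 <= K) by (apply (Vbound_pos K (v t)), Hv; lra).
  assert (HG := dec_pos _ _ _ Hg).
  assert (Hk2 := pow_lt kap 2 Hk).
  assert (PP : 0 < 9 / (nu * kap ^ 2)) by (apply Rdiv_lt_0_compat; nra).
  assert (KK : 0 <= kap * K) by nra.
  destruct (zz_eq_dec k (0, 0)%Z) as [->|H0].
  { destruct Hs as [Hs _]. rewrite Hs, Cmod_0. unfold Rdiv at 1.
    apply Rmult_le_pos; [nra|apply Rlt_le, inv_rho_pos]. }
  eapply Rle_trans;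
    [apply (sol_mode_bound nu kap g v k t G (18 * kap * K)); auto|].
  { pose proof (Hg k). simpl in H. lra. }
  { intros s Hs'. apply Bf_Vbound; auto; [lra|]. apply Hs. }
  pose proof (Vbound_mode K (v (t - 1)) k (proj1 Hs _) (Hv (t - 1) ltac:(lra))).
  pose proof (inv_lam_le nu kap k Hn Hk H0). pose proof (lam_pos nu kap k Hn Hk H0).
  assert (0 < / lam nu kap k) by (apply Rinv_0_lt_compat; auto).
  pose proof (Cmod_ge_0 (v (t - 1) k)).
  apply Rle_trans with ((1 + K + G + 18 * kap * K) * (9 / (nu * kap ^ 2) / rho k ^ 4)).
  - apply Rmult_le_compat; lra.
  - unfold Rdiv. lra.
Qed.

Definition locally_dec (m : nat) (v : R -> Z * Z -> C) : Prop :=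
  forall T, exists M, forall t, Rabs t <= T -> dec m M (v t).
Definition locally_V (v : R -> Z * Z -> C) : Prop :=
  forall T, exists M, forall t, Rabs t <= T -> Vbound M (v t).
Definition rapid (g : Z * Z -> C) : Prop := forall m, exists G, dec m G g.

Lemma sol_locally_dec4 nu kap g v : 0 < nu -> 0 < kap -> sol nu kap g v ->
  (exists G, dec 0 G g) -> locally_V v -> locally_dec 4 v.
Proof.
  (* Smoothing looks back one unit of time, hence [T + 1]. *)
  intros Hn Hk Hs [G HG] HV T. destruct (HV (T + 1)) as [K HK].
  destruct (sol_V_smoothing nu kap K G Hn Hk) as [M HM].
  exists M. intros t Ht. apply (HM g v t Hs HG).
  intros s Hs'. apply HK. apply Rabs_le. apply Rabs_le_between in Ht. lra.
Qed.

Lemma sol_locally_dec_step nu kap g v m : 0 < nu -> 0 < kap -> (4 <= m)%nat -> sol nu kap g v ->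
  (exists G, dec (m - 3) G g) -> locally_dec m v -> locally_dec (m + 1) v.
Proof.
  intros Hn Hk Hm Hs [G HG] HV T. destruct (HV (T + 1)) as [K HK].
  destruct (sol_smoothing_step nu kap m K G Hn Hk Hm) as [M HM].
  exists M. intros t Ht. apply (HM g v t Hs HG).
  intros s Hs'. apply HK. apply Rabs_le. apply Rabs_le_between in Ht. lra.
Qed.

(** Two implications feed each other. Decay of [v] of order [m] gives the force order [m - 3] by
    solving backwards from the zero at time 0, and this is exactly the order of the force that the
    smoothing step requires to bring [v] to order [m + 1]. *)
Lemma sol_through_zero_rapid nu kap g v : 0 < nu -> 0 < kap -> sol nu kap g v ->
  g (0, 0)%Z = RtoC 0 -> (exists G, dec 0 G g) -> locally_V v ->
  (forall k, v 0 k = RtoC 0) -> rapid g.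
Proof.
  intros Hn Hk Hs Hg0 HG HV Hv0.
  assert (S1 : forall m, (4 <= m)%nat -> locally_dec m v -> exists G, dec (m - 3) G g).
  { intros m Hm Hd. destruct (Hd 1) as [M HM].
    set (H := kap * (400 * 2 ^ (m - 1) * M * M)).
    assert (M0 : 0 <= M) by (apply (dec_pos m M (v 0)), HM; rewrite Rabs_R0; lra).
    assert (HH : 0 <= H).
    { unfold H. pose proof (pow_lt 2 (m - 1) ltac:(lra)). apply Rmult_le_pos; [lra|].
      rewrite Rmult_assoc. apply Rmult_le_pos; nra. }
    assert (Hk2 := pow_lt kap 2 Hk).
    assert (PP : 0 < 9 / (nu * kap ^ 2)) by (apply Rdiv_lt_0_compat; nra).
    exists (M + (1 + 9 / (nu * kap ^ 2)) * H). intros k.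
    destruct (zz_eq_dec k (0, 0)%Z) as [->|H0].
    { rewrite Hg0, Cmod_0. unfold Rdiv at 1.
      apply Rmult_le_pos; [nra|apply Rlt_le, inv_rho_pos]. }
    eapply Rle_trans.
    { apply (sol_through_zero_force nu kap g v k (H / rho k ^ (m - 3)) Hn Hk Hs (Hv0 k) H0).
      intros s Hs'. apply Bf_dec_drop3; auto; [lra|]. apply HM. apply Rabs_le. lra. }
    assert (Cmod (v (-1) k) <= M / rho k ^ (m - 3)).
    { apply (dec_weaken m); [lia|]. apply HM. apply Rabs_le. lra. }
    pose proof (inv_lam_le nu kap k Hn Hk H0).
    assert (/ lam nu kap k <= 9 / (nu * kap ^ 2)).
    { eapply Rle_trans; [apply H2|]. apply div_rho_pow_le. lra. }
    pose proof (inv_rho_pos k (m - 3)).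
    assert ((1 + / lam nu kap k) * (H / rho k ^ (m - 3)) <=
            (1 + 9 / (nu * kap ^ 2)) * (H / rho k ^ (m - 3))).
    { apply Rmult_le_compat_r; [|lra]. apply Rmult_le_pos; lra. }
    unfold Rdiv in *. lra. }
  assert (S2 : forall n, locally_dec (4 + n) v).
  { induction n as [|n IH].
    - apply (sol_locally_dec4 nu kap g); auto.
    - replace (4 + S n)%nat with (4 + n + 1)%nat by lia.
      apply (sol_locally_dec_step nu kap g); auto; [lia|]. apply S1; auto. lia. }
  intros m. destruct (S1 (m + 4)%nat ltac:(lia)) as [G' HG'].
  - replace (m + 4)%nat with (4 + m)%nat by lia. apply S2.
  - exists G'. apply (dec_weaken (m + 4 - 3)); [lia|exact HG'].
Qed.

Lemma sol_locally_rapid nu kap g v : 0 < nu -> 0 < kap -> sol nu kap g v ->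
  rapid g -> locally_V v -> forall m, locally_dec m v.
Proof.
  intros Hn Hk Hs Hg HV m.
  assert (S2 : forall n, locally_dec (4 + n) v).
  { induction n as [|n IH].
    - apply (sol_locally_dec4 nu kap g); auto.
    - replace (4 + S n)%nat with (4 + n + 1)%nat by lia.
      apply (sol_locally_dec_step nu kap g); auto. lia. }
  intros T. destruct (S2 m T) as [M HM]. exists M. intros t Ht.
  apply (dec_weaken (4 + m)); [lia|auto].
Qed.

(** The order of quantifiers is the point: [M'] is fixed before the trajectory, so the bounds hold
    uniformly over all of them. *)
Lemma sol_uniform_step nu kap g m M : 0 < nu -> 0 < kap -> rapid g -> (4 <= m)%nat ->
  forall n, exists M', forall v, sol nu kap g v -> (forall t, dec m M (v t)) ->
    forall t, dec (m + n) M' (v t).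
Proof.
  intros Hn Hk Hg Hm. induction n as [|n [M1 IH]].
  - exists M. intros v Hs Hd t. now rewrite Nat.add_0_r.
  - destruct (Hg (m + n - 3)%nat) as [G HG].
    destruct (sol_smoothing_step nu kap (m + n) M1 G Hn Hk ltac:(lia)) as [M' HM'].
    exists M'. intros v Hs Hd t. replace (m + S n)%nat with (m + n + 1)%nat by lia.
    apply (HM' g v t Hs HG). auto.
Qed.

Lemma sol_uniform_rapid nu kap g K : 0 < nu -> 0 < kap -> rapid g ->
  forall m, exists M, forall v, sol nu kap g v -> (forall t, Vbound K (v t)) ->
    forall t, dec m M (v t).
Proof.
  intros Hn Hk Hg m. destruct (Hg 0%nat) as [G HG].
  destruct (sol_V_smoothing nu kap K G Hn Hk) as [M4 H4].
  destruct (sol_uniform_step nu kap g 4 M4 Hn Hk Hg ltac:(lia) m) as [M HM].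
  exists M. intros v Hs HV t. apply (dec_weaken (4 + m)); [lia|].
  apply HM; auto. intros s. apply (H4 g v s Hs HG). auto.
Qed.

(** * Cancellation of energy and enstrophy transfer *)

(** All triples of the box are summed and the constraint [m + j + l = 0] is left to the summand, so
    that every permutation of the indices is a plain interchange of finite sums. *)
Definition tsum (F : Z * Z -> Z * Z -> Z * Z -> C) (b : list (Z * Z)) : C :=
  csum (fun m => csum (fun j => csum (fun l => F m j l) b) b) b.

Lemma tsum_ext F G b : (forall m j l, F m j l = G m j l) -> tsum F b = tsum G b.
Proof. intros H. unfold tsum. do 3 (apply csum_ext; intros ? _). apply H. Qed.

Lemma tsum_swap12 F b : tsum F b = tsum (fun m j l => F j m l) b.
Proof. unfold tsum. apply csum_swap. Qed.

Lemma tsum_swap23 F b : tsum F b = tsum (fun m j l => F m l j) b.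
Proof. unfold tsum. apply csum_ext. intros m _. apply csum_swap. Qed.

Lemma tsum_swap13 F b : tsum F b = tsum (fun m j l => F l j m) b.
Proof.
  rewrite tsum_swap12, tsum_swap23, tsum_swap12. reflexivity.
Qed.

Lemma RtoC_m1 : RtoC (-1) = Copp (RtoC 1).
Proof. rewrite <- RtoC_opp. f_equal. Qed.

Lemma tsum_opp F b : tsum (fun m j l => Copp (F m j l)) b = Copp (tsum F b).
Proof.
  unfold tsum. replace (Copp (csum (fun m => csum (fun j => csum (fun l => F m j l) b) b) b))
    with (Cmult (RtoC (-1)) (csum (fun m => csum (fun j => csum (fun l => F m j l) b) b) b)).
  2:{ rewrite RtoC_m1. ring. }
  rewrite <- csum_scal. apply csum_ext; intros m _.
  rewrite <- csum_scal. apply csum_ext; intros j _.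
  rewrite <- csum_scal. apply csum_ext; intros l _. rewrite RtoC_m1. ring.
Qed.

Lemma tsum_plus F G b : tsum (fun m j l => Cplus (F m j l) (G m j l)) b = Cplus (tsum F b) (tsum G b).
Proof.
  unfold tsum. rewrite <- csum_plus. apply csum_ext; intros m _.
  rewrite <- csum_plus. apply csum_ext; intros j _.
  rewrite <- csum_plus. apply csum_ext; intros l _. reflexivity.
Qed.

Lemma Copp_self_0 (a : C) : a = Copp a -> a = RtoC 0.
Proof.
  intros H. destruct a as [x y]. unfold Copp in H. simpl in H. injection H as Hx Hy.
  unfold RtoC. f_equal; lra.
Qed.

Definition zero_sum (m j l : Z * Z) : bool :=
  (Z.eqb (fst m + fst j + fst l) 0 && Z.eqb (snd m + snd j + snd l) 0)%bool.

Lemma zero_sum_iff m j l : zero_sum m j l = true <-> l = zsub (zneg m) j.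
Proof.
  unfold zero_sum, zsub, zneg. rewrite Bool.andb_true_iff, !Z.eqb_eq.
  destruct m, j, l; simpl. split; [intros; f_equal; lia|intros H; injection H; lia].
Qed.

(** The part of the triad interaction that is antisymmetric under every transposition: on
    [m + j + l = 0] one has [perp m j = perp j l = perp l m], and the other factors are
    symmetric. *)
Definition skew (w : Z * Z -> C) (m j l : Z * Z) : C :=
  if zero_sum m j l then
    Cmult (0, perp m j) (Cmult (Cmult (RtoC (/ nrm m)) (w m))
      (Cmult (Cmult (RtoC (/ nrm j)) (w j)) (Cmult (RtoC (/ nrm l)) (w l))))
  else RtoC 0.

Lemma skew_swap12 w m j l : skew w m j l = Copp (skew w j m l).
Proof.
  unfold skew. replace (zero_sum j m l) with (zero_sum m j l)
    by (unfold zero_sum; f_equal; f_equal; ring).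
  destruct (zero_sum m j l); [|ring].
  replace (perp m j) with (- perp j m) by (unfold perp; ring).
  replace (0, - perp j m) with (Copp (0, perp j m)) by (unfold Copp; simpl; f_equal; ring). ring.
Qed.

Lemma skew_swap23 w m j l : skew w m j l = Copp (skew w m l j).
Proof.
  unfold skew. replace (zero_sum m l j) with (zero_sum m j l)
    by (unfold zero_sum; f_equal; f_equal; ring).
  destruct (zero_sum m j l) eqn:E; [|ring].
  apply zero_sum_iff in E.
  replace (perp m j) with (- perp m l).
  2:{ subst l. unfold perp, zsub, zneg; simpl. rewrite !minus_IZR, !opp_IZR. ring. }
  replace (0, - perp m l) with (Copp (0, perp m l)) by (unfold Copp; simpl; f_equal; ring). ring.
Qed.

Lemma skew_swap13 w m j l : skew w m j l = Copp (skew w l j m).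
Proof. rewrite skew_swap12, skew_swap23, skew_swap12. ring. Qed.

Section SkewSums.
Variables (w : Z * Z -> C) (b : list (Z * Z)) (s : Z * Z -> Z * Z -> Z * Z -> R).

(** Exchanging two indices preserves the sum and the weight but reverses [skew], so the sum equals
    its own opposite. *)
Lemma tsum_skew12 : (forall m j l, s m j l = s j m l) ->
  tsum (fun m j l => Cmult (RtoC (s m j l)) (skew w m j l)) b = RtoC 0.
Proof.
  intros H. apply Copp_self_0. rewrite tsum_swap12 at 1. rewrite <- tsum_opp.
  apply tsum_ext; intros m j l. rewrite (skew_swap12 w j m), (H j m). ring.
Qed.

Lemma tsum_skew23 : (forall m j l, s m j l = s m l j) ->
  tsum (fun m j l => Cmult (RtoC (s m j l)) (skew w m j l)) b = RtoC 0.
Proof.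
  intros H. apply Copp_self_0. rewrite tsum_swap23 at 1. rewrite <- tsum_opp.
  apply tsum_ext; intros m j l. rewrite (skew_swap23 w m l), (H m l). ring.
Qed.

Lemma tsum_skew13 : (forall m j l, s m j l = s l j m) ->
  tsum (fun m j l => Cmult (RtoC (s m j l)) (skew w m j l)) b = RtoC 0.
Proof.
  intros H. apply Copp_self_0. rewrite tsum_swap13 at 1. rewrite <- tsum_opp.
  apply tsum_ext; intros m j l. rewrite (skew_swap13 w l j), (H l j). ring.
Qed.
End SkewSums.

(** The Galerkin truncation. The inner sum has at most the single nonzero term [l = k - j]; it
    records that [k - j] must also lie in the box and gives the expression the shape of a sum over
    triads. *)
Definition Btrunc (kap : R) (N : nat) (w : Z * Z -> C) (k : Z * Z) : C :=
  csum (fun j => csum (fun l => if zero_sum (zneg k) j l then Bterm kap w w k j else RtoC 0)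
                      (box N)) (box N).

Lemma nrm_neg k : nrm (zneg k) = nrm k.
Proof. unfold nrm, ksq, zneg; simpl. rewrite !opp_IZR. f_equal. ring. Qed.

Lemma ksq_neg k : ksq (zneg k) = ksq k.
Proof. unfold ksq, zneg; simpl. rewrite !opp_IZR. ring. Qed.

(** With [m + j + l = 0] one has [2 m.l = |j|^2 - |m|^2 - |l|^2]. *)
Lemma Btrunc_tsum kap N w om :
  (forall k, om (zneg k) = om k) ->
  csum (fun k => Cmult (RtoC (om k)) (Cmult (w (zneg k)) (Btrunc kap N w k))) (box N) =
  tsum (fun m j l => Cmult (RtoC (om m * (- kap / 2 * (ksq j - ksq m - ksq l)))) (skew w m j l))
       (box N).
Proof.
  (* Substitution [m = - k], under which the box is invariant. *)
  intros Hom. rewrite <- (csum_perm _ _ _ (box_neg_perm N)), csum_map.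
  unfold tsum. apply csum_ext; intros m _.
  rewrite zneg_inv, Hom. unfold Btrunc. rewrite <- !csum_scal. rewrite zneg_inv.
  apply csum_ext; intros j _. rewrite <- !csum_scal. apply csum_ext; intros l _.
  unfold skew. destruct (zero_sum m j l) eqn:E; [|ring].
  apply zero_sum_iff in E. unfold Bterm. rewrite <- E.
  assert (T : tau kap (zneg m) j =
    (- kap / 2 * (ksq j - ksq m - ksq l)) * perp m j * / nrm m * / nrm j * / nrm l).
  { unfold tau. rewrite <- E, nrm_neg.
    assert (E1 : perp j (zneg m) = perp m j)
      by (unfold perp, zneg; simpl; rewrite !opp_IZR; ring).
    assert (E2 : dot (zneg m) l = - ((ksq j - ksq m - ksq l) / 2)).
    { subst l. unfold dot, ksq, zsub, zneg; simpl. rewrite !minus_IZR, !opp_IZR. field. }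
    rewrite E1, E2. unfold Rdiv. ring. }
  rewrite T. set (c := - kap / 2 * (ksq j - ksq m - ksq l)).
  replace (0, c * perp m j * / nrm m * / nrm j * / nrm l) with
    (Cmult (RtoC c) (Cmult (0, perp m j) (Cmult (RtoC (/ nrm m)) (Cmult (RtoC (/ nrm j))
      (RtoC (/ nrm l)))))).
  2:{ unfold Cmult, RtoC; simpl. f_equal; ring. }
  rewrite RtoC_mult. ring.
Qed.

(** The weight splits into [|j|^2], [|m|^2] and [|l|^2], each symmetric in the two indices that it
    does not involve. *)
Lemma Btrunc_energy kap N w :
  csum (fun k => Cmult (RtoC 1) (Cmult (w (zneg k)) (Btrunc kap N w k))) (box N) = RtoC 0.
Proof.
  rewrite (Btrunc_tsum kap N w (fun _ => 1)) by auto.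
  rewrite (tsum_ext _ (fun m j l =>
    Cplus (Cmult (RtoC (- kap / 2 * ksq j)) (skew w m j l))
      (Cplus (Cmult (RtoC (kap / 2 * ksq m)) (skew w m j l))
             (Cmult (RtoC (kap / 2 * ksq l)) (skew w m j l))))).
  - rewrite !tsum_plus.
    rewrite (tsum_skew13 w (box N) (fun m j l => - kap / 2 * ksq j)) by auto.
    rewrite (tsum_skew23 w (box N) (fun m j l => kap / 2 * ksq m)) by auto.
    rewrite (tsum_skew12 w (box N) (fun m j l => kap / 2 * ksq l)) by auto. ring.
  - intros m j l.
    replace (1 * (- kap / 2 * (ksq j - ksq m - ksq l))) with
      (- kap / 2 * ksq j + (kap / 2 * ksq m + kap / 2 * ksq l)) by field.
    rewrite !RtoC_plus. ring.
Qed.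

(** The planar cancellation: multiplied by [|m|^2], the weight becomes a combination of
    [|m|^2 |j|^2], [|m|^4] and [|m|^2 |l|^2], and each of these is again symmetric in some pair of
    indices. *)
Lemma Btrunc_enstrophy kap N w :
  csum (fun k => Cmult (RtoC (ksq k)) (Cmult (w (zneg k)) (Btrunc kap N w k))) (box N) = RtoC 0.
Proof.
  rewrite (Btrunc_tsum kap N w ksq) by apply ksq_neg.
  rewrite (tsum_ext _ (fun m j l =>
    Cplus (Cmult (RtoC (- kap / 2 * (ksq m * ksq j))) (skew w m j l))
      (Cplus (Cmult (RtoC (kap / 2 * ksq m ^ 2)) (skew w m j l))
             (Cmult (RtoC (kap / 2 * (ksq m * ksq l))) (skew w m j l))))).
  - rewrite !tsum_plus.
    rewrite (tsum_skew12 w (box N) (fun m j l => - kap / 2 * (ksq m * ksq j)))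
      by (intros; ring).
    rewrite (tsum_skew23 w (box N) (fun m j l => kap / 2 * ksq m ^ 2)) by auto.
    rewrite (tsum_skew13 w (box N) (fun m j l => kap / 2 * (ksq m * ksq l)))
      by (intros; ring). ring.
  - intros m j l.
    replace (ksq m * (- kap / 2 * (ksq j - ksq m - ksq l))) with
      (- kap / 2 * (ksq m * ksq j) + (kap / 2 * ksq m ^ 2 + kap / 2 * (ksq m * ksq l))) by field.
    rewrite !RtoC_plus. ring.
Qed.

Lemma csum_filter {A} (P : A -> bool) (f : A -> C) l :
  csum (fun x => if P x then f x else RtoC 0) l = csum f (filter P l).
Proof.
  induction l as [|a l IH]; simpl; [reflexivity|]. rewrite IH. destruct (P a); simpl; ring.
Qed.

Definition inb (N : nat) (k : Z * Z) : bool :=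
  if in_dec zz_eq_dec k (box N) then true else false.

Lemma inb_true N k : inb N k = true <-> In k (box N).
Proof. unfold inb. destruct in_dec; split; auto; discriminate. Qed.

Lemma csum_inb N n f : (N <= n)%nat ->
  csum (fun x => if inb N x then f x else RtoC 0) (box n) = csum f (box N).
Proof.
  intros H. rewrite csum_filter. apply csum_perm. apply NoDup_Permutation.
  - apply NoDup_filter, NoDup_box.
  - apply NoDup_box.
  - intros x. rewrite filter_In, inb_true. pose proof (proj2 exhaust_box N n H x). tauto.
Qed.

Lemma csum_single N x (c : C) (P : Z * Z -> bool) :
  (forall l, P l = true <-> l = x) ->
  csum (fun l => if P l then c else RtoC 0) (box N) = if inb N x then c else RtoC 0.
Proof.
  intros HP. rewrite csum_filter.
  destruct (inb N x) eqn:E.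
  - transitivity (csum (fun _ : Z * Z => c) [x]); [|simpl; ring].
    apply csum_perm, NoDup_Permutation.
    + apply NoDup_filter, NoDup_box.
    + repeat constructor; simpl; tauto.
    + intros y. rewrite filter_In, HP. apply inb_true in E. simpl. split.
      * intros [_ ->]; auto.
      * intros [<-|[]]; auto.
  - destruct (filter P (box N)) as [|y t] eqn:F; [reflexivity|exfalso].
    assert (H : In y (filter P (box N))) by (rewrite F; now left).
    apply filter_In in H. destruct H as [H1 H2]. apply HP in H2. subst y.
    apply inb_true in H1. congruence.
Qed.

Lemma pk_outside N k : inb N k = false -> INR N <= pk k.
Proof.
  intros H. destruct (Rle_or_lt (INR N) (pk k)) as [h|h]; [exact h|exfalso].
  assert (inb N k = true); [|congruence]. apply inb_true, in_box.
  unfold pk in h. rewrite <- !abs_IZR in h. rewrite INR_IZR_INZ in h.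
  pose proof (IZR_le 0 (Z.abs (fst k)) ltac:(lia)). pose proof (IZR_le 0 (Z.abs (snd k)) ltac:(lia)).
  split; apply Z.lt_le_incl, lt_IZR; lra.
Qed.

(** As a lattice series with an indicator, the truncation can be subtracted from [Bf] term by term;
    its partial sums are constant from the box of size [N] on. *)
Lemma Btrunc_Csum kap N w k :
  Btrunc kap N w k =
  Csum box (fun j => if (inb N j && inb N (zsub k j))%bool then Bterm kap w w k j else RtoC 0).
Proof.
  symmetry. apply Csum_unique. eapply clim_ext_loc; [|apply clim_const].
  exists N. intros n Hn. unfold Btrunc.
  rewrite <- (csum_inb N n _ Hn). apply csum_ext. intros j _.
  rewrite (csum_single N (zsub k j)).
  - destruct (inb N j), (inb N (zsub k j)); reflexivity.
  - intros l. rewrite zero_sum_iff, zneg_inv. tauto.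
Qed.

(** A discarded term has [j] or [k - j] outside the box, where [pk >= N]. Spending one factor [pk],
    that is two of the seven orders, buys [1 / N] and leaves order 5 for the convolution. The
    constant is twice [400 * 2 ^ 5], one share for each factor that may lie outside. *)
Lemma Btrunc_error kap N w k M : 0 <= kap -> (0 < N)%nat -> dec 7 M w ->
  Cmod (Cminus (Bf kap w w k) (Btrunc kap N w k)) <=
  kap * nrm k * (25600 * M ^ 2 / rho k ^ 5 / INR N).
Proof.
  intros Hk HN Hw.
  assert (IN : 0 < INR N) by (apply lt_0_INR; lia).
  assert (M0 := dec_pos _ _ _ Hw).
  assert (Hw5 : dec 5 M w) by (apply (dec_weaken 7); [lia|exact Hw]).
  set (chi := fun j => (inb N j && inb N (zsub k j))%bool).
  replace (Btrunc kap N w k) with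
    (Csum box (fun j => if chi j then Bterm kap w w k j else RtoC 0))
    by (symmetry; apply Btrunc_Csum).
  assert (A := Bterm_dec_bounded kap M M w w k Hk Hw5 Hw5).
  set (S := kap * nrm k * (400 * 2 ^ 5 * M * M / rho k ^ 5)) in A.
  assert (A2 : abs_bounded box (fun j => Cmult (RtoC (-1)) (if chi j then Bterm kap w w k j else RtoC 0)) S).
  { apply (abs_bounded_le _ _ (Bterm kap w w k)); [|exact A]. intros j.
    rewrite Cmod_mult, RtoC_m1, Cmod_opp, Cmod_1, Rmult_1_l. destruct (chi j); [lra|].
    rewrite Cmod_0. apply Cmod_ge_0. }
  assert (A3 : abs_bounded box (fun j => if chi j then Bterm kap w w k j else RtoC 0) S).
  { apply (abs_bounded_le _ _ (Bterm kap w w k)); [|exact A]. intros j.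
    destruct (chi j); [lra|]. rewrite Cmod_0. apply Cmod_ge_0. }
  replace (Cminus (Bf kap w w k) (Csum box (fun j => if chi j then Bterm kap w w k j else RtoC 0)))
    with (Csum box (fun j => Cplus (Bterm kap w w k j)
           (Cmult (RtoC (-1)) (if chi j then Bterm kap w w k j else RtoC 0)))).
  2:{ rewrite (Csum_plus box _ _ _ _ exhaust_box A A2), (Csum_scal box _ _ _ exhaust_box A3).
      unfold Bf. rewrite RtoC_m1. ring. }
  apply Csum_bound; [apply exhaust_box|].
  set (h := fun j => pk j * Cmod (w j)).
  assert (Hh : forall j, 0 <= h j <= M / rho j ^ 5).
  { intros j. unfold h. pose proof (pk_ge1 j). pose proof (Cmod_ge_0 (w j)). split; [nra|].
    pose proof (Hw j). rewrite <- rho_sq in *. pose proof (rho_ge1 j).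
    replace (M / rho j ^ 5) with (rho j ^ 2 * (M / rho j ^ 7)) by (field; lra).
    apply Rmult_le_compat_l; lra. }
  assert (Hc : forall j, 0 <= Cmod (w j) <= M / rho j ^ 5) by (intros j; split; [apply Cmod_ge_0|apply Hw5]).
  apply (abs_bounded_lsum _ _ (fun j => kap * nrm k * / INR N *
    (h j * Cmod (w (zsub k j)) + Cmod (w j) * h (zsub k j)))).
  - intros j.
    pose proof (nrm_nonneg k). pose proof (Hh j). pose proof (Hh (zsub k j)).
    pose proof (Hc j). pose proof (Hc (zsub k j)).
    assert (0 < / INR N) by (now apply Rinv_0_lt_compat).
    destruct (chi j) eqn:E.
    + replace (Cplus (Bterm kap w w k j) (Cmult (RtoC (-1)) (Bterm kap w w k j))) with (RtoC 0)
        by (rewrite RtoC_m1; ring).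
      rewrite Cmod_0. repeat apply Rmult_le_pos; try lra.
      apply Rplus_le_le_0_compat; apply Rmult_le_pos; lra.
    + replace (Cplus (Bterm kap w w k j) (Cmult (RtoC (-1)) (RtoC 0))) with (Bterm kap w w k j) by ring.
      eapply Rle_trans; [apply Bterm_le; exact Hk|].
      rewrite (Rmult_assoc (kap * nrm k) (/ INR N)). apply Rmult_le_compat_l; [nra|].
      apply Rmult_le_reg_l with (INR N); [exact IN|].
      rewrite <- Rmult_assoc, <- (Rmult_assoc (INR N)), Rinv_r, Rmult_1_l by lra.
      unfold h in *. pose proof (pk_ge1 j). pose proof (pk_ge1 (zsub k j)).
      set (a := Cmod (w j)) in *. set (b := Cmod (w (zsub k j))) in *.
      set (x := pk j) in *. set (y := pk (zsub k j)) in *.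
      assert (AB : 0 <= a * b) by nra.
      assert (INR N <= x \/ INR N <= y) as [?|?].
      { unfold chi in E. apply Bool.andb_false_iff in E.
        destruct E as [E|E]; [left|right]; now apply pk_outside. }
      * assert (INR N * (a * b) <= x * (a * b)) by (apply Rmult_le_compat_r; lra).
        assert (0 <= y * (a * b)) by nra. lra.
      * assert (INR N * (a * b) <= y * (a * b)) by (apply Rmult_le_compat_r; lra).
        assert (0 <= x * (a * b)) by nra. lra.
  - intros n. rewrite lsum_scal, lsum_plus.
    pose proof (conv_bound 5 5 k n h (fun j => Cmod (w j)) M M ltac:(lia) ltac:(lia) Hh Hc).
    pose proof (conv_bound 5 5 k n (fun j => Cmod (w j)) h M M ltac:(lia) ltac:(lia) Hc Hh).
    cbv beta in H, H0. pose proof (nrm_nonneg k).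
    assert (0 < / INR N) by (now apply Rinv_0_lt_compat).
    replace (kap * nrm k * (25600 * M ^ 2 / rho k ^ 5 / INR N)) with
      (kap * nrm k * / INR N * (2 * (400 * 2 ^ 5 * M * M / rho k ^ 5))) by (unfold Rdiv; ring).
    apply Rmult_le_compat_l; [repeat apply Rmult_le_pos; lra|lra].
Qed.

(** The reality condition on the field in scalar form; the sign comes from
    [(- k)^perp = - k^perp]. *)
Definition antireal (w : Z * Z -> C) : Prop := forall k, w (zneg k) = Copp (Cconj (w k)).

Definition flux (kap : R) (om : Z * Z -> R) (N : nat) (w : Z * Z -> C) : R :=
  lsum (fun k => om k * Re (Cmult (Cconj (w k)) (Bf kap w w k))) (box N).

(** By [antireal] the conjugate of [w k] is [- w (- k)], so the vanishing truncated sum can be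
    subtracted and only the truncation error is left. In powers of [rho] the balance is 4 from [om],
    minus 7 from [w], 2 from [|k|], minus 5 from the error: a summable order 6, with lattice sum at
    most 100. *)
Lemma flux_le kap om N w M : 0 <= kap -> (0 < N)%nat -> dec 7 M w -> antireal w ->
  (forall k, 0 <= om k <= pk k ^ 2) ->
  csum (fun k => Cmult (RtoC (om k)) (Cmult (w (zneg k)) (Btrunc kap N w k))) (box N) = RtoC 0 ->
  Rabs (flux kap om N w) <= 2560000 * kap * M ^ 3 / INR N.
Proof.
  intros Hk HN Hw Hr Hom H0.
  assert (IN : 0 < INR N) by (apply lt_0_INR; lia).
  assert (M0 := dec_pos _ _ _ Hw).
  assert (E : flux kap om N w = Re (csum (fun k => Cmult (RtoC (om k))
     (Cmult (Cconj (w k)) (Cminus (Bf kap w w k) (Btrunc kap N w k)))) (box N))).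
  { transitivity (Re (csum (fun k => Cplus (Cmult (RtoC (om k)) (Cmult (Cconj (w k)) (Bf kap w w k)))
       (Cmult (RtoC (om k)) (Cmult (w (zneg k)) (Btrunc kap N w k)))) (box N))).
    - rewrite csum_plus, H0. rewrite Cplus_0_r, csum_Re. unfold flux.
      apply lsum_ext. intros k _.
      set (z := Cmult (Cconj (w k)) (Bf kap w w k)). unfold Re; simpl. ring.
    - f_equal. apply csum_ext. intros k _. rewrite Hr. ring. }
  rewrite E. eapply Rle_trans; [apply Re_le_Cmod|]. eapply Rle_trans; [apply csum_Cmod|].
  apply Rle_trans with (lsum (fun k => (kap * (25600 * M ^ 3 / INR N)) * / rho k ^ 6) (box N)).
  2:{ rewrite lsum_scal. replace (2560000 * kap * M ^ 3 / INR N) with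
        ((kap * (25600 * M ^ 3 / INR N)) * 100) by (unfold Rdiv; ring).
      apply Rmult_le_compat_l; [|apply lsum_inv_rho; lia].
      pose proof (pow_le M 3 M0). apply Rmult_le_pos; [lra|].
      apply Rmult_le_pos; [lra|apply inv_nonneg; lra]. }
  apply lsum_le. intros k _. rewrite !Cmod_mult, Cmod_conj, Cmod_R.
  destruct (Hom k) as [o1 o2]. rewrite Rabs_pos_eq by exact o1.
  pose proof (Btrunc_error kap N w k M Hk HN Hw) as Be.
  pose proof (rho_ge1 k). pose proof (Hw k). pose proof (nrm_le_pk k). pose proof (nrm_nonneg k).
  rewrite <- rho_sq in *.
  apply Rle_trans with ((rho k ^ 2) ^ 2 * ((M / rho k ^ 7) *
    (kap * rho k ^ 2 * (25600 * M ^ 2 / rho k ^ 5 / INR N)))).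
  - assert (0 <= 25600 * M ^ 2 / rho k ^ 5 / INR N).
    { repeat apply Rmult_le_pos; try lra; try (apply Rlt_le, Rinv_0_lt_compat); try lra; try nra.
      apply pow_lt; lra. }
    apply Rmult_le_compat; [lra| |lra|].
    + apply Rmult_le_pos; apply Cmod_ge_0.
    + apply Rmult_le_compat; [apply Cmod_ge_0|apply Cmod_ge_0|lra|].
      eapply Rle_trans; [exact Be|]. apply Rmult_le_compat_r; [lra|].
      apply Rmult_le_compat_l; lra.
  - apply Req_le. field. split; lra.
Qed.

(** * Uniform enstrophy bound for bounded complete trajectories *)

Definition wsum (om : Z * Z -> R) (N : nat) (w : Z * Z -> C) : R :=
  lsum (fun k => om k * Cmod (w k) ^ 2) (box N).

Lemma is_derive_lsum {A} (f : A -> R -> R) (f' : A -> R) t l :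
  (forall k, is_derive (f k) t (f' k)) ->
  is_derive (fun s => lsum (fun k => f k s) l) t (lsum f' l).
Proof.
  intros H. induction l as [|a l IH]; simpl.
  - apply (is_derive_const 0).
  - apply (is_derive_plus (f a) (fun s => lsum (fun k => f k s) l)); auto.
Qed.

Lemma dC_Cmod2 f t d : dC f t d ->
  is_derive (fun s => Cmod (f s) ^ 2) t (2 * Re (Cmult (Cconj (f t)) d)).
Proof.
  intros [H1 H2]. apply (is_derive_ext (fun s => Re (f s) ^ 2 + Im (f s) ^ 2)).
  { intros s. symmetry. apply Cmod2. }
  rewrite Re_conj_mult.
  evar_last.
  - apply (is_derive_plus (fun s => Re (f s) ^ 2) (fun s => Im (f s) ^ 2));
    [apply (is_derive_pow (fun s => Re (f s)) 2 t _ H1)|apply (is_derive_pow (fun s => Im (f s)) 2 t _ H2)].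
  - unfold plus; simpl. ring.
Qed.

Lemma dC_wsum nu kap g v om N t : sol nu kap g v ->
  is_derive (fun s => wsum om N (v s)) t
    (lsum (fun k => om k * (2 * Re (Cmult (Cconj (v t k)) (rhs nu kap g (v t) k)))) (box N)).
Proof.
  intros [_ H]. unfold wsum. apply is_derive_lsum. intros k.
  apply (is_derive_scal (fun s => Cmod (v s k) ^ 2)).
  apply (dC_Cmod2 (fun s => v s k)). apply H.
Qed.

Lemma Re_conj_rhs nu kap g w k :
  2 * Re (Cmult (Cconj (w k)) (rhs nu kap g w k)) =
  2 * Re (Cmult (Cconj (w k)) (g k)) - 2 * lam nu kap k * Cmod (w k) ^ 2
  - 2 * Re (Cmult (Cconj (w k)) (Bf kap w w k)).
Proof.
  rewrite Cmod2. rewrite !Re_conj_mult. unfold rhs, Re, Im; simpl. ring.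
Qed.

Lemma Re_conj_mult_le (a b : C) : Re (Cmult (Cconj a) b) <= Cmod a * Cmod b.
Proof. rewrite Re_conj_mult. apply Re_conj_le. Qed.

Section Dissipation.
Variables (nu kap M : R) (g : Z * Z -> C) (w : Z * Z -> C) (N : nat).
Hypotheses (Hn : 0 < nu) (Hk : 0 < kap) (HN : (0 < N)%nat) (Hd : dec 7 M w) (Hr : antireal w).

(** Young's inequality spends half of the dissipation [2 mu |k|^4 |w k|^2] on the force. The other
    half controls the enstrophy since [|k|^4 >= |k|^2] on the integer lattice, the Poincare
    inequality in this setting. *)
Lemma enstrophy_dissipation :
  lsum (fun k => ksq k * (2 * Re (Cmult (Cconj (w k)) (rhs nu kap g w k)))) (box N) <=
  - (nu * kap ^ 2) * wsum ksq N w + lsum (fun k => Cmod (g k) ^ 2) (box N) / (nu * kap ^ 2)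
  + 2 * (2560000 * kap * M ^ 3 / INR N).
Proof.
  assert (Hk2 := pow_lt kap 2 Hk). set (mu := nu * kap ^ 2).
  assert (Hmu : 0 < mu) by (unfold mu; nra).
  assert (F := flux_le kap ksq N w M ltac:(lra) HN Hd Hr
    (fun k => conj (ksq_nonneg k) (ksq_le_pk k)) (Btrunc_enstrophy kap N w)).
  pose proof (Rabs_le_between (flux kap ksq N w) (2560000 * kap * M ^ 3 / INR N)) as [F' _].
  specialize (F' F).
  apply Rle_trans with (lsum (fun k => - mu * (ksq k * Cmod (w k) ^ 2)
    + (/ mu * Cmod (g k) ^ 2 + (-2) * (ksq k * Re (Cmult (Cconj (w k)) (Bf kap w w k))))) (box N)).
  - apply lsum_le. intros k _. rewrite Re_conj_rhs.
    pose proof (Re_conj_mult_le (w k) (g k)).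
    set (a := Cmod (w k)) in *. set (b := Cmod (g k)) in *. set (q := ksq k).
    assert (Hq : q * q >= q).
    { unfold q. destruct (zz_eq_dec k (0, 0)%Z) as [->|h].
      - unfold ksq; simpl. lra.
      - pose proof (ksq_ge1 k h). nra. }
    assert (q0 : 0 <= q) by apply ksq_nonneg.
    assert (L : lam nu kap k = mu * q) by reflexivity. rewrite L.
    assert (Y : 2 * (q * (a * b)) <= mu * (q * q) * a ^ 2 + / mu * b ^ 2).
    { pose proof (pow2_ge_0 (mu * q * a - b)).
      apply Rmult_le_reg_l with mu; [exact Hmu|].
      replace (mu * (mu * (q * q) * a ^ 2 + / mu * b ^ 2)) with
        (mu * mu * (q * q) * a ^ 2 + b ^ 2) by (field; lra). nra. }
    assert (Z1 : 0 <= mu * a ^ 2) by (apply Rmult_le_pos; [lra|apply pow2_ge_0]).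
    assert (q * Re (Cmult (Cconj (w k)) (g k)) <= q * (a * b)) by (apply Rmult_le_compat_l; lra).
    assert (mu * q * a ^ 2 <= mu * (q * q) * a ^ 2) by nra.
    nra.
  - rewrite !lsum_plus, !lsum_scal. unfold flux in F'. unfold wsum, Rdiv in *. lra.
Qed.

(** Here the whole dissipation is kept. The work of the force is estimated crudely by
    [|g|^2 + |w|^2], which suffices because the energy of the trajectories considered is bounded for
    all times. *)
Lemma energy_dissipation :
  lsum (fun k => 1 * (2 * Re (Cmult (Cconj (w k)) (rhs nu kap g w k)))) (box N) <=
  - (2 * (nu * kap ^ 2)) * wsum ksq N w + lsum (fun k => Cmod (g k) ^ 2) (box N)
  + wsum (fun _ => 1) N w + 2 * (2560000 * kap * M ^ 3 / INR N).
Proof.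
  assert (Hk2 := pow_lt kap 2 Hk). set (mu := nu * kap ^ 2).
  assert (Hmu : 0 < mu) by (unfold mu; nra).
  assert (F := flux_le kap (fun _ => 1) N w M ltac:(lra) HN Hd Hr
    (fun k => ltac:(pose proof (pk_ge1 k); nra)) (Btrunc_energy kap N w)).
  pose proof (Rabs_le_between (flux kap (fun _ => 1) N w) (2560000 * kap * M ^ 3 / INR N)) as [F' _].
  specialize (F' F).
  apply Rle_trans with (lsum (fun k => - (2 * mu) * (ksq k * Cmod (w k) ^ 2)
    + (Cmod (g k) ^ 2 + (1 * Cmod (w k) ^ 2 +
       (-2) * (1 * Re (Cmult (Cconj (w k)) (Bf kap w w k)))))) (box N)).
  - apply lsum_le. intros k _. rewrite Re_conj_rhs.
    pose proof (Re_conj_mult_le (w k) (g k)).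
    assert (L : lam nu kap k = mu * ksq k) by reflexivity. rewrite L.
    pose proof (pow2_ge_0 (Cmod (w k) - Cmod (g k))). nra.
  - rewrite !lsum_plus, !lsum_scal. unfold flux in F'. rewrite lsum_scal in F'.
    unfold wsum, Rdiv in *. rewrite lsum_scal. lra.
Qed.
End Dissipation.

(** An enstrophy above the threshold grows exponentially backward in time, which
    makes the energy decrease at a fixed rate there: impossible for bounded energy. *)
Lemma sol_V_uniform nu kap g G0 : 0 < nu -> 0 < kap ->
  (forall N, lsum (fun k => Cmod (g k) ^ 2) (box N) <= G0) ->
  exists K, forall v, sol nu kap g v -> (forall t, antireal (v t)) -> locally_dec 7 v ->
    (exists ME, forall t N, wsum (fun _ => 1) N (v t) <= ME) -> forall t, Vbound K (v t).
Proof.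
  intros Hn Hk HG.
  assert (Hk2 := pow_lt kap 2 Hk). set (mu := nu * kap ^ 2).
  assert (Hmu : 0 < mu) by (unfold mu; nra).
  assert (G0p : 0 <= G0).
  { eapply Rle_trans; [|apply (HG 0%nat)]. apply lsum_nonneg. intros; apply pow2_ge_0. }
  (* The extra 1 absorbs the flux error of the truncated balance once [N] is large. *)
  set (F := G0 / mu + 1).
  assert (HF : 0 < F).
  { unfold F. assert (0 <= G0 / mu) by (apply Rmult_le_pos; [lra|apply inv_nonneg; lra]). lra. }
  exists (F / mu + 1). intros v Hs Hr Hd [ME HME] t1 N1.
  destruct (Rle_or_lt (lsum (fun k => ksq k * Cmod (v t1 k) ^ 2) (box N1)) (F / mu + 1))
    as [h|h]; [exact h|exfalso].
  assert (ME0 : 0 <= ME).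
  { eapply Rle_trans; [|apply (HME 0 0%nat)]. apply lsum_nonneg. intros.
    rewrite Rmult_1_l. apply pow2_ge_0. }
  (* At times before [t1 - T0] the dissipation [2 * mu * wsum ksq] exceeds [A], so the energy has
     slope at most [- A + G0 + ME + 1 = - 1]. Over a time [T1] it would fall by [ME + 1], more than
     is available. *)
  set (A := ME + G0 + 2). set (T0 := A / (2 * mu ^ 2)). set (T1 := ME + 1).
  assert (HT0 : 0 < T0) by (unfold T0, A; apply Rdiv_lt_0_compat; nra).
  (* This decay constant depends on the trajectory and on the window. It enters only through the
     flux error, which a large [N] makes smaller than 1, and not through the resulting bound. *)
  destruct (Hd (Rabs t1 + T0 + T1)) as [M HM].
  assert (HMt : forall s, t1 - T0 - T1 <= s <= t1 -> dec 7 M (v s)).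
  { intros s Hs'. apply HM. apply Rabs_le. pose proof (Rle_abs t1). pose proof (Rle_abs (- t1)).
    rewrite Rabs_Ropp in H0. unfold T1 in *. lra. }
  set (c := 2560000 * kap * M ^ 3).
  assert (M0 : 0 <= M) by (apply (dec_pos 7 M (v t1)), HMt; unfold T1; lra).
  assert (c0 : 0 <= c) by (unfold c; pose proof (pow_le M 3 M0); apply Rmult_le_pos; lra).
  destruct (INR_unbounded (2 * c)) as [N2 HN2].
  set (N := (N1 + N2 + 1)%nat).
  assert (IN : 2 * c < INR N).
  { eapply Rlt_le_trans; [exact HN2|]. apply le_INR. unfold N. lia. }
  assert (cN : 2 * (c / INR N) <= 1).
  { apply Rmult_le_reg_r with (INR N); [lra|]. unfold Rdiv.
    replace (2 * (c * / INR N) * INR N) with (2 * c) by (field; lra). lra. }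
  assert (Zt1 : F / mu + 1 < wsum ksq N (v t1)).
  { eapply Rlt_le_trans; [exact h|]. unfold wsum. apply lsum_incl.
    - apply NoDup_box.
    - apply exhaust_box. unfold N; lia.
    - intros k _. apply Rmult_le_pos; [apply ksq_nonneg|apply pow2_ge_0]. }
  assert (HNp : (0 < N)%nat) by (unfold N; lia).
  (* The excess over [F / mu] is at least 1 at [t1], and read backwards the Gronwall inequality
     makes it grow exponentially. *)
  assert (Zs : forall s, t1 - T0 - T1 <= s <= t1 -> exp (mu * (t1 - s)) <= wsum ksq N (v s)).
  { intros s Hs'.
    assert (U := linear_ode_upper (fun s => wsum ksq N (v s)) _ mu F s t1 Hmu ltac:(lra)
      (fun r _ => dC_wsum nu kap g v ksq N r Hs)).
    assert (U' : wsum ksq N (v t1) <=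
      exp (- (mu * (t1 - s))) * (wsum ksq N (v s) - F / mu) + F / mu).
    { apply U. intros r Hr'.
      pose proof (enstrophy_dissipation nu kap M g (v r) N Hn Hk HNp (HMt r ltac:(lra)) (Hr r)).
      fold mu in H. fold c in H.
      assert (lsum (fun k => Cmod (g k) ^ 2) (box N) / mu <= G0 / mu)
        by (apply Rmult_le_compat_r; [apply inv_nonneg; lra|apply HG]).
      unfold F. lra. }
    assert (E : exp (mu * (t1 - s)) * exp (- (mu * (t1 - s))) = 1).
    { rewrite <- exp_plus, <- exp_0. f_equal. ring. }
    pose proof (exp_pos (mu * (t1 - s))). pose proof (exp_pos (- (mu * (t1 - s)))).
    assert (Fm : 0 <= F / mu) by (apply Rmult_le_pos; [lra|apply inv_nonneg; lra]).
    set (e := exp (mu * (t1 - s))) in *. set (e' := exp (- (mu * (t1 - s)))) in *.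
    set (z := wsum ksq N (v s)) in *.
    assert (1 <= e' * (z - F / mu)) by lra.
    assert (e * 1 <= e * (e' * (z - F / mu))) by (apply Rmult_le_compat_l; lra).
    rewrite <- Rmult_assoc, E in H2. lra. }
  assert (X : wsum (fun _ => 1) N (v (t1 - T0)) + (t1 - T0) <=
              wsum (fun _ => 1) N (v (t1 - T0 - T1)) + (t1 - T0 - T1)).
  { apply (is_derive_nonpos_decr (fun s => wsum (fun _ => 1) N (v s) + s)
      (fun t => lsum (fun k => 1 * (2 * Re (Cmult (Cconj (v t k)) (rhs nu kap g (v t) k)))) (box N)
       + 1)).
    - unfold T1; lra.
    - intros s _. apply (is_derive_plus (fun s => wsum (fun _ => 1) N (v s)) (fun s => s)).
      + now apply dC_wsum.
      + apply (is_derive_id s).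
    - intros s Hs'.
      pose proof (energy_dissipation nu kap M g (v s) N Hn Hk HNp (HMt s ltac:(lra)) (Hr s)).
      fold mu in H. fold c in H.
      pose proof (HG N). pose proof (HME s N). pose proof (Zs s ltac:(lra)).
      pose proof (exp_ineq1_le (mu * (t1 - s))).
      assert (A <= 2 * mu * (mu * (t1 - s))).
      { replace A with (2 * mu * (mu * T0)) by (unfold T0; field; lra).
        apply Rmult_le_compat_l; [lra|]. apply Rmult_le_compat_l; lra. }
      assert (2 * mu * (mu * (t1 - s)) <= 2 * mu * wsum ksq N (v s))
        by (apply Rmult_le_compat_l; lra).
      unfold A in *. lra. }
  pose proof (HME (t1 - T0 - T1) N).
  assert (0 <= wsum (fun _ => 1) N (v (t1 - T0))).
  { apply lsum_nonneg. intros. rewrite Rmult_1_l. apply pow2_ge_0. }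
  unfold T1 in *. lra.
Qed.

(** * Time differentiation in weighted sup norms *)

Lemma dec_plus m M M' w w' : dec m M w -> dec m M' w' ->
  dec m (M + M') (fun k => Cplus (w k) (w' k)).
Proof.
  intros H H' k. eapply Rle_trans; [apply Cmod_triangle|].
  pose proof (H k). pose proof (H' k). unfold Rdiv in *. lra.
Qed.

Lemma dec_scal m M c w : dec m M w -> dec m (Cmod c * M) (fun k => Cmult c (w k)).
Proof.
  intros H k. rewrite Cmod_mult. unfold Rdiv. rewrite Rmult_assoc.
  apply Rmult_le_compat_l; [apply Cmod_ge_0|apply H].
Qed.

Lemma dec_minus m M M' w w' : dec m M w -> dec m M' w' ->
  dec m (M + M') (fun k => Cminus (w k) (w' k)).
Proof.
  intros H H' k. eapply Rle_trans; [apply Cmod_minus_le|].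
  pose proof (H k). pose proof (H' k). unfold Rdiv in *. lra.
Qed.

Lemma dec_ext m M w w' : (forall k, w k = w' k) -> dec m M w -> dec m M w'.
Proof. intros E H k. rewrite <- E. apply H. Qed.

Lemma dec_0 m : dec m 0 (fun _ => RtoC 0).
Proof. intros k. rewrite Cmod_0. unfold Rdiv. rewrite Rmult_0_l. lra. Qed.

Lemma lam_le nu kap k : 0 < nu -> 0 < kap -> 0 <= lam nu kap k <= nu * kap ^ 2 * rho k ^ 4.
Proof.
  intros Hn Hk. unfold lam. pose proof (pow_lt kap 2 Hk). pose proof (ksq_nonneg k).
  split; [apply Rmult_le_pos; nra|]. apply Rmult_le_compat_l; [nra|].
  replace (rho k ^ 4) with (pk k ^ 2) by (rewrite <- rho_sq; ring). apply ksq_le_pk.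
Qed.

Lemma dec_lam nu kap m M w : 0 < nu -> 0 < kap -> dec (m + 4) M w ->
  dec m (nu * kap ^ 2 * M) (fun k => Cmult (RtoC (lam nu kap k)) (w k)).
Proof.
  intros Hn Hk H k. destruct (lam_le nu kap k Hn Hk) as [l1 l2].
  rewrite Cmod_mult, Cmod_R, Rabs_pos_eq by exact l1.
  pose proof (H k). pose proof (rho_ge1 k).
  replace (nu * kap ^ 2 * M / rho k ^ m) with ((nu * kap ^ 2 * rho k ^ 4) * (M / rho k ^ (m + 4))).
  - apply Rmult_le_compat; auto. apply Cmod_ge_0.
  - rewrite pow_add. field. split; try apply pow_nonzero; lra.
Qed.

Definition cB (kap : R) (m : nat) : R := kap * (400 * 2 ^ (m + 5)).

Lemma cB_pos kap m : 0 < kap -> 0 < cB kap m.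
Proof. intros H. unfold cB. pose proof (pow_lt 2 (m + 5) ltac:(lra)). nra. Qed.

(** Five orders are given up for a uniform statement in [m]; this is harmless in this part, where
    every order is at hand. *)
Lemma dec_Bf kap m M M' w v : 0 < kap -> dec (m + 5) M w -> dec (m + 5) M' v ->
  dec m (cB kap m * M * M') (Bf kap w v).
Proof.
  intros Hk H H' k. pose proof (dec_pos _ _ _ H). pose proof (dec_pos _ _ _ H').
  eapply Rle_trans.
  { apply (Bf_dec kap (m + 5) (m + 5) M M'); auto; [lra|lia]. }
  pose proof (nrm_le_pk k). rewrite <- rho_sq in H2. pose proof (nrm_nonneg k).
  pose proof (pow_lt 2 (m + 5) ltac:(lra)). pose proof (rho_ge1 k).
  apply Rle_trans with (kap * rho k ^ 2 * (400 * 2 ^ (m + 5) * M * M' / rho k ^ (m + 5))).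
  - apply Rmult_le_compat_r; [|nra].
    unfold Rdiv. repeat apply Rmult_le_pos; try lra. apply Rlt_le, inv_rho_pos.
  - unfold cB. rewrite (pow_add (rho k)).
    replace (kap * rho k ^ 2 * (400 * 2 ^ (m + 5) * M * M' / (rho k ^ m * rho k ^ 5))) with
      (kap * (400 * 2 ^ (m + 5)) * M * M' / rho k ^ m * / rho k ^ 3).
    2:{ field. split; try apply pow_nonzero; lra. }
    apply (div_rho_pow_le k 3).
    unfold Rdiv. repeat apply Rmult_le_pos; try lra. apply Rlt_le, inv_rho_pos.
Qed.

Lemma dec_rhs nu kap m M G g w : 0 < nu -> 0 < kap -> dec m G g -> dec (m + 5) M w ->
  dec m (G + nu * kap ^ 2 * M + cB kap m * M * M) (rhs nu kap g w).
Proof.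
  intros Hn Hk Hg Hw. unfold rhs.
  apply (dec_minus m _ _ (fun k => Cminus (g k) (Cmult (RtoC (lam nu kap k)) (w k)))).
  - apply dec_minus; auto. apply dec_lam; auto. apply (dec_weaken (m + 5)); [lia|auto].
  - now apply dec_Bf.
Qed.

Definition bdd (w : R -> Z * Z -> C) : Prop := forall m, exists M, forall t, dec m M (w t).

Definition remainder (w w' : R -> Z * Z -> C) (t h : R) (k : Z * Z) : C :=
  Cminus (Cminus (w (t + h) k) (w t k)) (Cmult (RtoC h) (w' t k)).

(** A quadratic remainder, uniform in time and in every weight, serves as the notion of derivative:
    it passes through sums, [lam] and [Bf] by algebra alone. These operations cost orders, which is
    why all orders are required together. *)
Definition quad (w w' : R -> Z * Z -> C) : Prop :=
  forall m, exists M, forall t h, Rabs h <= 1 -> dec m (M * h ^ 2) (remainder w w' t h).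

Definition diffd (w w' : R -> Z * Z -> C) : Prop := bdd w /\ bdd w' /\ quad w w'.

Lemma bdd_ext w w' : (forall t k, w t k = w' t k) -> bdd w -> bdd w'.
Proof.
  intros E H m. destruct (H m) as [M HM]. exists M. intros t.
  apply (dec_ext m M (w t)); auto.
Qed.

Lemma diffd_ext w w' v v' : (forall t k, w t k = v t k) -> (forall t k, w' t k = v' t k) ->
  diffd w w' -> diffd v v'.
Proof.
  intros E E' (H1 & H2 & H3). split; [|split].
  - now apply (bdd_ext w).
  - now apply (bdd_ext w').
  - intros m. destruct (H3 m) as [M HM]. exists M. intros t h Hh.
    apply (dec_ext m _ (remainder w w' t h)); auto.
    intros k. unfold remainder. now rewrite !E, E'.
Qed.

Lemma bdd_plus w v : bdd w -> bdd v -> bdd (fun t k => Cplus (w t k) (v t k)).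
Proof.
  intros H H' m. destruct (H m) as [M HM], (H' m) as [M' HM'].
  exists (M + M'). intros t. now apply dec_plus.
Qed.

Lemma bdd_scal c w : bdd w -> bdd (fun t k => Cmult c (w t k)).
Proof.
  intros H m. destruct (H m) as [M HM]. exists (Cmod c * M). intros t. now apply dec_scal.
Qed.

Lemma bdd_lam nu kap w : 0 < nu -> 0 < kap -> bdd w ->
  bdd (fun t k => Cmult (RtoC (lam nu kap k)) (w t k)).
Proof.
  intros Hn Hk H m. destruct (H (m + 4)%nat) as [M HM]. eexists. intros t. apply dec_lam; auto.
Qed.

Lemma bdd_Bf kap w v : 0 < kap -> bdd w -> bdd v -> bdd (fun t => Bf kap (w t) (v t)).
Proof.
  intros Hk H H' m. destruct (H (m + 5)%nat) as [M HM], (H' (m + 5)%nat) as [M' HM'].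
  eexists. intros t. apply dec_Bf; auto.
Qed.

Lemma diffd_plus w w' v v' : diffd w w' -> diffd v v' ->
  diffd (fun t k => Cplus (w t k) (v t k)) (fun t k => Cplus (w' t k) (v' t k)).
Proof.
  intros (A1 & A2 & A3) (B1 & B2 & B3). split; [|split]; try now apply bdd_plus.
  intros m. destruct (A3 m) as [M HM], (B3 m) as [M' HM']. exists (M + M'). intros t h Hh.
  rewrite Rmult_plus_distr_r.
  apply (dec_ext m _ (fun k => Cplus (remainder w w' t h k) (remainder v v' t h k))).
  - intros k. unfold remainder. ring.
  - apply dec_plus; auto.
Qed.

Lemma diffd_scal c w w' : diffd w w' ->
  diffd (fun t k => Cmult c (w t k)) (fun t k => Cmult c (w' t k)).
Proof.
  intros (A1 & A2 & A3). split; [|split]; try now apply bdd_scal.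
  intros m. destruct (A3 m) as [M HM]. exists (Cmod c * M). intros t h Hh.
  rewrite Rmult_assoc.
  apply (dec_ext m _ (fun k => Cmult c (remainder w w' t h k))).
  - intros k. unfold remainder. ring.
  - apply dec_scal; auto.
Qed.

Lemma diffd_lam nu kap w w' : 0 < nu -> 0 < kap -> diffd w w' ->
  diffd (fun t k => Cmult (RtoC (lam nu kap k)) (w t k))
        (fun t k => Cmult (RtoC (lam nu kap k)) (w' t k)).
Proof.
  intros Hn Hk (A1 & A2 & A3). split; [|split]; try now apply bdd_lam.
  intros m. destruct (A3 (m + 4)%nat) as [M HM]. exists (nu * kap ^ 2 * M). intros t h Hh.
  rewrite Rmult_assoc.
  apply (dec_ext m _ (fun k => Cmult (RtoC (lam nu kap k)) (remainder w w' t h k))).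
  - intros k. unfold remainder. ring.
  - apply dec_lam; auto.
Qed.

Lemma diffd_const (g : Z * Z -> C) : rapid g -> diffd (fun _ => g) (fun _ _ => RtoC 0).
Proof.
  intros Hg. split; [|split].
  - intros m. destruct (Hg m) as [G HG]. exists G. auto.
  - intros m. exists 0. intros _. apply dec_0.
  - intros m. exists 0. intros t h _. rewrite Rmult_0_l.
    apply (dec_ext m _ (fun _ => RtoC 0)); [|apply dec_0].
    intros k. unfold remainder. ring.
Qed.

Lemma diffd_csum {A} (f f' : A -> R -> Z * Z -> C) l :
  (forall x, In x l -> diffd (f x) (f' x)) ->
  diffd (fun t k => csum (fun x => f x t k) l) (fun t k => csum (fun x => f' x t k) l).
Proof.
  induction l as [|a l IH]; intros H; simpl.
  - apply (diffd_const (fun _ => RtoC 0)). intros m. exists 0. apply dec_0.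
  - apply (diffd_plus (f a) (f' a)).
    + apply H. now left.
    + apply IH. intros x Hx. apply H. now right.
Qed.

(** The product rule with explicit remainder: beyond the constant and linear terms, everything
    carries [h * h], [q] or [r]. *)
Lemma Bf_remainder kap (w w' r v v' q : Z * Z -> C) M h k : 0 < kap ->
  dec 5 M w -> dec 5 M w' -> dec 5 M r -> dec 5 M v -> dec 5 M v' -> dec 5 M q ->
  Bf kap (fun j => Cplus (w j) (Cplus (Cmult h (w' j)) (r j)))
         (fun j => Cplus (v j) (Cplus (Cmult h (v' j)) (q j))) k =
  Cplus (Cplus (Bf kap w v k) (Cmult h (Cplus (Bf kap w' v k) (Bf kap w v' k))))
    (Cplus (Cmult (Cmult h h) (Bf kap w' v' k))
       (Cplus (Bf kap (fun j => Cplus (w j) (Cmult h (w' j))) q k)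
              (Bf kap r (fun j => Cplus (v j) (Cplus (Cmult h (v' j)) (q j))) k))).
Proof.
  intros Hk Hw Hw' Hr Hv Hv' Hq. assert (Hk0 : 0 <= kap) by lra.
  assert (Hhw' := dec_scal _ _ h _ Hw'). assert (Hhv' := dec_scal _ _ h _ Hv').
  assert (Hhvq := dec_plus _ _ _ _ _ Hhv' Hq). assert (Hhwr := dec_plus _ _ _ _ _ Hhw' Hr).
  assert (Hvv := dec_plus _ _ _ _ _ Hv Hhvq). assert (Hww := dec_plus _ _ _ _ _ Hw Hhw').
  cbv beta in *.
  replace (fun j => Cplus (w j) (Cplus (Cmult h (w' j)) (r j))) with
    (fun j => Cplus (Cplus (w j) (Cmult h (w' j))) (r j))
    by (apply functional_extensionality; intros j; ring).
  rewrite (Bf_plus_l kap _ _ _ _ _ _ Hk0 Hww Hr Hvv).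
  rewrite (Bf_plus_r kap _ _ _ _ _ _ Hk0 Hv Hhvq Hww).
  rewrite (Bf_plus_r kap _ _ _ _ _ _ Hk0 Hhv' Hq Hww).
  rewrite (Bf_scal_r kap _ _ _ _ Hk0 Hv' Hww).
  rewrite (Bf_plus_l kap _ _ _ _ _ _ Hk0 Hw Hhw' Hv).
  rewrite (Bf_plus_l kap _ _ _ _ _ _ Hk0 Hw Hhw' Hv').
  rewrite (Bf_scal_l kap _ _ _ _ Hk0 Hw' Hv).
  rewrite (Bf_scal_l kap _ _ _ _ Hk0 Hw' Hv').
  ring.
Qed.

Lemma diffd_Bf kap w w' v v' : 0 < kap -> diffd w w' -> diffd v v' ->
  diffd (fun t => Bf kap (w t) (v t))
        (fun t k => Cplus (Bf kap (w' t) (v t) k) (Bf kap (w t) (v' t) k)).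
Proof.
  intros Hk (A1 & A2 & A3) (B1 & B2 & B3). split; [|split].
  - now apply bdd_Bf.
  - apply bdd_plus; now apply bdd_Bf.
  - intros m. set (n := (m + 5)%nat).
    destruct (A1 n) as [a1 HA1], (A2 n) as [a2 HA2], (A3 n) as [a3 HA3].
    destruct (B1 n) as [b1 HB1], (B2 n) as [b2 HB2], (B3 n) as [b3 HB3].
    exists (cB kap m * (a2 * b2 + ((a1 + a2) * b3 + a3 * b1))).
    intros t h Hh.
    assert (P := cB_pos kap m Hk).
    assert (pa1 := dec_pos _ _ _ (HA1 0)). assert (pa2 := dec_pos _ _ _ (HA2 0)).
    assert (pb1 := dec_pos _ _ _ (HB1 0)). assert (pb2 := dec_pos _ _ _ (HB2 0)).
    assert (pa3 := dec_pos _ _ _ (HA3 0 1 ltac:(rewrite Rabs_R1; lra))).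
    assert (pb3 := dec_pos _ _ _ (HB3 0 1 ltac:(rewrite Rabs_R1; lra))).
    assert (h2 : 0 <= h ^ 2 <= 1).
    { split; [apply pow2_ge_0|]. rewrite <- pow2_abs. pose proof (Rabs_pos h). nra. }
    set (K := a1 + a2 + a3 + b1 + b2 + b3).
    assert (D5 : forall x M, M <= K -> dec n M x -> dec 5 K x).
    { intros x M HM Hx. apply (dec_mono 5 M); [exact HM|]. apply (dec_weaken n); [unfold n; lia|exact Hx]. }
    set (r := remainder w w' t h). set (q := remainder v v' t h).
    assert (Hr : dec n (a3 * h ^ 2) r) by (apply HA3; auto).
    assert (Hq : dec n (b3 * h ^ 2) q) by (apply HB3; auto).
    assert (Ew : w (t + h) = fun j => Cplus (w t j) (Cplus (Cmult (RtoC h) (w' t j)) (r j))).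
    { apply functional_extensionality; intros j. unfold r, remainder. ring. }
    assert (Ev : v (t + h) = fun j => Cplus (v t j) (Cplus (Cmult (RtoC h) (v' t j)) (q j))).
    { apply functional_extensionality; intros j. unfold q, remainder. ring. }
    assert (Q1 : a3 * h ^ 2 <= a3) by nra. assert (Q2 : b3 * h ^ 2 <= b3) by nra.
    apply (dec_ext m _ (fun k => Cplus (Cmult (Cmult (RtoC h) (RtoC h)) (Bf kap (w' t) (v' t) k))
       (Cplus (Bf kap (fun j => Cplus (w t j) (Cmult (RtoC h) (w' t j))) q k)
              (Bf kap r (v (t + h)) k)))).
    { intros k. unfold remainder. rewrite Ew, Ev.
      rewrite (Bf_remainder kap (w t) (w' t) r (v t) (v' t) q K (RtoC h) k Hk);
       try (eapply D5; [|eauto]; unfold K; lra).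
      ring. }
    replace (cB kap m * (a2 * b2 + ((a1 + a2) * b3 + a3 * b1)) * h ^ 2) with
      (h ^ 2 * (cB kap m * a2 * b2) +
       (cB kap m * (a1 + a2) * (b3 * h ^ 2) + cB kap m * (a3 * h ^ 2) * b1)) by ring.
    apply dec_plus; [|apply dec_plus].
    + rewrite <- RtoC_mult. replace (h ^ 2) with (Cmod (RtoC (h * h))).
      * apply dec_scal, dec_Bf; auto.
      * rewrite Cmod_R, Rabs_pos_eq by nra. ring.
    + apply dec_Bf; auto. apply (dec_mono _ (a1 + Cmod (RtoC h) * a2)).
      * rewrite Cmod_R. nra.
      * apply dec_plus; [apply HA1|]. apply dec_scal, HA2.
    + apply dec_Bf; auto.
Qed.

Lemma is_derive_of_quad (f : R -> R) t d M eta : 0 <= M -> 0 < eta ->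
  (forall h, Rabs h <= eta -> Rabs (f (t + h) - f t - h * d) <= M * h ^ 2) -> is_derive f t d.
Proof.
  intros HM Heta H. apply is_derive_Reals. intros eps Heps.
  assert (P : 0 < Rmin eta (eps / (M + 1))).
  { apply Rmin_pos; [lra|]. apply Rdiv_lt_0_compat; lra. }
  exists (mkposreal _ P). intros h Hh0 Hh. simpl in Hh.
  assert (h1 : Rabs h <= eta) by (pose proof (Rmin_l eta (eps / (M + 1))); lra).
  assert (h2 : Rabs h < eps / (M + 1)) by (pose proof (Rmin_r eta (eps / (M + 1))); lra).
  assert (hp := Rabs_pos_lt h Hh0).
  replace ((f (t + h) - f t) / h - d) with ((f (t + h) - f t - h * d) / h) by (field; auto).
  unfold Rdiv. rewrite Rabs_mult, Rabs_inv.
  apply Rle_lt_trans with (M * h ^ 2 * / Rabs h).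
  - apply Rmult_le_compat_r; [apply inv_nonneg; lra|now apply H].
  - rewrite <- pow2_abs. replace (M * Rabs h ^ 2 * / Rabs h) with (M * Rabs h) by (field; lra).
    apply Rle_lt_trans with ((M + 1) * Rabs h); [nra|].
    apply Rlt_le_trans with ((M + 1) * (eps / (M + 1))); [apply Rmult_lt_compat_l; lra|].
    right; field; lra.
Qed.

Lemma dC_of_quad f t d M eta : 0 <= M -> 0 < eta ->
  (forall h, Rabs h <= eta ->
     Cmod (Cminus (Cminus (f (t + h)) (f t)) (Cmult (RtoC h) d)) <= M * h ^ 2) -> dC f t d.
Proof.
  intros HM Heta H. split; apply (is_derive_of_quad _ _ _ M eta HM Heta); intros h Hh;
  (eapply Rle_trans; [|apply (H h Hh)]).
  - eapply Rle_trans; [|apply Re_le_Cmod]. apply Req_le. f_equal. unfold Re; simpl. ring.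
  - eapply Rle_trans; [|apply Im_le_Cmod]. apply Req_le. f_equal. unfold Im; simpl. ring.
Qed.

Lemma diffd_dC w w' t k : diffd w w' -> dC (fun s => w s k) t (w' t k).
Proof.
  intros (_ & _ & H). destruct (H 0%nat) as [M HM].
  assert (M0 := dec_pos _ _ _ (HM 0 1 ltac:(rewrite Rabs_R1; lra))).
  apply (dC_of_quad _ _ _ M 1); [nra|lra|]. intros h Hh. pose proof (HM t h Hh k).
  unfold remainder in H0. simpl in H0 |- *. lra.
Qed.

Lemma rhs_diff nu kap g w v M k : 0 < kap -> dec 5 M w -> dec 5 M v ->
  Cminus (rhs nu kap g w k) (rhs nu kap g v k) =
  Copp (Cplus (Cmult (RtoC (lam nu kap k)) (Cminus (w k) (v k)))
   (Cplus (Bf kap (fun j => Cminus (w j) (v j)) w k) (Bf kap v (fun j => Cminus (w j) (v j)) k))).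
Proof.
  intros Hk Hw Hv. assert (Hk0 : 0 <= kap) by lra.
  set (e := fun j => Cminus (w j) (v j)).
  assert (He : dec 5 (M + M) e) by now apply dec_minus.
  assert (Ew : w = fun j => Cplus (v j) (e j)).
  { apply functional_extensionality; intros j. unfold e. ring. }
  assert (EB : Bf kap w w k = Cplus (Bf kap v v k) (Cplus (Bf kap e w k) (Bf kap v e k))).
  { rewrite Ew at 1. rewrite (Bf_plus_l kap _ _ _ _ _ _ Hk0 Hv He Hw).
    rewrite Ew at 1. rewrite (Bf_plus_r kap _ _ _ _ _ _ Hk0 Hv He Hv). ring. }
  unfold rhs. rewrite EB. unfold e. ring.
Qed.

(** The mean value estimate is used twice, first for [W s - W 0], then for the difference of the
    right-hand sides; each use yields a factor [|a|] and costs five orders. The direction [a] is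
    complex, so the same lemma covers steps in real time and segments inside the strip. *)
Lemma segment_remainder nu kap m M G : 0 < nu -> 0 < kap -> exists K, 0 <= K /\
  forall g (W : R -> Z * Z -> C) (a : C), dec (m + 5) G g ->
   (forall s, 0 <= s <= 1 -> dec (m + 5 + 5) M (W s)) ->
   (forall s k, 0 <= s <= 1 -> dC (fun s => W s k) s (Cmult a (rhs nu kap g (W s) k))) ->
   dec m (K * Cmod a ^ 2)
     (fun k => Cminus (Cminus (W 1 k) (W 0 k)) (Cmult a (rhs nu kap g (W 0) k))).
Proof.
  intros Hn Hk.
  set (M1 := Rabs G + nu * kap ^ 2 * Rabs M + cB kap (m + 5) * Rabs M * Rabs M).
  set (K := nu * kap ^ 2 * M1 + (cB kap m * M1 * Rabs M + cB kap m * Rabs M * M1)).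
  assert (Hk2 := pow_lt kap 2 Hk).
  assert (M1p : 0 <= M1).
  { unfold M1. pose proof (Rabs_pos G). pose proof (Rabs_pos M). pose proof (cB_pos kap (m + 5) Hk).
    set (c := cB kap (m + 5)) in *. clearbody c.
    apply Rplus_le_le_0_compat; [apply Rplus_le_le_0_compat|]; repeat apply Rmult_le_pos; lra. }
  assert (Kp : 0 <= K).
  { unfold K. pose proof (Rabs_pos M). pose proof (cB_pos kap m Hk). set (c := cB kap m) in *.
    clearbody M1 c.
    apply Rplus_le_le_0_compat; [|apply Rplus_le_le_0_compat]; repeat apply Rmult_le_pos; lra. }
  exists K. split; [exact Kp|]. intros g W a Hg HW HD.
  assert (M0 : 0 <= M) by (apply (dec_pos (m + 5 + 5) M (W 0)), HW; lra).
  assert (G0 := dec_pos _ _ _ Hg).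
  assert (HR : forall s, 0 <= s <= 1 -> dec (m + 5) M1 (rhs nu kap g (W s))).
  { intros s Hs. unfold M1. rewrite !Rabs_pos_eq by auto. apply dec_rhs; auto. }
  assert (HL : forall s, 0 <= s <= 1 ->
    dec (m + 5) (Cmod a * M1) (fun k => Cminus (W s k) (W 0 k))).
  { intros s Hs k.
    assert (D := dC_mvt (fun s => W s k) (fun s => Cmult a (rhs nu kap g (W s) k)) (RtoC 0)
      (Cmod a * (M1 / rho k ^ (m + 5))) s (proj1 Hs)).
    cbv beta in D.
    replace (Cminus (Cminus (W s k) (W 0 k)) (Cmult (RtoC s) (RtoC 0))) with
      (Cminus (W s k) (W 0 k)) in D by ring.
    assert (P : 0 <= Cmod a * (M1 / rho k ^ (m + 5))).
    { apply Rmult_le_pos; [apply Cmod_ge_0|]. apply Rmult_le_pos; [exact M1p|].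
      apply Rlt_le, inv_rho_pos. }
    apply Rle_trans with (s * (Cmod a * (M1 / rho k ^ (m + 5)))).
    - apply D.
      + intros r Hr. apply HD. lra.
      + intros r Hr. replace (Cminus (Cmult a (rhs nu kap g (W r) k)) (RtoC 0)) with
          (Cmult a (rhs nu kap g (W r) k)) by ring.
        rewrite Cmod_mult. apply Rmult_le_compat_l; [apply Cmod_ge_0|]. apply HR. lra.
    - replace (Cmod a * M1 / rho k ^ (m + 5)) with (Cmod a * (M1 / rho k ^ (m + 5)))
        by (unfold Rdiv; ring). nra. }
  assert (HF : forall s, 0 <= s <= 1 -> dec m (Cmod a * K)
     (fun k => Cminus (rhs nu kap g (W s) k) (rhs nu kap g (W 0) k))).
  { intros s Hs.
    assert (W5 : forall s, 0 <= s <= 1 -> dec 5 M (W s))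
      by (intros r Hr; apply (dec_weaken (m + 5 + 5)); [lia|auto]).
    apply (dec_ext m _ (fun k => Cmult (RtoC (-1))
      (Cplus (Cmult (RtoC (lam nu kap k)) (Cminus (W s k) (W 0 k)))
       (Cplus (Bf kap (fun j => Cminus (W s j) (W 0 j)) (W s) k)
              (Bf kap (W 0) (fun j => Cminus (W s j) (W 0 j)) k))))).
    { intros k. rewrite (rhs_diff nu kap g (W s) (W 0) M k Hk) by (apply W5; lra).
      rewrite RtoC_m1. ring. }
    replace (Cmod a * K) with (Cmod (RtoC (-1)) * (nu * kap ^ 2 * (Cmod a * M1) +
      (cB kap m * (Cmod a * M1) * M + cB kap m * M * (Cmod a * M1)))).
    2:{ rewrite RtoC_m1, Cmod_opp, Cmod_1. unfold K. rewrite (Rabs_pos_eq M) by exact M0. ring. }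
    assert (WM : forall s, 0 <= s <= 1 -> dec (m + 5) M (W s))
      by (intros r Hr; apply (dec_weaken (m + 5 + 5)); [lia|auto]).
    apply dec_scal, dec_plus; [|apply dec_plus].
    - apply dec_lam; auto. apply (dec_weaken (m + 5)); [lia|auto].
    - apply dec_Bf; auto.
    - apply dec_Bf; auto. apply WM; lra. }
  intros k.
  assert (D := dC_mvt (fun s => W s k) (fun s => Cmult a (rhs nu kap g (W s) k))
      (Cmult a (rhs nu kap g (W 0) k)) (Cmod a * (Cmod a * K / rho k ^ m)) 1 ltac:(lra)).
  cbv beta in D. rewrite Cmult_1_l in D.
  replace (K * Cmod a ^ 2 / rho k ^ m) with (1 * (Cmod a * (Cmod a * K / rho k ^ m)))
    by (unfold Rdiv; ring).
  apply D.
  - intros r Hr. now apply HD.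
  - intros r Hr. replace (Cminus (Cmult a (rhs nu kap g (W r) k)) (Cmult a (rhs nu kap g (W 0) k)))
     with (Cmult a (Cminus (rhs nu kap g (W r) k) (rhs nu kap g (W 0) k))) by ring.
    rewrite Cmod_mult. apply Rmult_le_compat_l; [apply Cmod_ge_0|]. now apply HF.
Qed.

Lemma dC_affine f t h s d : dC f (t + s * h) d ->
  dC (fun s => f (t + s * h)) s (Cmult (RtoC h) d).
Proof.
  intros [H1 H2].
  assert (A : is_derive (fun s => t + s * h) s h).
  { auto_derive; [exact I|ring]. }
  split.
  - evar_last; [apply (is_derive_comp (fun s => Re (f s)) (fun s => t + s * h) s _ _ H1 A)|].
    unfold scal; simpl; unfold mult; simpl. unfold Re; simpl. ring.
  - evar_last; [apply (is_derive_comp (fun s => Im (f s)) (fun s => t + s * h) s _ _ H2 A)|].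
    unfold scal; simpl; unfold mult; simpl. unfold Im; simpl. ring.
Qed.

Lemma sol_diffd nu kap g v : 0 < nu -> 0 < kap -> rapid g -> sol nu kap g v -> bdd v ->
  diffd v (fun t => rhs nu kap g (v t)).
Proof.
  intros Hn Hk Hg Hs Hv. split; [exact Hv|split].
  - intros m. destruct (Hg m) as [G HG], (Hv (m + 5)%nat) as [M HM].
    exists (G + nu * kap ^ 2 * M + cB kap m * M * M). intros t. apply dec_rhs; auto.
  - intros m. destruct (Hg (m + 5)%nat) as [G HG], (Hv (m + 5 + 5)%nat) as [M HM].
    destruct (segment_remainder nu kap m M G Hn Hk) as (K & K0 & HK).
    exists K. intros t h _.
    assert (D := HK g (fun s => v (t + s * h)) (RtoC h) HG (fun s _ => HM _)).
    cbv beta in D. rewrite Rmult_1_l, Rmult_0_l, Rplus_0_r, Cmod_R, pow2_abs in D.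
    apply D. intros s k _. apply (dC_affine (fun r => v r k)). apply Hs.
Qed.

(** * Taylor coefficients in time *)

Definition force_at (g : Z * Z -> C) (n : nat) (k : Z * Z) : C :=
  match n with O => g k | _ => RtoC 0 end.

Definition Bconv (kap : R) (a : nat -> R -> Z * Z -> C) (n : nat) (t : R) (k : Z * Z) : C :=
  csum (fun i => Bf kap (a i t) (a (n - i)%nat t) k) (seq 0 (S n)).

Definition next_coef (nu kap : R) (g : Z * Z -> C) (n : nat) (a : nat -> R -> Z * Z -> C)
  (t : R) (k : Z * Z) : C :=
  Cmult (RtoC (/ INR (S n)))
    (Cminus (Cminus (force_at g n k) (Cmult (RtoC (lam nu kap k)) (a n t k))) (Bconv kap a n t k)).

(** The recursion needs all earlier coefficients at once, so a whole table is carried; stage [S n]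
    freezes the entries up to [n] and fills the rest with the new one. *)
Fixpoint coef_table (nu kap : R) (g : Z * Z -> C) (v : R -> Z * Z -> C) (n : nat)
  : nat -> R -> Z * Z -> C :=
  match n with
  | O => fun _ => v
  | S n => fun i => if (i <=? n)%nat then coef_table nu kap g v n i
                    else next_coef nu kap g n (coef_table nu kap g v n)
  end.

Definition coef nu kap g v (n : nat) : R -> Z * Z -> C := coef_table nu kap g v n n.

Lemma coef_table_stable nu kap g v n i : (i <= n)%nat ->
  coef_table nu kap g v n i = coef nu kap g v i.
Proof.
  induction n as [|n IH]; intros H.
  - replace i with 0%nat by lia. reflexivity.
  - destruct (Nat.eq_dec i (S n)) as [->|h]; [reflexivity|].
    simpl. replace (i <=? n)%nat with true by (symmetry; apply Nat.leb_le; lia).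
    apply IH. lia.
Qed.

Lemma coef_S nu kap g v n :
  coef nu kap g v (S n) = next_coef nu kap g n (coef nu kap g v).
Proof.
  unfold coef at 1. cbn [coef_table]. replace (S n <=? n)%nat with false by (symmetry; apply Nat.leb_gt; lia).
  apply functional_extensionality; intros t. apply functional_extensionality; intros k.
  unfold next_coef, Bconv. rewrite (coef_table_stable nu kap g v n n) by lia. do 2 f_equal.
  apply csum_ext. intros i Hi. apply in_seq in Hi. rewrite (coef_table_stable nu kap g v n i), (coef_table_stable nu kap g v n (n - i)) by lia.
  reflexivity.
Qed.

Lemma coef_S_eq nu kap g v n t k :
  Cmult (RtoC (INR (S n))) (coef nu kap g v (S n) t k) =
  Cminus (Cminus (force_at g n k) (Cmult (RtoC (lam nu kap k)) (coef nu kap g v n t k)))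
         (Bconv kap (coef nu kap g v) n t k).
Proof.
  rewrite coef_S. unfold next_coef. rewrite Cmult_assoc, <- RtoC_mult.
  rewrite Rinv_r by (apply not_0_INR; lia). apply Cmult_1_l.
Qed.

Lemma coef_mode0 nu kap g v n t : (forall t, v t (0, 0)%Z = RtoC 0) -> g (0, 0)%Z = RtoC 0 ->
  coef nu kap g v n t (0, 0)%Z = RtoC 0.
Proof.
  intros Hv Hg. destruct n; [apply Hv|]. rewrite coef_S. unfold next_coef, Bconv.
  rewrite lam_0. replace (force_at g n (0, 0)%Z) with (RtoC 0) by (destruct n; simpl; auto).
  rewrite (csum_ext _ (fun _ => RtoC 0)) by (intros; apply Bf_0).
  rewrite csum_const0. ring.
Qed.

(** Leibniz rule for a Cauchy product: a term of index [i] in the longer sum is reached once with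
    factor [i] and once with factor [n + 1 - i]. *)
Lemma csum_leibniz (b : nat -> C) n :
  csum (fun i => Cplus (Cmult (RtoC (INR (S i))) (b (S i)))
                       (Cmult (RtoC (INR (S (n - i)))) (b i))) (seq 0 (S n)) =
  Cmult (RtoC (INR (S n))) (csum b (seq 0 (S (S n)))).
Proof.
  rewrite csum_plus.
  replace (csum (fun i => Cmult (RtoC (INR (S i))) (b (S i))) (seq 0 (S n))) with
    (csum (fun i => Cmult (RtoC (INR i)) (b i)) (seq 0 (S (S n)))).
  2:{ change (seq 0 (S (S n))) with (0%nat :: seq 1 (S n)). rewrite <- seq_shift.
      cbn [csum fold_right]. change (RtoC (INR 0)) with (RtoC 0).
      fold (csum (fun i => Cmult (RtoC (INR i)) (b i)) (map S (seq 0 (S n)))).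
      rewrite csum_map. ring. }
  replace (csum (fun i => Cmult (RtoC (INR (S (n - i)))) (b i)) (seq 0 (S n))) with
    (csum (fun i => Cmult (RtoC (INR (S n - i))) (b i)) (seq 0 (S (S n)))).
  2:{ rewrite (seq_S (S n)), csum_app. rewrite Nat.add_0_l. cbn [csum fold_right].
      rewrite Nat.sub_diag. change (RtoC (INR 0)) with (RtoC 0).
      rewrite Cmult_0_l, !Cplus_0_r. apply csum_ext. intros i Hi. apply in_seq in Hi.
      do 3 f_equal. lia. }
  rewrite <- csum_plus, <- csum_scal. apply csum_ext. intros i Hi. apply in_seq in Hi.
  rewrite <- Cmult_plus_distr_r, <- RtoC_plus, <- plus_INR. do 3 f_equal. lia.
Qed.

(** This identifies the formally defined coefficients as the derivatives of [v] divided by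
    factorials. Differentiating the recursion for index [n + 1] reproduces the one for [n + 2],
    multiplied by the proper integer. *)
Lemma coef_diffd nu kap g v : 0 < nu -> 0 < kap -> rapid g -> sol nu kap g v -> bdd v ->
  forall n, diffd (coef nu kap g v n)
                  (fun t k => Cmult (RtoC (INR (S n))) (coef nu kap g v (S n) t k)).
Proof.
  intros Hn Hk Hg Hs Hv. set (a := coef nu kap g v).
  induction n as [n IH] using lt_wf_ind.
  destruct n as [|n].
  - apply (diffd_ext v (fun t => rhs nu kap g (v t))); auto.
    + intros t k. unfold a. rewrite coef_S_eq. unfold Bconv. simpl. unfold rhs, coef. simpl. ring.
    + now apply sol_diffd.
  - assert (D : diffd
      (fun t k => Cmult (RtoC (/ INR (S n))) (Cplus (force_at g n k) (Cplus
         (Cmult (RtoC (-1)) (Cmult (RtoC (lam nu kap k)) (a n t k)))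
         (Cmult (RtoC (-1)) (csum (fun i => Bf kap (a i t) (a (n - i)%nat t) k) (seq 0 (S n)))))))
      (fun t k => Cmult (RtoC (/ INR (S n))) (Cplus (RtoC 0) (Cplus
         (Cmult (RtoC (-1)) (Cmult (RtoC (lam nu kap k)) (Cmult (RtoC (INR (S n))) (a (S n) t k))))
         (Cmult (RtoC (-1)) (csum (fun i =>
           Cplus (Bf kap (fun j => Cmult (RtoC (INR (S i))) (a (S i) t j)) (a (n - i)%nat t) k)
             (Bf kap (a i t) (fun j => Cmult (RtoC (INR (S (n - i)))) (a (S (n - i)) t j)) k))
            (seq 0 (S n)))))))).
    { apply diffd_scal, (diffd_plus (fun _ => force_at g n) (fun _ _ => RtoC 0)).
      { apply diffd_const. destruct n; simpl; auto. intros m. exists 0. apply dec_0. }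
      apply (diffd_plus (fun t k => Cmult (RtoC (-1)) (Cmult (RtoC (lam nu kap k)) (a n t k)))
        (fun t k => Cmult (RtoC (-1)) (Cmult (RtoC (lam nu kap k))
                       (Cmult (RtoC (INR (S n))) (a (S n) t k))))).
      { apply diffd_scal, diffd_lam; auto. }
      apply diffd_scal.
      apply (diffd_csum (fun i t k => Bf kap (a i t) (a (n - i)%nat t) k)).
      intros i Hi. apply in_seq in Hi. apply (diffd_Bf kap (a i) _ (a (n - i)%nat)); auto.
      - apply IH; lia.
      - apply IH; lia. }
    (* For the top index the decay is read off from the derivative of [a n], since its own statement
       is the one being proved. *)
    assert (BA : forall i, (i <= S n)%nat -> forall t, exists M, dec 5 M (a i t)).
    { intros i Hi t. destruct (Nat.eq_dec i (S n)) as [->|h].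
      - destruct (IH n ltac:(lia)) as (_ & H & _). destruct (H 5%nat) as [M HM].
        exists (Cmod (RtoC (/ INR (S n))) * M).
        apply (dec_ext _ _ (fun k => Cmult (RtoC (/ INR (S n))) (Cmult (RtoC (INR (S n))) (a (S n) t k)))).
        + intros k. rewrite Cmult_assoc, <- RtoC_mult, Rinv_l by (apply not_0_INR; lia).
          apply Cmult_1_l.
        + now apply dec_scal.
      - destruct (IH i ltac:(lia)) as (H & _ & _). destruct (H 5%nat) as [M HM]. exists M. auto. }
    refine (diffd_ext _ _ _ _ _ _ D).
    + intros t k. transitivity (next_coef nu kap g n a t k); [|unfold a; now rewrite coef_S].
      unfold next_coef, Bconv. f_equal. rewrite RtoC_m1. ring.
    + intros t k. transitivity (Cminus (Cminus (force_at g (S n) k)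
        (Cmult (RtoC (lam nu kap k)) (a (S n) t k))) (Bconv kap a (S n) t k));
        [|symmetry; apply coef_S_eq]. unfold Bconv.
      assert (N0 : RtoC (INR (S n)) <> RtoC 0).
      { intros E. apply RtoC_inj in E. now apply (not_0_INR (S n)). }
      rewrite RtoC_inv by (now apply not_0_INR).
      replace (csum (fun i =>
           Cplus (Bf kap (fun j => Cmult (RtoC (INR (S i))) (a (S i) t j)) (a (n - i)%nat t) k)
             (Bf kap (a i t) (fun j => Cmult (RtoC (INR (S (n - i)))) (a (S (n - i)) t j)) k))
            (seq 0 (S n))) with
        (Cmult (RtoC (INR (S n))) (csum (fun i => Bf kap (a i t) (a (S n - i)%nat t) k)
           (seq 0 (S (S n))))).
      * cbn [force_at]. rewrite RtoC_m1. field. exact N0.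
      * rewrite <- (csum_leibniz (fun i => Bf kap (a i t) (a (S n - i)%nat t) k)).
        apply csum_ext. intros i Hi. apply in_seq in Hi.
        destruct (BA (S i) ltac:(lia) t) as [M1 HM1]. destruct (BA (n - i)%nat ltac:(lia) t) as [M2 HM2].
        destruct (BA i ltac:(lia) t) as [M3 HM3]. destruct (BA (S (n - i)) ltac:(lia) t) as [M4 HM4].
        assert (Hk0 : 0 <= kap) by lra.
        rewrite (Bf_scal_l kap _ _ _ _ Hk0 HM1 HM2), (Bf_scal_r kap _ _ _ _ Hk0 HM4 HM3).
        replace (S n - S i)%nat with (n - i)%nat by lia.
        replace (S n - i)%nat with (S (n - i)) by lia. reflexivity.
Qed.

(** * Geometric growth of the Taylor coefficients *)

Lemma lsum_inv_sq n : lsum (fun i => / INR (S i) ^ 2) (seq 0 (S n)) <= 2 - / INR (S n).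
Proof.
  induction n as [|n IH].
  - simpl. lra.
  - rewrite seq_S, lsum_app. cbn [lsum fold_right]. change (0 + S n)%nat with (S n).
    assert (0 < INR (S n)) by (apply lt_0_INR; lia).
    assert (E : INR (S (S n)) = INR (S n) + 1) by apply S_INR.
    rewrite E. set (x := INR (S n)) in *.
    assert (/ (x + 1) ^ 2 <= / x - / (x + 1)).
    { replace (/ x - / (x + 1)) with (/ (x * (x + 1))) by (field; lra).
      apply Rinv_le_contravar; nra. }
    unfold lsum in IH |- *. lra.
Qed.

Lemma lsum_rev (f : nat -> R) n :
  lsum (fun i => f (n - i)%nat) (seq 0 (S n)) = lsum f (seq 0 (S n)).
Proof.
  rewrite <- (lsum_map f (fun i => (n - i)%nat)). apply lsum_perm.
  apply NoDup_Permutation.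
  - apply NoDup_map_NoDup_ForallPairs; [|apply seq_NoDup].
    intros x y Hx Hy. apply in_seq in Hx, Hy. lia.
  - apply seq_NoDup.
  - intros x. rewrite in_map_iff, in_seq. split.
    + intros (i & <- & Hi). apply in_seq in Hi. lia.
    + intros Hx. exists (n - x)%nat. rewrite in_seq. lia.
Qed.

(** The summable factor [1 / (n + 1)^2] makes the sequence reproduce itself under Cauchy products up
    to a constant; for pure powers a factor [n + 1] would appear. *)
Definition growth (c : R) (n : nat) : R := c ^ n / INR (S n) ^ 2.

Lemma growth_pos c n : 0 < c -> 0 < growth c n.
Proof.
  intros H. apply Rdiv_lt_0_compat; [now apply pow_lt|]. apply pow_lt, lt_0_INR. lia.
Qed.

(** From [(n + 1) + 1 = (i + 1) + (n - i + 1)] one gets [(n + 1)^2 <= 2 ((i + 1)^2 + (n - i +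
    1)^2)]. The 8 is this 2 times the bound 2 for each of two sums of inverse squares. *)
Lemma growth_conv c n : 0 < c ->
  lsum (fun i => growth c i * growth c (n - i)) (seq 0 (S n)) <= 8 * growth c n.
Proof.
  intros Hc.
  apply Rle_trans with (lsum (fun i => 2 * growth c n *
     (/ INR (S i) ^ 2 + / INR (S (n - i)) ^ 2)) (seq 0 (S n))).
  - apply lsum_le. intros i Hi. apply in_seq in Hi. unfold growth.
    assert (E : c ^ i * c ^ (n - i) = c ^ n) by (rewrite <- pow_add; f_equal; lia).
    assert (S1 : INR (S n) + 1 = INR (S i) + INR (S (n - i))).
    { rewrite <- plus_INR, <- S_INR. f_equal. lia. }
    assert (0 < INR (S i)) by (apply lt_0_INR; lia).
    assert (0 < INR (S (n - i))) by (apply lt_0_INR; lia).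
    assert (0 < INR (S n)) by (apply lt_0_INR; lia).
    set (x := INR (S i)) in *. set (y := INR (S (n - i))) in *. set (z := INR (S n)) in *.
    assert (pc := pow_lt c n Hc).
    replace (c ^ i / x ^ 2 * (c ^ (n - i) / y ^ 2)) with (c ^ n / (x ^ 2 * y ^ 2))
      by (rewrite <- E; field; lra).
    replace (2 * (c ^ n / z ^ 2) * (/ x ^ 2 + / y ^ 2)) with
      (c ^ n / (x ^ 2 * y ^ 2) * (2 * (x ^ 2 + y ^ 2) / z ^ 2)) by (field; lra).
    rewrite <- (Rmult_1_r (c ^ n / (x ^ 2 * y ^ 2))) at 1.
    apply Rmult_le_compat_l.
    + apply Rlt_le, Rdiv_lt_0_compat; [lra|]. apply Rmult_lt_0_compat; apply pow_lt; lra.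
    + apply Rmult_le_reg_r with (z ^ 2); [apply pow_lt; lra|].
      unfold Rdiv. rewrite Rmult_assoc, Rinv_l by (apply pow_nonzero; lra).
      pose proof (pow2_ge_0 (x - y)). nra.
  - rewrite lsum_scal, lsum_plus, (lsum_rev (fun i => / INR (S i) ^ 2)).
    pose proof (lsum_inv_sq n). pose proof (growth_pos c n Hc).
    assert (0 < / INR (S n)) by (apply Rinv_0_lt_compat, lt_0_INR; lia).
    replace (8 * growth c n) with (2 * growth c n * 4) by ring.
    apply Rmult_le_compat_l; lra.
Qed.

Lemma growth_pred c n : 0 < c -> growth c n <= 4 / c * growth c (S n).
Proof.
  intros Hc. unfold growth.
  assert (0 < INR (S n)) by (apply lt_0_INR; lia).
  assert (E : INR (S (S n)) = INR (S n) + 1) by apply S_INR.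
  assert (1 <= INR (S n)) by (apply (le_INR 1); lia).
  rewrite E. set (x := INR (S n)) in *. simpl pow.
  replace (4 / c * (c * c ^ n / ((x + 1) * ((x + 1) * 1)))) with (c ^ n * (4 / (x + 1) ^ 2))
    by (field; lra).
  unfold Rdiv at 1. apply Rmult_le_compat_l; [apply pow_le; lra|].
  replace (4 / (x + 1) ^ 2) with (/ ((x + 1) / 2) ^ 2) by (field; lra).
  apply Rinv_le_contravar; [apply pow_lt; lra|]. nra.
Qed.

(** One derivative is half of the Stokes operator: [kap |k| = sqrt (lam / nu)]. The constant is
    [400 * 2 ^ 7]. *)
Lemma Bf_sqrt_lam nu kap M M' w v k : 0 < nu -> 0 < kap -> dec 7 M w -> dec 7 M' v ->
  Cmod (Bf kap w v k) <= 51200 / sqrt nu * sqrt (lam nu kap k) * (M * M' / rho k ^ 7).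
Proof.
  intros Hn Hk Hw Hv.
  eapply Rle_trans; [apply (Bf_dec kap 7 7 M M'); auto; [lra|lia]|].
  assert (E : sqrt (lam nu kap k) = sqrt nu * (kap * nrm k)).
  { unfold lam. rewrite <- nrm_sq.
    replace (nu * kap ^ 2 * nrm k ^ 2) with (nu * (kap * nrm k) ^ 2) by ring.
    rewrite sqrt_mult by (try apply pow2_ge_0; lra). rewrite sqrt_pow2; [reflexivity|].
    pose proof (nrm_nonneg k). nra. }
  rewrite E. pose proof (sqrt_lt_R0 nu Hn). pose proof (rho_ge1 k).
  apply Req_le. field. lra.
Qed.

Lemma low_mode_arith N l sl K r M G q p :
  1 <= N -> 0 <= K -> 1 <= r -> 1 <= M -> 0 <= G -> 0 < q -> 0 < p ->
  l <= r ^ 2 * N -> sl <= r * N ->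
  G * q * p + l * (M * q * p) + K * sl * p * (8 * M ^ 2 * q) <=
  N * ((G + r ^ 2 * M + 8 * K * r * M ^ 2) * q * p).
Proof.
  intros HN HK Hr HM HG Hq Hp Hl Hsl.
  assert (qp : 0 <= q * p) by nra.
  assert (l * (M * (q * p)) <= r ^ 2 * N * (M * (q * p))).
  { apply Rmult_le_compat_r; [|lra]. apply Rmult_le_pos; lra. }
  assert (1 * (G * (q * p)) <= N * (G * (q * p))).
  { apply Rmult_le_compat_r; [|lra]. apply Rmult_le_pos; lra. }
  assert (sl * (8 * K * M ^ 2 * (q * p)) <= r * N * (8 * K * M ^ 2 * (q * p))).
  { apply Rmult_le_compat_r; [|lra]. repeat apply Rmult_le_pos; nra. }
  nra.
Qed.

Section CoefGrowth.
Variables (nu kap M G : R) (g : Z * Z -> C) (v : R -> Z * Z -> C).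
Hypotheses (Hn : 0 < nu) (Hk : 0 < kap) (HM1 : 1 <= M) (Hg0 : g (0, 0)%Z = RtoC 0)
  (Hg : rapid g) (Hs : sol nu kap g v) (Hb : bdd v)
  (HM : forall t, dec 7 M (v t)) (HG : dec 7 G g).

Let K := 51200 / sqrt nu.
(** The threshold [sqrt lam >= r] between high and low modes makes [8 * K * M / sqrt lam <= 1 / 4].
    Then [cst] exceeds 4 times the constant of [low_mode_arith], with 4 from [growth_pred]. *)
Let r := 32 * K * M + 1.
Let cst := 4 * (G + r ^ 2 * M + 8 * K * r * M ^ 2) + 1.
Let a := coef nu kap g v.

Lemma coef_K_pos : 0 < K.
Proof. apply Rdiv_lt_0_compat; [lra|now apply sqrt_lt_R0]. Qed.

Lemma coef_r_ge1 : 1 <= r.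
Proof. pose proof coef_K_pos. unfold r. nra. Qed.

Lemma coef_cst_pos : 1 <= cst.
Proof.
  pose proof coef_K_pos. pose proof coef_r_ge1. pose proof (dec_pos _ _ _ HG).
  unfold cst. assert (0 <= r ^ 2 * M) by (apply Rmult_le_pos; nra).
  assert (0 <= 8 * K * r) by (apply Rmult_le_pos; lra).
  assert (0 <= 8 * K * r * M ^ 2) by (apply Rmult_le_pos; nra). lra.
Qed.

Lemma Bconv_le n (Y : nat -> R) t k :
  (forall i, (i <= n)%nat -> dec 7 (Y i) (a i t)) ->
  Cmod (Bconv kap a n t k) <= K * sqrt (lam nu kap k) / rho k ^ 7 *
    lsum (fun i => Y i * Y (n - i)%nat) (seq 0 (S n)).
Proof.
  intros HY. unfold Bconv. eapply Rle_trans; [apply csum_Cmod|].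
  rewrite <- lsum_scal. apply lsum_le. intros i Hi. apply in_seq in Hi.
  eapply Rle_trans; [apply (Bf_sqrt_lam nu kap (Y i) (Y (n - i)%nat)); auto; apply HY; lia|].
  fold K. apply Req_le. unfold Rdiv. ring.
Qed.

(** The equation for coefficient [n + 1] contains that coefficient itself, paired with [a 0], so the
    estimate is implicit. Its exact weighted supremum [S] over all times and modes, finite by
    [coef_diffd], is shown to satisfy [S <= max (S / 2) (M * growth)]. *)
Lemma coef_growth_step n :
  (forall i, (i <= n)%nat -> forall t, dec 7 (M * growth cst i) (a i t)) ->
  forall t, dec 7 (M * growth cst (S n)) (a (S n) t).
Proof.
  intros IH.
  pose proof coef_K_pos as HK. pose proof coef_r_ge1 as Hr. pose proof coef_cst_pos as Hc.
  assert (G0 := dec_pos _ _ _ HG).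
  set (q := growth cst) in *.
  assert (qp : forall i, 0 < q i) by (intros; apply growth_pos; lra).
  assert (Hd := coef_diffd nu kap g v Hn Hk Hg Hs Hb (S n)). fold a in Hd.
  set (E := fun x => exists t k, x = Cmod (a (S n) t k) * rho k ^ 7).
  destruct (completeness E) as [S [HS1 HS2]].
  { destruct Hd as (H & _). destruct (H 7%nat) as [X HX]. exists X. intros x (t & k & ->).
    pose proof (HX t k). pose proof (rho_pow_ge1 k 7).
    apply Rmult_le_compat_r with (r := rho k ^ 7) in H0; [|lra].
    unfold Rdiv in H0. rewrite Rmult_assoc, Rinv_l in H0 by lra. lra. }
  { exists (Cmod (a (Datatypes.S n) 0 (0, 0)%Z) * rho (0, 0)%Z ^ 7). now exists 0, (0, 0)%Z. }
  assert (HS : forall t, dec 7 S (a (Datatypes.S n) t)).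
  { intros t k. assert (Cmod (a (Datatypes.S n) t k) * rho k ^ 7 <= S) by (apply HS1; now exists t, k).
    pose proof (rho_pow_ge1 k 7). apply Rmult_le_reg_r with (rho k ^ 7); [lra|].
    unfold Rdiv. rewrite Rmult_assoc, Rinv_l by lra. lra. }
  assert (S0 := dec_pos _ _ _ (HS 0)).
  assert (Hle : forall X, (forall t, dec 7 X (a (Datatypes.S n) t)) -> S <= X).
  { intros X HX. apply HS2. intros x (t & k & ->).
    pose proof (HX t k). pose proof (rho_pow_ge1 k 7).
    apply Rmult_le_compat_r with (r := rho k ^ 7) in H; [|lra].
    unfold Rdiv in H. rewrite Rmult_assoc, Rinv_l in H by lra. lra. }
  destruct (Rle_or_lt S (M * q (Datatypes.S n))) as [h|h].
  { intros t. apply (dec_mono 7 S); auto. }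
  exfalso.
  set (n' := Datatypes.S n) in *.
  assert (Mq : 0 < M * q n') by (apply Rmult_lt_0_compat; [lra|apply qp]).
  enough (S <= Rmax (S / 2) (M * q n')).
  { revert H. apply Rmax_case; intros; lra. }
  apply Hle. intros t k.
  destruct (zz_eq_dec k (0, 0)%Z) as [->|Hk0].
  { unfold a. rewrite coef_mode0 by (auto; apply Hs). rewrite Cmod_0.
    apply Rmult_le_pos; [|apply Rlt_le, inv_rho_pos]. pose proof (Rmax_r (S / 2) (M * q n')). lra. }
  pose proof (lam_pos nu kap k Hn Hk Hk0) as Hl. set (l := lam nu kap k) in *.
  assert (Hsq := sqrt_lt_R0 l Hl). assert (Hss := sqrt_sqrt l ltac:(lra)).
  pose proof (inv_rho_pos k 7) as Hrho.
  assert (Kl : 0 <= K * sqrt l * / rho k ^ 7)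
    by (apply Rmult_le_pos; [apply Rmult_le_pos; lra|lra]).
  destruct (Rle_or_lt (r ^ 2 * INR n') l) as [hl|hl].
  - (* high modes: damping dominates *)
    assert (N1 : 1 <= INR n') by (apply (le_INR 1); unfold n'; lia).
    assert (rl : r <= sqrt l).
    { rewrite <- (sqrt_pow2 r) by lra. apply sqrt_le_1_alt. nra. }
    (* The assumed excess ratio, at least 1. Since [q 0 = 1], multiplying all products by [sg]
       dominates also the two extreme ones containing [S], and [growth_conv] applies to the whole
       sum. *)
    set (sg := S / (M * q n')).
    assert (sg1 : 1 <= sg).
    { apply Rmult_le_reg_r with (M * q n'); [lra|]. unfold sg, Rdiv.
      rewrite Rmult_assoc, Rinv_l by lra. lra. }
    assert (sgS : sg * (M * q n') = S) by (unfold sg; field; split; [specialize (qp n')|]; lra).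
    set (Y := fun i => if (i =? n')%nat then S else M * q i).
    assert (HB : forall s, Cmod (Bconv kap a n' s k) <= K * sqrt l / rho k ^ 7 * (8 * M * S)).
    { intros s. eapply Rle_trans.
      - apply (Bconv_le n' Y). intros i Hi. unfold Y. destruct (Nat.eqb_spec i n') as [->|hi]; auto.
        apply IH. unfold n' in *; lia.
      - fold l. apply Rmult_le_compat_l.
        + exact Kl.
        + apply Rle_trans with (lsum (fun i => (sg * M ^ 2) * (q i * q (n' - i)%nat)) (seq 0 (Datatypes.S n'))).
          * apply lsum_le. intros i Hi. apply in_seq in Hi. unfold Y.
            assert (P : 0 <= M ^ 2 * (q i * q (n' - i)%nat)).
            { pose proof (qp i). pose proof (qp (n' - i)%nat). apply Rmult_le_pos; nra. }
            assert (q0 : q 0%nat = 1) by (unfold q, growth; simpl; field).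
            assert (HM0 : 0 <= M) by lra.
            destruct (Nat.eqb_spec i n') as [->|hi].
            { replace (n' - n')%nat with 0%nat by lia.
              replace (0 =? n')%nat with false by (symmetry; apply Nat.eqb_neq; unfold n'; lia).
              rewrite <- sgS, q0. apply Req_le. ring. }
            destruct (Nat.eqb_spec (n' - i) n') as [hi2|hi2].
            { assert (i = 0%nat) by lia. subst i. rewrite hi2. rewrite <- sgS, q0. apply Req_le. ring. }
            replace (M * q i * (M * q (n' - i)%nat)) with (1 * (M ^ 2 * (q i * q (n' - i)%nat))) by ring.
            replace (sg * M ^ 2 * (q i * q (n' - i)%nat)) with (sg * (M ^ 2 * (q i * q (n' - i)%nat))) by ring.
            apply Rmult_le_compat_r; lra.
          * rewrite lsum_scal. pose proof (growth_conv cst n' ltac:(lra)). fold q in H.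
            replace (8 * M * S) with (sg * M ^ 2 * (8 * q n')) by (rewrite <- sgS; ring).
            apply Rmult_le_compat_l; [|exact H]. apply Rmult_le_pos; nra. }
    (* Looking back by [3 / l] makes the damping factor [1 / (1 + 3) = 1 / 4]. The past value and
       the bilinear term then contribute at most [S / 4] each. *)
    assert (D := dC_linear_ode (fun s => a n' s k)
      (fun s => Cmult (RtoC (INR (Datatypes.S n'))) (a (Datatypes.S n') s k)) l
      (K * sqrt l / rho k ^ 7 * (8 * M * S)) t (3 / l) Hl).
    cbv beta in D.
    assert (D' : Cmod (a n' t k) <= Cmod (a n' (t - 3 / l) k) / (1 + l * (3 / l)) +
       K * sqrt l / rho k ^ 7 * (8 * M * S) / l).
    { apply D.
      - apply Rlt_le, Rdiv_lt_0_compat; lra.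
      - intros s _. apply (diffd_dC _ _ s k Hd).
      - intros s _. unfold a. rewrite coef_S_eq. fold a. fold l.
        replace (force_at g n' k) with (RtoC 0) by reflexivity.
        replace (Cplus (Cminus (Cminus (RtoC 0) (Cmult (RtoC l) (a n' s k))) (Bconv kap a n' s k))
          (Cmult (RtoC l) (a n' s k))) with (Copp (Bconv kap a n' s k)) by ring.
        rewrite Cmod_opp. apply HB. }
    replace (1 + l * (3 / l)) with 4 in D' by (field; lra).
    pose proof (HS (t - 3 / l) k).
    assert (T2 : K * sqrt l / rho k ^ 7 * (8 * M * S) / l <= S / 4 * / rho k ^ 7).
    { replace (K * sqrt l / rho k ^ 7 * (8 * M * S) / l) with
        ((8 * K * M) / sqrt l * S * / rho k ^ 7).
      2:{ assert (El : / l = / sqrt l * / sqrt l) by (rewrite <- Rinv_mult, Hss; reflexivity).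
          unfold Rdiv. rewrite El. generalize K. intros K'. pose proof (rho_ge1 k). field. lra. }
      apply Rmult_le_compat_r; [lra|].
      assert (8 * K * M / sqrt l <= / 4).
      { apply Rmult_le_reg_r with (sqrt l); [exact Hsq|]. unfold Rdiv.
        rewrite Rmult_assoc, Rinv_l by lra. unfold r in rl. lra. }
      unfold Rdiv in *. nra. }
    unfold Rdiv in *.
    apply Rle_trans with (S * / 2 * / rho k ^ 7); [lra|].
    apply Rmult_le_compat_r; [lra|]. apply Rmax_l.
  - (* low modes: the recursion loses only the factor [lam <= r ^ 2 * n] *)
    assert (N1 : 1 <= INR n') by (apply (le_INR 1); unfold n'; lia).
    assert (sl : sqrt l <= r * INR n').
    { rewrite <- (sqrt_pow2 (r * INR n')) by nra. apply sqrt_le_1_alt.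
      rewrite Rpow_mult_distr. assert (INR n' <= INR n' ^ 2) by nra.
      assert (0 <= r ^ 2) by nra. nra. }
    assert (BB : Cmod (Bconv kap a n t k) <= K * sqrt l / rho k ^ 7 * (8 * M ^ 2 * q n)).
    { eapply Rle_trans; [apply (Bconv_le n (fun i => M * q i)); intros; apply IH; auto|].
      fold l. apply Rmult_le_compat_l; [exact Kl|].
      rewrite (lsum_ext _ (fun i => M ^ 2 * (q i * q (n - i)%nat))) by (intros; ring).
      rewrite lsum_scal. pose proof (growth_conv cst n ltac:(lra)). fold q in H.
      replace (8 * M ^ 2 * q n) with (M ^ 2 * (8 * q n)) by ring. apply Rmult_le_compat_l; nra. }
    assert (AA := IH n ltac:(lia) t k).
    assert (FF : Cmod (force_at g n k) <= G * q n * / rho k ^ 7).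
    { destruct n; simpl force_at.
      - replace (q 0%nat) with 1 by (unfold q, growth; simpl; field). rewrite Rmult_1_r. apply HG.
      - rewrite Cmod_0. pose proof (qp (Datatypes.S n)).
        apply Rmult_le_pos; [apply Rmult_le_pos; lra|lra]. }
    assert (RR : Cmod (a n' t k) <= / INR n' *
       (G * q n * / rho k ^ 7 + l * (M * q n / rho k ^ 7) + K * sqrt l / rho k ^ 7 * (8 * M ^ 2 * q n))).
    { unfold a, n'. rewrite coef_S. unfold next_coef. fold a n' l.
      rewrite Cmod_mult, Cmod_R, Rabs_pos_eq by (apply inv_nonneg; lra).
      apply Rmult_le_compat_l; [apply inv_nonneg; lra|].
      eapply Rle_trans; [apply Cmod_minus_le|]. apply Rplus_le_compat; [|exact BB].
      eapply Rle_trans; [apply Cmod_minus_le|]. apply Rplus_le_compat; [exact FF|].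
      rewrite Cmod_mult, Cmod_R, Rabs_pos_eq by lra. apply Rmult_le_compat_l; [lra|exact AA]. }
    assert (qn := qp n).
    assert (QQ : Cmod (a n' t k) <= (G + r ^ 2 * M + 8 * K * r * M ^ 2) * q n * / rho k ^ 7).
    { eapply Rle_trans; [exact RR|].
      apply Rmult_le_reg_l with (INR n'); [lra|].
      rewrite <- Rmult_assoc, Rinv_r, Rmult_1_l by lra.
      apply low_mode_arith; lra. }
    eapply Rle_trans; [exact QQ|]. unfold Rdiv. apply Rmult_le_compat_r; [lra|].
    apply Rle_trans with (M * q n'); [|apply Rmax_r].
    pose proof (growth_pred cst n ltac:(lra)) as GP. fold q in GP. fold n' in GP.
    set (X := G + r ^ 2 * M + 8 * K * r * M ^ 2) in *.
    assert (X0 : 0 <= X).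
    { unfold cst in Hc. fold X in Hc. lra. }
    apply Rle_trans with (X * (4 / cst * q n')); [apply Rmult_le_compat_l; lra|].
    replace (X * (4 / cst * q n')) with ((4 * X / cst) * q n') by (unfold Rdiv; ring).
    apply Rmult_le_compat_r; [apply Rlt_le, qp|].
    apply Rle_trans with 1; [|lra].
    apply Rmult_le_reg_r with cst; [lra|]. unfold Rdiv.
    rewrite Rmult_assoc, Rinv_l by lra. unfold cst. fold X. lra.
Qed.

Lemma coef_growth n t : dec 7 (M * growth cst n) (a n t).
Proof.
  revert t. induction n as [n IH] using lt_wf_ind. destruct n as [|n].
  - intros t. apply (dec_mono 7 M); [|apply HM]. unfold growth; simpl. lra.
  - apply coef_growth_step. intros i Hi. apply IH. lia.
Qed.
End CoefGrowth.

(** * Extension to a complex strip *)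

Lemma lsum_half N : lsum (fun n => (/ 2) ^ n) (seq 0 N) = 2 - 2 * (/ 2) ^ N.
Proof.
  induction N as [|N IH]; [simpl; lra|].
  rewrite seq_S, lsum_app, IH. simpl. lra.
Qed.

Lemma half_pow_pos n : 0 < (/ 2) ^ n.
Proof. apply pow_lt. lra. Qed.

Lemma abs_bounded_half (f : nat -> C) P :
  (forall n, Cmod (f n) <= P * (/ 2) ^ n) -> abs_bounded (seq 0) f (2 * P).
Proof.
  intros H. apply (abs_bounded_lsum _ _ (fun n => P * (/ 2) ^ n)); [exact H|].
  intros N. rewrite lsum_scal, lsum_half. pose proof (half_pow_pos N).
  assert (0 <= P) by (pose proof (H 0%nat); pose proof (Cmod_ge_0 (f 0%nat)); simpl in *; lra).
  nra.
Qed.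

Lemma Csum_half_tail (f : nat -> C) P N :
  (forall n, Cmod (f n) <= P * (/ 2) ^ n) ->
  Cmod (Cminus (Csum (seq 0) f) (csum f (seq 0 N))) <= 2 * P * (/ 2) ^ N.
Proof.
  intros H.
  assert (P0 : 0 <= P) by (pose proof (H 0%nat); pose proof (Cmod_ge_0 (f 0%nat)); simpl in *; lra).
  assert (L := Csum_correct _ _ _ exhaust_seq (abs_bounded_half f P H)).
  apply (clim_bound (fun n => Cplus (csum f (seq 0 n)) (Copp (csum f (seq 0 N))))).
  - exists N. intros n Hn. replace n with (N + (n - N))%nat by lia.
    rewrite seq_app, csum_app, Nat.add_0_l.
    replace (Cplus (Cplus (csum f (seq 0 N)) (csum f (seq N (n - N)))) (Copp (csum f (seq 0 N))))
      with (csum f (seq N (n - N))) by ring.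
    eapply Rle_trans; [apply csum_Cmod|].
    apply Rle_trans with (lsum (fun j => P * (/ 2) ^ j) (seq N (n - N))).
    + apply lsum_le. intros; apply H.
    + rewrite lsum_scal.
      assert (E := lsum_half (N + (n - N))%nat). rewrite seq_app, lsum_app, lsum_half, Nat.add_0_l in E.
      pose proof (half_pow_pos (N + (n - N))).
      assert (lsum (fun n => (/ 2) ^ n) (seq N (n - N)) <= 2 * (/ 2) ^ N) by lra.
      replace (2 * P * (/ 2) ^ N) with (P * (2 * (/ 2) ^ N)) by ring.
      apply Rmult_le_compat_l; assumption.
  - apply clim_plus; [exact L|apply clim_const].
Qed.

Lemma clim_half (u : nat -> C) l P :
  (forall N, Cmod (Cminus (u N) l) <= P * (/ 2) ^ N) -> clim u l.
Proof.
  intros H.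
  assert (Z : is_lim_seq (fun N => P * (/ 2) ^ N) 0).
  { replace 0 with (P * 0) by ring. apply (is_lim_seq_scal_l _ _ (Finite 0)).
    apply is_lim_seq_geom. rewrite Rabs_pos_eq; lra. }
  assert (Z' : is_lim_seq (fun N => - (P * (/ 2) ^ N)) 0).
  { replace 0 with (- 0) by ring. now apply (is_lim_seq_opp _ (Finite 0)). }
  assert (S : forall f l', (forall N, Rabs (f N - l') <= P * (/ 2) ^ N) -> is_lim_seq f l').
  { intros f l' Hf. apply (is_lim_seq_ext (fun N => (f N - l') + l')); [intros; ring|].
    replace (Finite l') with (Finite (0 + l')) by (f_equal; ring).
    apply is_lim_seq_plus'; [|apply is_lim_seq_const].
    apply (is_lim_seq_le_le (fun N => - (P * (/ 2) ^ N)) _ (fun N => P * (/ 2) ^ N)); auto.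
    intros N. pose proof (Hf N). apply Rabs_le_between in H0. lra. }
  split; apply S; intros N; (eapply Rle_trans; [|apply (H N)]).
  - exact (Re_le_Cmod (Cminus (u N) l)).
  - exact (Im_le_Cmod (Cminus (u N) l)).
Qed.

Lemma Csum_shift (f : nat -> C) X Y :
  f 0%nat = RtoC 0 -> abs_bounded (seq 0) f X -> abs_bounded (seq 0) (fun n => f (S n)) Y ->
  Csum (seq 0) (fun n => f (S n)) = Csum (seq 0) f.
Proof.
  intros H0 H H'. apply Csum_unique.
  destruct (Csum_correct _ _ _ exhaust_seq H) as [L1 L2].
  apply is_lim_seq_incr_1 in L1. apply is_lim_seq_incr_1 in L2.
  apply (clim_ext (fun n => csum f (seq 0 (S n)))); [|split; assumption].
  intros n. change (seq 0 (S n)) with (0%nat :: seq 1 n). rewrite <- seq_shift.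
  cbn [csum fold_right]. rewrite H0.
  change (Cplus (RtoC 0) (csum f (map S (seq 0 n))) = csum (fun n => f (S n)) (seq 0 n)).
  rewrite csum_map. ring.
Qed.

(** * Estimates for powers and the complexified time variable *)

Lemma INR_S_le_pow2 n : INR (S n) <= 2 ^ n.
Proof.
  induction n as [|n IH]; [simpl; lra|]. rewrite S_INR. simpl pow.
  pose proof (pow_R1_Rle 2 n ltac:(lra)). lra.
Qed.

(** Multiplying by [r] avoids the exponent [n - 1] and the case [n = 0]; [Cpow_taylor_le] does the
    same with [r ^ 2]. *)
Lemma Cpow_diff_le (x e : C) r n : 0 < r -> Cmod x <= r -> Cmod (Cplus x e) <= r ->
  Cmod (Cminus (Cpow (Cplus x e) n) (Cpow x n)) * r <= INR n * Cmod e * r ^ n.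
Proof.
  intros Hr Hx Hxe. induction n as [|n IH].
  - simpl. replace (Cminus (RtoC 1) (RtoC 1)) with (RtoC 0) by ring. rewrite Cmod_0. lra.
  - rewrite !Cpow_S.
    replace (Cminus (Cmult (Cplus x e) (Cpow (Cplus x e) n)) (Cmult x (Cpow x n))) with
      (Cplus (Cmult (Cplus x e) (Cminus (Cpow (Cplus x e) n) (Cpow x n))) (Cmult e (Cpow x n)))
      by ring.
    set (D := Cminus (Cpow (Cplus x e) n) (Cpow x n)) in *.
    assert (A : Cmod (Cplus (Cmult (Cplus x e) D) (Cmult e (Cpow x n))) <=
      Cmod (Cplus x e) * Cmod D + Cmod e * Cmod x ^ n).
    { eapply Rle_trans; [apply Cmod_triangle|]. rewrite !Cmod_mult, Cmod_pow. lra. }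
    assert (B : Cmod x ^ n <= r ^ n) by (apply pow_incr; split; [apply Cmod_ge_0|auto]).
    pose proof (Cmod_ge_0 D). pose proof (Cmod_ge_0 e). pose proof (Cmod_ge_0 (Cplus x e)).
    assert (Cmod (Cplus x e) * Cmod D <= r * Cmod D) by (apply Rmult_le_compat_r; auto).
    assert (Cmod e * Cmod x ^ n <= Cmod e * r ^ n) by (apply Rmult_le_compat_l; auto).
    rewrite S_INR. simpl pow.
    apply Rle_trans with ((r * Cmod D + Cmod e * r ^ n) * r); [apply Rmult_le_compat_r; lra|].
    nra.
Qed.

Definition cpow_deriv (x : C) (n : nat) : C := Cmult (RtoC (INR n)) (Cpow x (pred n)).

Lemma cpow_deriv_S x n :
  cpow_deriv x (S n) = Cplus (Cmult x (cpow_deriv x n)) (Cpow x n).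
Proof.
  unfold cpow_deriv. rewrite S_INR, RtoC_plus. destruct n; simpl pred.
  - simpl. ring.
  - rewrite Cpow_S. ring.
Qed.

Lemma cpow_deriv_le (x : C) r n : 0 < r -> Cmod x <= r -> Cmod (cpow_deriv x n) * r <= INR n * r ^ n.
Proof.
  intros Hr Hx. unfold cpow_deriv. rewrite Cmod_mult, Cmod_R, Rabs_pos_eq, Cmod_pow by apply pos_INR.
  destruct n as [|n]; [simpl; lra|].
  assert (B : Cmod x ^ n <= r ^ n) by (apply pow_incr; split; [apply Cmod_ge_0|auto]).
  simpl pred. rewrite Rmult_assoc. apply Rmult_le_compat_l; [apply pos_INR|].
  simpl. rewrite (Rmult_comm r). apply Rmult_le_compat_r; lra.
Qed.

Lemma Cpow_taylor_le (x e : C) r n : 0 < r -> Cmod x <= r -> Cmod (Cplus x e) <= r ->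
  Cmod (Cminus (Cminus (Cpow (Cplus x e) n) (Cpow x n)) (Cmult e (cpow_deriv x n))) * r ^ 2 <=
  INR n ^ 2 * Cmod e ^ 2 * r ^ n.
Proof.
  intros Hr Hx Hxe. induction n as [|n IH].
  - unfold cpow_deriv. simpl.
    replace (Cminus (Cminus (RtoC 1) (RtoC 1)) (Cmult e (Cmult (RtoC 0) (RtoC 1)))) with (RtoC 0) by ring.
    rewrite Cmod_0. lra.
  - rewrite !Cpow_S, cpow_deriv_S.
    set (Q := Cminus (Cminus (Cpow (Cplus x e) n) (Cpow x n)) (Cmult e (cpow_deriv x n))) in *.
    replace (Cminus (Cminus (Cmult (Cplus x e) (Cpow (Cplus x e) n)) (Cmult x (Cpow x n)))
        (Cmult e (Cplus (Cmult x (cpow_deriv x n)) (Cpow x n)))) with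
      (Cplus (Cmult (Cplus x e) Q) (Cmult (Cmult e e) (cpow_deriv x n))) by (unfold Q; ring).
    pose proof (cpow_deriv_le x r n Hr Hx) as CD.
    assert (A : Cmod (Cplus (Cmult (Cplus x e) Q) (Cmult (Cmult e e) (cpow_deriv x n))) <=
      r * Cmod Q + Cmod e ^ 2 * Cmod (cpow_deriv x n)).
    { eapply Rle_trans; [apply Cmod_triangle|]. rewrite !Cmod_mult.
      pose proof (Cmod_ge_0 Q).
      assert (Cmod (Cplus x e) * Cmod Q <= r * Cmod Q) by (apply Rmult_le_compat_r; auto). lra. }
    rewrite S_INR. replace (r ^ S n) with (r * r ^ n) by reflexivity.
    apply Rle_trans with ((r * Cmod Q + Cmod e ^ 2 * Cmod (cpow_deriv x n)) * r ^ 2).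
    { apply Rmult_le_compat_r; [apply pow2_ge_0|exact A]. }
    pose proof (pow2_ge_0 (Cmod e)). pose proof (pos_INR n).
    assert (T1 : r * (Cmod Q * r ^ 2) <= r * (INR n ^ 2 * Cmod e ^ 2 * r ^ n))
      by (apply Rmult_le_compat_l; lra).
    assert (T2 : Cmod e ^ 2 * r * (Cmod (cpow_deriv x n) * r) <= Cmod e ^ 2 * r * (INR n * r ^ n)).
    { apply Rmult_le_compat_l; [|exact CD]. apply Rmult_le_pos; lra. }
    assert (T3 : 0 <= (INR n + 1) * (Cmod e ^ 2 * (r * r ^ n))).
    { pose proof (pow_lt r n Hr). apply Rmult_le_pos; [lra|]. apply Rmult_le_pos; nra. }
    nra.
Qed.

Lemma Bf_0_l kap v k : Bf kap (fun _ => RtoC 0) v k = RtoC 0.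
Proof.
  apply Csum_unique. eapply clim_ext; [|apply clim_const].
  intros n. transitivity (csum (fun _ : Z * Z => RtoC 0) (box n)); [symmetry; apply csum_const0|].
  apply csum_ext. intros j _. unfold Bterm. ring.
Qed.

Lemma Bf_0_r kap v k : Bf kap v (fun _ => RtoC 0) k = RtoC 0.
Proof.
  apply Csum_unique. eapply clim_ext; [|apply clim_const].
  intros n. transitivity (csum (fun _ : Z * Z => RtoC 0) (box n)); [symmetry; apply csum_const0|].
  apply csum_ext. intros j _. unfold Bterm. ring.
Qed.

Lemma dec_csum {A} m (Y : A -> R) (f : A -> Z * Z -> C) l :
  (forall x, dec m (Y x) (f x)) -> dec m (lsum Y l) (fun k => csum (fun x => f x k) l).
Proof.
  intros H. induction l as [|x l IH]; simpl; [apply dec_0|]. now apply dec_plus.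
Qed.

Lemma Bf_csum_l {A} kap (Y : A -> R) X (f : A -> Z * Z -> C) v l k : 0 <= kap ->
  (forall x, dec 5 (Y x) (f x)) -> dec 5 X v ->
  Bf kap (fun j => csum (fun x => f x j) l) v k = csum (fun x => Bf kap (f x) v k) l.
Proof.
  intros Hk Hf Hv. induction l as [|x l IH]; simpl; [apply Bf_0_l|].
  rewrite (Bf_plus_l kap _ _ _ _ _ _ Hk (Hf x) (dec_csum 5 Y f l Hf) Hv). now rewrite IH.
Qed.

Lemma Bf_csum_r {A} kap (Y : A -> R) X (f : A -> Z * Z -> C) v l k : 0 <= kap ->
  (forall x, dec 5 (Y x) (f x)) -> dec 5 X v ->
  Bf kap v (fun j => csum (fun x => f x j) l) k = csum (fun x => Bf kap v (f x) k) l.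
Proof.
  intros Hk Hf Hv. induction l as [|x l IH]; simpl; [apply Bf_0_r|].
  rewrite (Bf_plus_r kap _ _ _ _ _ _ Hk (Hf x) (dec_csum 5 Y f l Hf) Hv). now rewrite IH.
Qed.

(** Reorganizes the partial sums of a Cauchy product over a full square, ready to be compared with
    the product of partial sums. *)
Lemma csum_triangle (F : nat -> nat -> C) N :
  csum (fun n => csum (fun i => F i (n - i)%nat) (seq 0 (S n))) (seq 0 N) =
  csum (fun i => csum (fun l => if (i + l <? N)%nat then F i l else RtoC 0) (seq 0 N)) (seq 0 N).
Proof.
  transitivity (csum (fun n => csum (fun i => if (i <=? n)%nat then F i (n - i)%nat else RtoC 0)
    (seq 0 N)) (seq 0 N)).
  { apply csum_ext. intros n Hn. apply in_seq in Hn.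
    replace N with (S n + (N - S n))%nat at 1 by lia. rewrite seq_app, csum_app.
    rewrite (csum_ext (fun i => if (i <=? n)%nat then F i (n - i)%nat else RtoC 0)
      (fun _ => RtoC 0) (seq (0 + S n) _)).
    - rewrite csum_const0, Cplus_0_r. apply csum_ext. intros i Hi. apply in_seq in Hi.
      destruct (Nat.leb_spec i n); [reflexivity|lia].
    - intros i Hi. apply in_seq in Hi. destruct (Nat.leb_spec i n); [lia|reflexivity]. }
  rewrite csum_swap. apply csum_ext. intros i Hi. apply in_seq in Hi.
  replace N with (i + (N - i))%nat at 1 by lia. rewrite seq_app, csum_app.
  rewrite (csum_ext _ (fun _ => RtoC 0) (seq 0 i)).
  2:{ intros n Hn. apply in_seq in Hn. destruct (Nat.leb_spec i n); [lia|reflexivity]. }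
  rewrite csum_const0, Cplus_0_l, Nat.add_0_l.
  replace (seq i (N - i)) with (map (fun l => (i + l)%nat) (seq 0 (N - i))).
  2:{ clear. generalize (N - i)%nat as p. intros p. induction p as [|p IH]; [reflexivity|].
      rewrite !seq_S, map_app, IH. reflexivity. }
  rewrite csum_map. replace N with ((N - i) + i)%nat at 2 by lia. rewrite seq_app, csum_app.
  rewrite (csum_ext (fun l => if (i + l <? N)%nat then F i l else RtoC 0)
     (fun _ => RtoC 0) (seq (0 + (N - i)) i)).
  2:{ intros l Hl. apply in_seq in Hl. destruct (Nat.ltb_spec (i + l) N); [lia|reflexivity]. }
  rewrite csum_const0, Cplus_0_r. apply csum_ext. intros l Hl. apply in_seq in Hl.
  destruct (Nat.leb_spec i (i + l)); [|lia]. destruct (Nat.ltb_spec (i + l) N); [|lia].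
  f_equal. lia.
Qed.

Section Strip.
Variables (nu kap M c : R) (g : Z * Z -> C) (a : nat -> R -> Z * Z -> C).
Hypotheses (Hn : 0 < nu) (Hk : 0 < kap) (Hc : 1 <= c)
  (Ha : forall n t, dec 7 (M * c ^ n) (a n t))
  (Hda : forall n t k, dC (fun s => a n s k) t (Cmult (RtoC (INR (S n))) (a (S n) t k)))
  (Hrec : forall n t k, Cmult (RtoC (INR (S n))) (a (S n) t k) =
     Cminus (Cminus (force_at g n k) (Cmult (RtoC (lam nu kap k)) (a n t k))) (Bconv kap a n t k)).

(** Inside the radius [1 / c] of convergence by a factor 32, so that the polynomial factors in [n]
    from two derivatives, at most of order [4 ^ n], still leave a geometric rate [(1 / 2) ^ n]. *)
Let r := / (32 * c).

(** The Taylor series is centred at the real part of the point and runs in the imaginary direction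
    only. One formula covers the whole strip and no local expansions have to be glued; the price is
    that analyticity must be checked. *)
Definition ext_fun (z : C) (k : Z * Z) : C :=
  Csum (seq 0) (fun n => Cmult (a n (Re z) k) (Cpow (0, Im z) n)).
Definition ext_deriv (z : C) (k : Z * Z) : C :=
  Csum (seq 0) (fun n => Cmult (Cmult (RtoC (INR (S n))) (a (S n) (Re z) k)) (Cpow (0, Im z) n)).

Lemma strip_r_pos : 0 < r.
Proof. apply Rinv_0_lt_compat. lra. Qed.

Lemma strip_M_pos : 0 <= M.
Proof. pose proof (dec_pos _ _ _ (Ha 0 0)). simpl in H. lra. Qed.

Lemma coef_le n t k : Cmod (a n t k) <= M * c ^ n.
Proof.
  eapply Rle_trans; [apply Ha|]. apply div_rho_pow_le, (dec_pos _ _ _ (Ha n t)).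
Qed.

Lemma cr_pow n : c ^ n * r ^ n = (/ 32) ^ n.
Proof. rewrite <- Rpow_mult_distr. f_equal. unfold r. field. lra. Qed.

Lemma coef_second_order n t h k :
  Cmod (Cminus (Cminus (a n (t + h) k) (a n t k)) (Cmult (RtoC h) (Cmult (RtoC (INR (S n))) (a (S n) t k))))
  <= h ^ 2 * (INR (S n) * INR (S (S n)) * (M * c ^ (S (S n)))).
Proof.
  pose proof (pos_INR (S n)). pose proof (pos_INR (S (S n))). pose proof strip_M_pos.
  pose proof (pow_lt c (S (S n)) ltac:(lra)).
  assert (D0 : 0 <= M * c ^ S (S n)) by nra.
  set (Q := M * c ^ S (S n)) in *.
  assert (L : forall s, 0 <= s <= 1 ->
    Cmod (Cminus (a (S n) (t + s * h) k) (a (S n) t k)) <= Rabs h * (INR (S (S n)) * Q)).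
  { intros s Hs.
    assert (D := dC_mvt (fun s => a (S n) (t + s * h) k)
      (fun s => Cmult (RtoC h) (Cmult (RtoC (INR (S (S n)))) (a (S (S n)) (t + s * h) k)))
      (RtoC 0) (Rabs h * (INR (S (S n)) * Q)) s (proj1 Hs)).
    cbv beta in D. rewrite Rmult_0_l, Rplus_0_r in D.
    replace (Cminus (Cminus (a (S n) (t + s * h) k) (a (S n) t k)) (Cmult (RtoC s) (RtoC 0)))
      with (Cminus (a (S n) (t + s * h) k) (a (S n) t k)) in D by ring.
    assert (P : 0 <= Rabs h * (INR (S (S n)) * Q)).
    { apply Rmult_le_pos; [apply Rabs_pos|]. now apply Rmult_le_pos. }
    apply Rle_trans with (s * (Rabs h * (INR (S (S n)) * Q))); [|nra].
    apply D.
    - intros s' _. apply (dC_affine (fun r => a (S n) r k)). apply Hda.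
    - intros s' _.
      match goal with |- Cmod (Cminus ?x (RtoC 0)) <= _ => replace (Cminus x (RtoC 0)) with x by ring end.
      rewrite !Cmod_mult, !Cmod_R, (Rabs_pos_eq (INR _)) by assumption.
      apply Rmult_le_compat_l; [apply Rabs_pos|]. apply Rmult_le_compat_l; [assumption|].
      apply coef_le. }
  assert (D := dC_mvt (fun s => a n (t + s * h) k)
      (fun s => Cmult (RtoC h) (Cmult (RtoC (INR (S n))) (a (S n) (t + s * h) k)))
      (Cmult (RtoC h) (Cmult (RtoC (INR (S n))) (a (S n) t k)))
      (Rabs h * (INR (S n) * (Rabs h * (INR (S (S n)) * Q)))) 1 ltac:(lra)).
  cbv beta in D. rewrite Rmult_0_l, Rplus_0_r, Rmult_1_l, Cmult_1_l in D.
  apply Rle_trans with (1 * (Rabs h * (INR (S n) * (Rabs h * (INR (S (S n)) * Q))))).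
  - apply D.
    + intros s' _. apply (dC_affine (fun r => a n r k)). apply Hda.
    + intros s' Hs'.
      match goal with |- Cmod (Cminus (Cmult ?x (Cmult ?y ?u)) (Cmult ?x (Cmult ?y ?v))) <= _ =>
        replace (Cminus (Cmult x (Cmult y u)) (Cmult x (Cmult y v))) with
          (Cmult x (Cmult y (Cminus u v))) by ring end.
      rewrite !Cmod_mult, !Cmod_R, (Rabs_pos_eq (INR _)) by assumption.
      apply Rmult_le_compat_l; [apply Rabs_pos|]. apply Rmult_le_compat_l; [assumption|].
      now apply L.
  - rewrite <- (pow2_abs h). apply Req_le. ring.
Qed.

Lemma ext_term_le z n k : Rabs (Im z) <= r ->
  Cmod (Cmult (a n (Re z) k) (Cpow (0, Im z) n)) <= M / rho k ^ 7 * (/ 32) ^ n.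
Proof.
  intros Hz. rewrite Cmod_mult, Cmod_pow, Cmod_imag. rewrite <- cr_pow.
  pose proof (Ha n (Re z) k). pose proof strip_M_pos.
  apply Rle_trans with (M * c ^ n / rho k ^ 7 * r ^ n).
  - apply Rmult_le_compat; auto; [apply Cmod_ge_0|apply pow_le, Rabs_pos|].
    apply pow_incr. split; [apply Rabs_pos|exact Hz].
  - apply Req_le. unfold Rdiv. ring.
Qed.

Lemma pow_mono_base x y n : 0 <= x <= y -> x ^ n <= y ^ n.
Proof. intros; now apply pow_incr. Qed.

Lemma ext_term_half z n k : Rabs (Im z) <= r ->
  Cmod (Cmult (a n (Re z) k) (Cpow (0, Im z) n)) <= M / rho k ^ 7 * (/ 2) ^ n.
Proof.
  intros Hz. eapply Rle_trans; [now apply ext_term_le|].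
  apply Rmult_le_compat_l; [|apply pow_mono_base; lra].
  apply Rmult_le_pos; [apply strip_M_pos|apply Rlt_le, inv_rho_pos].
Qed.

Lemma ext_fun_dec z : Rabs (Im z) <= r -> dec 7 (2 * M) (ext_fun z).
Proof.
  intros Hz k. unfold ext_fun. eapply Rle_trans.
  - apply (Csum_bound _ _ _ exhaust_seq).
    apply (abs_bounded_half _ (M / rho k ^ 7)). intros n. now apply ext_term_half.
  - unfold Rdiv. lra.
Qed.

Lemma ext_fun_real t k : ext_fun (RtoC t) k = a 0%nat t k.
Proof.
  apply Csum_unique. apply (clim_ext_loc (fun _ => a 0%nat t k)); [|apply clim_const].
  exists 1%nat. intros n Hn1. destruct n as [|n]; [lia|].
  change (seq 0 (S n)) with (0%nat :: seq 1 n). cbn [csum fold_right].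
  change (a 0%nat t k = Cplus (Cmult (a 0%nat (Re (RtoC t)) k) (Cpow (0, Im (RtoC t)) 0))
     (csum (fun n => Cmult (a n (Re (RtoC t)) k) (Cpow (0, Im (RtoC t)) n)) (seq 1 n))).
  rewrite (csum_ext _ (fun _ => RtoC 0)).
  - rewrite csum_const0. simpl. ring.
  - intros i Hi. apply in_seq in Hi. destruct i as [|i]; [lia|]. rewrite Cpow_S. simpl Im.
    change (0, 0) with (RtoC 0). ring.
Qed.

Lemma ext_deriv_term_half t y n k : Rabs y <= r ->
  Cmod (Cmult (Cmult (RtoC (INR (S n))) (a (S n) t k)) (Cpow (0, y) n)) <= M * c * (/ 2) ^ n.
Proof.
  intros Hz. rewrite !Cmod_mult, Cmod_pow, Cmod_imag, Cmod_R, Rabs_pos_eq by apply pos_INR.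
  pose proof (coef_le (S n) t k). pose proof strip_M_pos. pose proof strip_r_pos.
  pose proof (pow_lt c n ltac:(lra)). pose proof (pow_lt r n H1).
  apply Rle_trans with (2 ^ n * (M * c ^ S n) * r ^ n).
  - apply Rmult_le_compat.
    + apply Rmult_le_pos; [apply pos_INR|apply Cmod_ge_0].
    + apply pow_le, Rabs_pos.
    + apply Rmult_le_compat; [apply pos_INR|apply Cmod_ge_0|apply INR_S_le_pow2|exact H].
    + apply pow_incr. split; [apply Rabs_pos|exact Hz].
  - replace (2 ^ n * (M * c ^ S n) * r ^ n) with (M * c * (2 ^ n * (c ^ n * r ^ n))) by (simpl; ring).
    rewrite cr_pow, <- Rpow_mult_distr. apply Rmult_le_compat_l; [nra|].
    apply pow_mono_base. lra.
Qed.

(** A real step moves the coefficient, an imaginary step moves the power. The second-order error has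
    three parts: the remainder [Rn] of the coefficient, the mixed term with [Dn], and the remainder
    [Qn] of the power. *)
Lemma ext_difference_term t y al be n k : Rabs y <= r -> Rabs (y + be) <= r ->
  Cmod (Cminus (Cminus (Cminus (Cmult (a n (t + al) k) (Cpow (0, (y + be)%R) n))
     (Cmult (a n t k) (Cpow (0, y) n)))
     (Cmult (RtoC al) (Cmult (Cmult (RtoC (INR (S n))) (a (S n) t k)) (Cpow (0, y) n))))
     (Cmult (0, be) (Cmult (a n t k) (cpow_deriv (0, y) n)))) <=
  6 * M / r ^ 2 * (Rabs al + Rabs be) ^ 2 * (/ 2) ^ n.
Proof.
  intros Hy Hyb. pose proof strip_r_pos as Hr. pose proof strip_M_pos as HM.
  set (x := (0, y) : C). set (e := (0, be) : C).
  assert (Exe : (0, (y + be)%R) = Cplus x e) by (unfold x, e, Cplus; simpl; f_equal; ring).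
  rewrite Exe.
  assert (Hx : Cmod x <= r) by (unfold x; now rewrite Cmod_imag).
  assert (Hxe : Cmod (Cplus x e) <= r) by (rewrite <- Exe, Cmod_imag; exact Hyb).
  assert (He : Cmod e = Rabs be) by apply Cmod_imag.
  set (A1 := Cmult (RtoC (INR (S n))) (a (S n) t k)).
  set (Rn := Cminus (Cminus (a n (t + al) k) (a n t k)) (Cmult (RtoC al) A1)).
  set (Qn := Cminus (Cminus (Cpow (Cplus x e) n) (Cpow x n)) (Cmult e (cpow_deriv x n))).
  set (Dn := Cminus (Cpow (Cplus x e) n) (Cpow x n)).
  match goal with |- Cmod ?X <= _ =>
    replace X with (Cplus (Cplus (Cmult Rn (Cpow (Cplus x e) n)) (Cmult (Cmult (RtoC al) A1) Dn))
      (Cmult (a n t k) Qn)) by (unfold Rn, Dn, Qn; ring) end.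
  assert (BR := coef_second_order n t al k). fold A1 in BR. fold Rn in BR.
  assert (BD := Cpow_diff_le x e r n Hr Hx Hxe). fold Dn in BD.
  assert (BQ := Cpow_taylor_le x e r n Hr Hx Hxe). fold Qn in BQ.
  assert (BA1 : Cmod A1 <= INR (S n) * (M * c ^ S n)).
  { unfold A1. rewrite Cmod_mult, Cmod_R, Rabs_pos_eq by apply pos_INR.
    apply Rmult_le_compat_l; [apply pos_INR|apply coef_le]. }
  assert (BA := coef_le n t k).
  assert (BP : Cmod (Cpow (Cplus x e) n) <= r ^ n).
  { rewrite Cmod_pow. apply pow_incr. split; [apply Cmod_ge_0|exact Hxe]. }
  rewrite He in *.
  set (H := Rabs al + Rabs be).
  pose proof (Rabs_pos al) as al0. pose proof (Rabs_pos be) as be0.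
  set (N1 := INR (S n)) in *. assert (En : INR n = N1 - 1) by (unfold N1; rewrite S_INR; ring).
  assert (E2 : INR (S (S n)) = N1 + 1) by (unfold N1; rewrite (S_INR (S n)); ring).
  rewrite En in *. rewrite E2 in BR.
  assert (N1p : 1 <= N1) by (apply (le_INR 1); lia).
  assert (N4 : N1 ^ 2 <= 4 ^ n).
  { replace 4 with (2 ^ 2) by ring. rewrite <- pow_mult, Nat.mul_comm, pow_mult.
    apply pow_incr. split; [lra|apply INR_S_le_pow2]. }
  assert (cn := pow_lt c n ltac:(lra)). assert (rn := pow_lt r n Hr).
  assert (CR := cr_pow n).
  assert (c1r : c * r <= 1) by (unfold r; rewrite Rinv_mult; rewrite <- Rmult_assoc, (Rmult_comm c), Rmult_assoc, Rinv_r by lra; lra).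
  assert (P0 : 0 <= M * (c ^ n * r ^ n)) by (apply Rmult_le_pos; nra).
  set (P := M * (c ^ n * r ^ n)) in *.
  assert (r2 : 0 < r ^ 2) by nra.
  assert (T1 : Cmod (Cmult Rn (Cpow (Cplus x e) n)) * r ^ 2 <= 2 * N1 ^ 2 * H ^ 2 * P).
  { rewrite Cmod_mult.
    apply Rle_trans with (al ^ 2 * (N1 * (N1 + 1) * (M * c ^ S (S n))) * r ^ n * r ^ 2).
    - apply Rmult_le_compat_r; [lra|]. apply Rmult_le_compat; auto; apply Cmod_ge_0.
    - rewrite <- (pow2_abs al).
      replace (Rabs al ^ 2 * (N1 * (N1 + 1) * (M * c ^ S (S n))) * r ^ n * r ^ 2) with
        ((N1 * (N1 + 1)) * Rabs al ^ 2 * P * (c * r) ^ 2) by (unfold P; simpl; ring).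
      assert ((c * r) ^ 2 <= 1) by (assert (0 <= c * r) by nra; nra).
      assert (Rabs al ^ 2 <= H ^ 2) by (apply pow_incr; unfold H; lra).
      assert (0 <= Rabs al ^ 2) by apply pow2_ge_0.
      apply Rle_trans with ((2 * N1 ^ 2) * H ^ 2 * P * 1); [|lra].
      apply Rmult_le_compat; [| apply pow2_ge_0| |assumption].
      + repeat apply Rmult_le_pos; try lra; nra.
      + apply Rmult_le_compat_r; [exact P0|].
        apply Rmult_le_compat; nra. }
  assert (T2 : Cmod (Cmult (Cmult (RtoC al) A1) Dn) * r ^ 2 <= N1 ^ 2 * H ^ 2 * P).
  { rewrite !Cmod_mult, Cmod_R.
    replace (Rabs al * Cmod A1 * Cmod Dn * r ^ 2) with (Rabs al * r * Cmod A1 * (Cmod Dn * r)) by ring.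
    apply Rle_trans with (Rabs al * r * (N1 * (M * c ^ S n)) * ((N1 - 1) * Rabs be * r ^ n)).
    - apply Rmult_le_compat; [|apply Rmult_le_pos; [apply Cmod_ge_0|lra]| |exact BD].
      + repeat apply Rmult_le_pos; try lra. apply Cmod_ge_0.
      + apply Rmult_le_compat_l; [nra|exact BA1].
    - replace (Rabs al * r * (N1 * (M * c ^ S n)) * ((N1 - 1) * Rabs be * r ^ n)) with
        ((N1 * (N1 - 1)) * (Rabs al * Rabs be) * P * (c * r)) by (unfold P; simpl; ring).
      apply Rle_trans with (N1 ^ 2 * H ^ 2 * P * 1); [|lra].
      apply Rmult_le_compat; [| nra| |exact c1r].
      + repeat apply Rmult_le_pos; lra.
      + apply Rmult_le_compat_r; [exact P0|]. unfold H. apply Rmult_le_compat; nra. }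
  assert (T3 : Cmod (Cmult (a n t k) Qn) * r ^ 2 <= N1 ^ 2 * H ^ 2 * P).
  { rewrite Cmod_mult, Rmult_assoc.
    apply Rle_trans with ((M * c ^ n) * ((N1 - 1) ^ 2 * Rabs be ^ 2 * r ^ n)).
    - apply Rmult_le_compat; auto; [apply Cmod_ge_0|]. apply Rmult_le_pos; [apply Cmod_ge_0|lra].
    - replace (M * c ^ n * ((N1 - 1) ^ 2 * Rabs be ^ 2 * r ^ n)) with
        ((N1 - 1) ^ 2 * Rabs be ^ 2 * P) by (unfold P; ring).
      apply Rmult_le_compat_r; [exact P0|]. unfold H.
      apply Rmult_le_compat; try apply pow2_ge_0; apply pow_incr; lra. }
  assert (PP : 4 * N1 ^ 2 * H ^ 2 * P <= 6 * M * H ^ 2 * (/ 2) ^ n).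
  { unfold P. rewrite CR.
    assert (h2 : 0 <= H ^ 2) by apply pow2_ge_0.
    apply Rle_trans with (4 * 4 ^ n * H ^ 2 * (M * (/ 32) ^ n)).
    - assert (0 < (/ 32) ^ n) by (apply pow_lt; lra).
      apply Rmult_le_compat_r; [nra|]. apply Rmult_le_compat_r; [exact h2|]. lra.
    - replace (4 * 4 ^ n * H ^ 2 * (M * (/ 32) ^ n)) with (4 * M * H ^ 2 * (4 ^ n * (/ 32) ^ n)) by ring.
      rewrite <- Rpow_mult_distr.
      assert ((4 * / 32) ^ n <= (/ 2) ^ n) by (apply pow_mono_base; lra).
      assert (0 < (4 * / 32) ^ n) by (apply pow_lt; lra).
      assert (0 <= M * H ^ 2) by nra.
      apply Rmult_le_compat; lra. }
  apply Rmult_le_reg_r with (r ^ 2); [exact r2|].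
  replace (6 * M / r ^ 2 * H ^ 2 * (/ 2) ^ n * r ^ 2) with (6 * M * H ^ 2 * (/ 2) ^ n) by (field; lra).
  eapply Rle_trans; [apply Rmult_le_compat_r; [lra|apply Cmod_triangle]|].
  assert (TR := Cmod_triangle (Cmult Rn (Cpow (Cplus x e) n)) (Cmult (Cmult (RtoC al) A1) Dn)).
  apply (Rmult_le_compat_r (r ^ 2)) in TR; [|lra]. lra.
Qed.

(** The Cauchy-Riemann equations: since [a n] has time derivative [(n + 1) a (n + 1)],
    differentiating the powers of [i y] and shifting the index gives the same series as
    differentiating the coefficients. *)
Lemma ext_fun_quadratic z h k : Rabs (Im z) <= r -> Rabs (Im z + Im h) <= r ->
  Cmod (Cminus (Cminus (ext_fun (Cplus z h) k) (ext_fun z k)) (Cmult h (ext_deriv z k)))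
  <= 12 * M / r ^ 2 * (Rabs (Re h) + Rabs (Im h)) ^ 2.
Proof.
  intros Hz Hzh.
  set (t := Re z) in *. set (y := Im z) in *. set (al := Re h) in *. set (be := Im h) in *.
  set (F1 := fun n => Cmult (a n (t + al) k) (Cpow (0, (y + be)%R) n)).
  set (F2 := fun n => Cmult (a n t k) (Cpow (0, y) n)).
  set (F3 := fun n => Cmult (Cmult (RtoC (INR (S n))) (a (S n) t k)) (Cpow (0, y) n)).
  set (F4 := fun n => Cmult (a n t k) (cpow_deriv (0, y) n)).
  assert (B1 : abs_bounded (seq 0) F1 (2 * (M / rho k ^ 7))).
  { apply abs_bounded_half. intros n. apply (ext_term_half (Cplus z h)). exact Hzh. }
  assert (B2 : abs_bounded (seq 0) F2 (2 * (M / rho k ^ 7))).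
  { apply abs_bounded_half. intros n. apply (ext_term_half z). exact Hz. }
  assert (B3 : abs_bounded (seq 0) F3 (2 * (M * c))).
  { apply abs_bounded_half. intros n. apply ext_deriv_term_half. exact Hz. }
  assert (E4 : forall n, F4 (S n) = F3 n).
  { intros n. unfold F4, F3, cpow_deriv. simpl pred. ring. }
  assert (E40 : F4 0%nat = RtoC 0).
  { unfold F4, cpow_deriv. simpl. ring. }
  assert (B4 : abs_bounded (seq 0) F4 (2 * (2 * (M * c)))).
  { apply abs_bounded_half. intros [|n].
    - rewrite E40, Cmod_0. pose proof strip_M_pos. simpl. nra.
    - rewrite E4. eapply Rle_trans; [apply ext_deriv_term_half; exact Hz|]. simpl. lra. }
  (* The index shift that makes the derivative the same in both directions; it is legitimate because
     the term of index 0 vanishes. *)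
  assert (S4 : Csum (seq 0) F4 = Csum (seq 0) F3).
  { rewrite <- (Csum_shift F4 _ (2 * (M * c)) E40 B4).
    - apply Csum_ext. apply E4.
    - intros N. rewrite (lsum_ext _ (fun n => Cmod (F3 n))) by (intros; now rewrite E4). apply B3. }
  assert (HBT : abs_bounded (seq 0) (fun n => Cminus (Cminus (Cminus (F1 n) (F2 n))
     (Cmult (RtoC al) (F3 n))) (Cmult (0, be) (F4 n)))
     (2 * (6 * M / r ^ 2 * (Rabs al + Rabs be) ^ 2))).
  { apply abs_bounded_half. intros n. now apply ext_difference_term. }
  assert (E : Cminus (Cminus (ext_fun (Cplus z h) k) (ext_fun z k)) (Cmult h (ext_deriv z k)) =
    Csum (seq 0) (fun n => Cminus (Cminus (Cminus (F1 n) (F2 n))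
     (Cmult (RtoC al) (F3 n))) (Cmult (0, be) (F4 n)))).
  { symmetry. apply Csum_unique.
    assert (L1 := Csum_correct _ _ _ exhaust_seq B1). assert (L2 := Csum_correct _ _ _ exhaust_seq B2).
    assert (L3 := Csum_correct _ _ _ exhaust_seq B3). assert (L4 := Csum_correct _ _ _ exhaust_seq B4).
    rewrite S4 in L4.
    assert (L := clim_plus _ _ _ _ L1 (clim_plus _ _ _ _ (clim_scal (RtoC (-1)) _ _ L2)
      (clim_plus _ _ _ _ (clim_scal (Copp (RtoC al)) _ _ L3) (clim_scal (Copp (0, be)) _ _ L4)))).
    replace (Cminus (Cminus (ext_fun (Cplus z h) k) (ext_fun z k)) (Cmult h (ext_deriv z k))) with
     (Cplus (Csum (seq 0) F1) (Cplus (Cmult (RtoC (-1)) (Csum (seq 0) F2))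
        (Cplus (Cmult (Copp (RtoC al)) (Csum (seq 0) F3)) (Cmult (Copp (0, be)) (Csum (seq 0) F3))))).
    - refine (clim_ext _ _ _ _ L). intros n. cbv beta.
      rewrite <- !csum_scal, <- !csum_plus. apply csum_ext. intros i _. rewrite RtoC_m1. ring.
    - change (ext_fun (Cplus z h) k) with (Csum (seq 0) F1).
      change (ext_fun z k) with (Csum (seq 0) F2). change (ext_deriv z k) with (Csum (seq 0) F3).
      replace h with (Cplus (RtoC al) (0, be)).
      + rewrite RtoC_m1. ring.
      + unfold al, be. destruct h as [h1 h2]. unfold Cplus, RtoC; simpl. f_equal; ring. }
  rewrite E. eapply Rle_trans; [apply (Csum_bound _ _ _ exhaust_seq HBT)|].
  apply Req_le. unfold Rdiv. ring.
Qed.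

(** Summing the recursion against the powers of [i y]. The nonlinear part needs that the Cauchy
    product sums to [Bf U U]: its partial sums [P N] are compared with [Bf (W N) (W N)], and this
    with [Bf U U] by bilinearity, both up to a multiple of [(1 / 2) ^ N]. *)
Lemma ext_equation z k : Rabs (Im z) <= r -> ext_deriv z k = rhs nu kap g (ext_fun z) k.
Proof.
  intros Hz. pose proof strip_r_pos as Hr. pose proof strip_M_pos as HM.
  set (x := (0, Im z) : C). set (t := Re z).
  assert (Hx : Cmod x <= r) by (unfold x; now rewrite Cmod_imag).
  set (f := fun n j => Cmult (a n t j) (Cpow x n)).
  set (W := fun N j => csum (fun n => f n j) (seq 0 N)).
  set (U := ext_fun z).
  assert (Hf : forall n, dec 7 (M * (/ 2) ^ n) (f n)).
  { intros n j. unfold f. eapply Rle_trans; [apply (ext_term_half z n j Hz)|].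
    apply Req_le. unfold Rdiv. ring. }
  assert (HU : dec 7 (2 * M) U) by now apply ext_fun_dec.
  assert (HW : forall N, dec 7 (2 * M) (W N)).
  { intros N. apply (dec_mono 7 (lsum (fun n => M * (/ 2) ^ n) (seq 0 N))).
    - rewrite lsum_scal, lsum_half. pose proof (half_pow_pos N). nra.
    - now apply dec_csum. }
  assert (He : forall N, dec 7 (2 * M * (/ 2) ^ N) (fun j => Cminus (U j) (W N j))).
  { intros N j. unfold U, ext_fun, W, f. eapply Rle_trans.
    - apply (Csum_half_tail _ (M / rho j ^ 7)). intros n. now apply ext_term_half.
    - apply Req_le. unfold Rdiv. ring. }
  assert (Hk0 : 0 <= kap) by lra.
  assert (B2 : forall X Y w v, dec 7 X w -> dec 7 Y v -> Cmod (Bf kap w v k) <= cB kap 2 * X * Y).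
  { intros X Y w v Hw Hv. pose proof (dec_Bf kap 2 X Y w v Hk Hw Hv) as D.
    eapply Rle_trans; [apply D|]. apply div_rho_pow_le, (dec_pos _ _ _ D). }
  assert (W5 : forall X w, dec 7 X w -> dec 5 X w) by (intros X w; apply dec_weaken; lia).
  pose proof (cB_pos kap 2 Hk) as cBp.
  set (F := fun i l => Bf kap (f i) (f l) k).
  set (P := fun N => csum (fun n => Cmult (Cpow x n) (Bconv kap a n t k)) (seq 0 N)).
  assert (Ff : forall i l, F i l = Cmult (Cmult (Cpow x i) (Cpow x l)) (Bf kap (a i t) (a l t) k)).
  { intros i l. unfold F, f.
    replace (fun j => Cmult (a i t j) (Cpow x i)) with (fun j => Cmult (Cpow x i) (a i t j))
      by (apply functional_extensionality; intros; ring).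
    replace (fun j => Cmult (a l t j) (Cpow x l)) with (fun j => Cmult (Cpow x l) (a l t j))
      by (apply functional_extensionality; intros; ring).
    rewrite (Bf_scal_l kap _ _ _ _ Hk0 (W5 _ _ (Ha i t)) (dec_scal _ _ _ _ (W5 _ _ (Ha l t)))).
    rewrite (Bf_scal_r kap _ _ _ _ Hk0 (W5 _ _ (Ha l t)) (W5 _ _ (Ha i t))). ring. }
  assert (FB : forall i l, Cmod (F i l) <= cB kap 2 * M ^ 2 * ((/ 32) ^ i * (/ 32) ^ l)).
  { intros i l. rewrite Ff, !Cmod_mult, !Cmod_pow, <- !cr_pow.
    assert (Cmod x ^ i <= r ^ i) by (apply pow_incr; split; [apply Cmod_ge_0|auto]).
    assert (Cmod x ^ l <= r ^ l) by (apply pow_incr; split; [apply Cmod_ge_0|auto]).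
    assert (0 <= Cmod x ^ i) by (apply pow_le, Cmod_ge_0).
    assert (0 <= Cmod x ^ l) by (apply pow_le, Cmod_ge_0).
    apply Rle_trans with (r ^ i * r ^ l * (cB kap 2 * (M * c ^ i) * (M * c ^ l))).
    - apply Rmult_le_compat; [nra|apply Cmod_ge_0| |apply B2; apply Ha].
      now apply Rmult_le_compat.
    - apply Req_le. ring. }
  (* Only pairs with [i + l >= N] differ. Of their rate [(1 / 32) ^ (i + l)], one factor
     [(1 / 2) ^ N] is extracted and a summable [(1 / 2) ^ (i + l)] is kept. *)
  assert (PB : forall N, Cmod (Cminus (P N) (Bf kap (W N) (W N) k)) <=
     4 * (cB kap 2 * M ^ 2) * (/ 2) ^ N).
  { intros N.
    assert (E1 : P N = csum (fun i => csum (fun l => if (i + l <? N)%nat then F i l else RtoC 0)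
       (seq 0 N)) (seq 0 N)).
    { rewrite <- csum_triangle. unfold P. apply csum_ext. intros n _. unfold Bconv.
      rewrite <- csum_scal. apply csum_ext. intros i Hi. apply in_seq in Hi. rewrite Ff.
      rewrite <- Cpow_add_r. do 2 f_equal. lia. }
    assert (E2 : Bf kap (W N) (W N) k = csum (fun i => csum (fun l => F i l) (seq 0 N)) (seq 0 N)).
    { unfold W at 1.
      rewrite (Bf_csum_l kap _ _ f (W N) (seq 0 N) k Hk0 (fun n => W5 _ _ (Hf n)) (W5 _ _ (HW N))).
      apply csum_ext. intros i _. unfold W.
      now rewrite (Bf_csum_r kap _ _ f (f i) (seq 0 N) k Hk0 (fun n => W5 _ _ (Hf n)) (W5 _ _ (Hf i))). }
    replace (Cminus (P N) (Bf kap (W N) (W N) k)) with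
      (csum (fun i => csum (fun l => Cplus (if (i + l <? N)%nat then F i l else RtoC 0)
          (Cmult (RtoC (-1)) (F i l))) (seq 0 N)) (seq 0 N)).
    2:{ rewrite E1, E2. unfold Cminus.
        replace (Copp (csum (fun i => csum (fun l => F i l) (seq 0 N)) (seq 0 N))) with
          (Cmult (RtoC (-1)) (csum (fun i => csum (fun l => F i l) (seq 0 N)) (seq 0 N)))
          by (rewrite RtoC_m1; ring).
        rewrite <- csum_scal, <- csum_plus. apply csum_ext. intros i _.
        rewrite <- csum_scal, <- csum_plus. reflexivity. }
    eapply Rle_trans; [apply csum_Cmod|].
    set (C0 := cB kap 2 * M ^ 2) in *.
    assert (C00 : 0 <= C0) by (unfold C0; apply Rmult_le_pos; [lra|apply pow2_ge_0]).
    apply Rle_trans with (lsum (fun i => lsum (fun l => C0 * (/ 2) ^ N * (/ 2) ^ i * (/ 2) ^ l)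
      (seq 0 N)) (seq 0 N)).
    - apply lsum_le. intros i _. eapply Rle_trans; [apply csum_Cmod|]. apply lsum_le. intros l _.
      pose proof (half_pow_pos N). pose proof (half_pow_pos i). pose proof (half_pow_pos l).
      destruct (Nat.ltb_spec (i + l) N).
      + replace (Cplus (F i l) (Cmult (RtoC (-1)) (F i l))) with (RtoC 0) by (rewrite RtoC_m1; ring).
        rewrite Cmod_0. repeat apply Rmult_le_pos; lra.
      + rewrite Cplus_0_l, Cmod_mult, RtoC_m1, Cmod_opp, Cmod_1, Rmult_1_l.
        eapply Rle_trans; [apply FB|]. replace (C0 * (/ 2) ^ N * (/ 2) ^ i * (/ 2) ^ l) with (C0 * ((/ 2) ^ N * (/ 2) ^ (i + l)))
          by (rewrite (pow_add _ i l); ring).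
        apply Rmult_le_compat_l; [exact C00|].
        rewrite <- (pow_add _ i l). replace (/ 32) with (/ 2 * / 16) by lra.
        rewrite Rpow_mult_distr. apply Rmult_le_compat.
        * apply pow_le; lra.
        * apply pow_le; lra.
        * replace (i + l)%nat with (N + (i + l - N))%nat by lia. rewrite pow_add.
          rewrite <- (Rmult_1_r ((/ 2) ^ N)) at 2. apply Rmult_le_compat_l; [lra|].
          rewrite <- (pow1 (i + l - N)). apply pow_incr. lra.
        * apply pow_incr. lra.
    - rewrite (lsum_ext _ (fun i => C0 * (/ 2) ^ N * (2 - 2 * (/ 2) ^ N) * (/ 2) ^ i)).
      2:{ intros i _. rewrite lsum_scal, lsum_half. ring. }
      rewrite lsum_scal, lsum_half. pose proof (half_pow_pos N).
      assert ((/ 2) ^ N <= 1) by (rewrite <- (pow1 N); apply pow_incr; lra).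
      set (y := (/ 2) ^ N) in *.
      replace (C0 * y * (2 - 2 * y) * (2 - 2 * y)) with ((C0 * y) * (4 * (1 - y) ^ 2)) by ring.
      replace (4 * C0 * y) with ((C0 * y) * 4) by ring.
      apply Rmult_le_compat_l; nra. }
  assert (LP : clim P (Bf kap U U k)).
  { apply (clim_half _ _ (4 * (cB kap 2 * M ^ 2) + 8 * (cB kap 2 * M ^ 2))). intros N.
    assert (EB : Bf kap U U k = Cplus (Bf kap (W N) (W N) k)
      (Cplus (Bf kap (W N) (fun j => Cminus (U j) (W N j)) k)
             (Bf kap (fun j => Cminus (U j) (W N j)) U k))).
    { assert (EU : U = fun j => Cplus (W N j) (Cminus (U j) (W N j)))
        by (apply functional_extensionality; intros; ring).
      rewrite EU at 1.
      rewrite (Bf_plus_l kap _ _ _ _ _ _ Hk0 (W5 _ _ (HW N)) (W5 _ _ (He N)) (W5 _ _ HU)).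
      rewrite EU at 1.
      rewrite (Bf_plus_r kap _ _ _ _ _ _ Hk0 (W5 _ _ (HW N)) (W5 _ _ (He N)) (W5 _ _ (HW N))).
      ring. }
    rewrite EB.
    set (e1 := Bf kap (W N) (fun j => Cminus (U j) (W N j)) k).
    set (e2 := Bf kap (fun j => Cminus (U j) (W N j)) U k).
    replace (Cminus (P N) (Cplus (Bf kap (W N) (W N) k) (Cplus e1 e2))) with
      (Cminus (Cminus (P N) (Bf kap (W N) (W N) k)) (Cplus e1 e2)) by ring.
    eapply Rle_trans; [apply Cmod_minus_le|].
    pose proof (PB N). pose proof (Cmod_triangle e1 e2).
    pose proof (B2 _ _ _ _ (HW N) (He N)) as b1. pose proof (B2 _ _ _ _ (He N) HU) as b2.
    fold e1 in b1. fold e2 in b2. lra. }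
  assert (LW : clim (fun N => W N k) (U k)).
  { apply (clim_half _ _ (2 * M)). intros N.
    pose proof (He N k). cbv beta in H.
    replace (Cminus (W N k) (U k)) with (Copp (Cminus (U k) (W N k))) by ring.
    rewrite Cmod_opp. eapply Rle_trans; [exact H|]. apply div_rho_pow_le, (dec_pos _ _ _ (He N)). }
  unfold ext_deriv. fold x t. apply Csum_unique.
  unfold rhs. fold U.
  assert (L := clim_plus _ _ _ _ (clim_const (g k)) (clim_plus _ _ _ _
    (clim_scal (Copp (RtoC (lam nu kap k))) _ _ LW) (clim_scal (RtoC (-1)) _ _ LP))).
  replace (Cminus (Cminus (g k) (Cmult (RtoC (lam nu kap k)) (U k))) (Bf kap U U k)) with
    (Cplus (g k) (Cplus (Cmult (Copp (RtoC (lam nu kap k))) (U k))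
       (Cmult (RtoC (-1)) (Bf kap U U k)))) by (rewrite RtoC_m1; ring).
  (* The force sits in the term of index 0 alone, so the partial sums must contain at least that
     term. *)
  refine (clim_ext_loc _ _ _ _ L). exists 1%nat. intros N HN. cbv beta.
  assert (EF : g k = csum (fun n => Cmult (Cpow x n) (force_at g n k)) (seq 0 N)).
  { destruct N as [|N]; [lia|]. change (seq 0 (S N)) with (0%nat :: seq 1 N).
    cbn [csum fold_right].
    change (g k = Cplus (Cmult (Cpow x 0) (g k))
      (csum (fun n => Cmult (Cpow x n) (force_at g n k)) (seq 1 N))).
    rewrite (csum_ext _ (fun _ => RtoC 0)).
    - rewrite csum_const0. simpl. ring.
    - intros i Hi. apply in_seq in Hi. destruct i as [|i]; [lia|]. simpl. ring. }
  rewrite EF. unfold P, W. rewrite <- !csum_scal, <- !csum_plus. apply csum_ext. intros n _.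
  rewrite Hrec. unfold f. rewrite RtoC_m1. ring.
Qed.

End Strip.

Lemma growth_le_pow c n : 0 < c -> growth c n <= c ^ n.
Proof.
  intros Hc. unfold growth, Rdiv. rewrite <- (Rmult_1_r (c ^ n)) at 2.
  apply Rmult_le_compat_l; [apply pow_le; lra|].
  rewrite <- Rinv_1. apply Rinv_le_contravar; [lra|]. apply pow_R1_Rle, (le_INR 1). lia.
Qed.

Lemma Re_Im_scal s (h : C) : Re (Cmult (RtoC s) h) = s * Re h /\ Im (Cmult (RtoC s) h) = s * Im h.
Proof. unfold Re, Im; simpl. split; ring. Qed.

(** The width and all decay constants are fixed before the trajectory. The quadratic remainder in
    every weight is stronger than mode-wise differentiability and is what later yields derivatives
    in the norm of every [A^(alpha/2)]. *)
Lemma sol_strip_extension nu kap g M : 0 < nu -> 0 < kap -> rapid g -> g (0, 0)%Z = RtoC 0 ->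
  exists delta, 0 < delta /\ exists Mm : nat -> R,
    forall v, sol nu kap g v -> bdd v -> (forall t, dec 7 M (v t)) ->
    exists U : C -> Z * Z -> C,
      (forall t k, U (RtoC t) k = v t k) /\
      (forall m z, Rabs (Im z) < delta -> dec m (Mm m) (U z)) /\
      (forall m, exists K, 0 <= K /\ forall z h, Rabs (Im z) < delta ->
         Rabs (Im (Cplus z h)) < delta ->
         dec m (K * Cmod h ^ 2) (fun k => Cminus (Cminus (U (Cplus z h) k) (U z k))
                                     (Cmult h (rhs nu kap g (U z) k)))).
Proof.
  intros Hn Hk Hg Hg0.
  destruct (Hg 7%nat) as [G HG].
  set (M1 := Rmax 1 M). assert (HM1 : 1 <= M1) by apply Rmax_l.
  set (cst := 4 * (G + (32 * (51200 / sqrt nu) * M1 + 1) ^ 2 * M1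
     + 8 * (51200 / sqrt nu) * (32 * (51200 / sqrt nu) * M1 + 1) * M1 ^ 2) + 1).
  assert (Hcst : 1 <= cst) by exact (coef_cst_pos nu M1 G g Hn HM1 HG).
  set (r := / (32 * cst)). assert (Hr : 0 < r) by (apply Rinv_0_lt_compat; lra).
  (* Prepared for the restrictions of the extension to horizontal lines, which are real-time
     solutions with the order 7 bound [2 * M1]; the constants do not depend on the line. *)
  assert (UM : forall m, exists M', forall v, sol nu kap g v -> (forall t, dec 7 (2 * M1) (v t)) ->
    forall t, dec m M' (v t)).
  { intros m. destruct (sol_uniform_step nu kap g 7 (2 * M1) Hn Hk Hg ltac:(lia) m) as [M' HM'].
    exists M'. intros v Hs Hd t. apply (dec_weaken (7 + m)); [lia|auto]. }
  set (Mm := fun m => proj1_sig (constructive_indefinite_description _ (UM m))).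
  assert (HMm : forall m v, sol nu kap g v -> (forall t, dec 7 (2 * M1) (v t)) ->
    forall t, dec m (Mm m) (v t)).
  { intros m. unfold Mm. destruct constructive_indefinite_description; auto. }
  (* Half the radius leaves a margin for small steps beyond a segment that lies in the strip. *)
  exists (r / 2). split; [lra|]. exists Mm.
  intros v Hs Hb Hd.
  assert (Hd1 : forall t, dec 7 M1 (v t)).
  { intros t. apply (dec_mono 7 M); [apply Rmax_r|auto]. }
  set (a := coef nu kap g v).
  assert (Ha : forall n t, dec 7 (M1 * cst ^ n) (a n t)).
  { intros n t. apply (dec_mono 7 (M1 * growth cst n)).
    - apply Rmult_le_compat_l; [lra|]. apply growth_le_pow; lra.
    - exact (coef_growth nu kap M1 G g v Hn Hk HM1 Hg0 Hg Hs Hb Hd1 HG n t). }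
  assert (Hda : forall n t k, dC (fun s => a n s k) t (Cmult (RtoC (INR (S n))) (a (S n) t k))).
  { intros n t k. apply (diffd_dC (a n) (fun t k => Cmult (RtoC (INR (S n))) (a (S n) t k))).
    now apply coef_diffd. }
  assert (Hrec := fun n t k => coef_S_eq nu kap g v n t k). fold a in Hrec.
  set (U := ext_fun a).
  assert (HU7 : forall z, Rabs (Im z) <= r -> dec 7 (2 * M1) (U z)).
  { intros z Hz. now apply (ext_fun_dec M1 cst a Hcst Ha). }
  assert (Hquad : forall z h k, Rabs (Im z) <= r -> Rabs (Im z + Im h) <= r ->
    Cmod (Cminus (Cminus (U (Cplus z h) k) (U z k)) (Cmult h (rhs nu kap g (U z) k)))
      <= 12 * M1 / r ^ 2 * (Rabs (Re h) + Rabs (Im h)) ^ 2).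
  { intros z h k Hz Hzh.
    replace (rhs nu kap g (U z) k) with (ext_deriv a z k)
      by exact (ext_equation nu kap M1 cst g a Hk Hcst Ha Hrec z k Hz).
    exact (ext_fun_quadratic M1 cst a Hcst Ha Hda z h k Hz Hzh). }
  assert (Q0 : 0 <= 12 * M1 / r ^ 2).
  { apply Rlt_le, Rdiv_lt_0_compat; [lra|]. now apply pow_lt. }
  assert (U0 : forall z, U z (0, 0)%Z = RtoC 0).
  { intros z. unfold U, ext_fun. apply Csum_unique. eapply clim_ext; [|apply clim_const].
    intros n. transitivity (csum (fun _ : nat => RtoC 0) (seq 0 n)); [symmetry; apply csum_const0|].
    apply csum_ext. intros i _. unfold a. rewrite coef_mode0 by (auto; apply Hs). ring. }
  assert (Hsol : forall y, Rabs y <= r -> sol nu kap g (fun t => U (t, y))).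
  { intros y Hy. split; [auto|]. intros t k.
    apply (dC_of_quad _ _ _ (12 * M1 / r ^ 2) 1 Q0 ltac:(lra)). intros h _.
    pose proof (Hquad (t, y) (RtoC h) k Hy) as H. simpl Im in H. simpl Re in H.
    rewrite Rplus_0_r, Rabs_R0, Rplus_0_r, pow2_abs in H.
    replace (Cplus (t, y) (RtoC h)) with ((t + h, y) : C) in H
      by (unfold Cplus, RtoC; simpl; f_equal; ring).
    now apply H. }
  exists U. split; [|split].
  - intros t k. unfold U. rewrite ext_fun_real. reflexivity.
  - intros m z Hz.
    replace (U z) with (U (Re z, Im z)) by (now destruct z).
    apply (HMm m (fun t => U (t, Im z))).
    + apply Hsol. lra.
    + intros t. apply HU7. simpl. lra.
  - intros m. destruct (Hg (m + 5)%nat) as [Gm HGm].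
    (* The estimate [Hquad] has no weight in [k]. Joining [z] to [z + h] by a segment, which stays
       in the convex strip, recovers every weight from the equation and the decay already known
       there. *)
    destruct (segment_remainder nu kap m (Mm (m + 5 + 5)%nat) Gm Hn Hk) as (K & K0 & HK).
    exists K. split; [exact K0|]. intros z h Hz Hzh.
    assert (Hseg : forall s, 0 <= s <= 1 -> Rabs (Im (Cplus z (Cmult (RtoC s) h))) < r / 2).
    { intros s Hs'. change (Im (Cplus z (Cmult (RtoC s) h))) with (Im z + Im (Cmult (RtoC s) h)).
      rewrite (proj2 (Re_Im_scal s h)).
      change (Im (Cplus z h)) with (Im z + Im h) in Hzh.
      apply Rabs_lt_between in Hz. apply Rabs_lt_between in Hzh. apply Rabs_lt_between.
      destruct (Req_dec s 0) as [->|hs]; [lra|].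
      assert (0 < s * (r / 2 - (Im z + Im h))) by (apply Rmult_lt_0_compat; lra).
      assert (0 < s * (r / 2 + (Im z + Im h))) by (apply Rmult_lt_0_compat; lra).
      assert (0 <= (1 - s) * (r / 2 - Im z)) by (apply Rmult_le_pos; lra).
      assert (0 <= (1 - s) * (r / 2 + Im z)) by (apply Rmult_le_pos; lra). lra. }
    assert (D := HK g (fun s => U (Cplus z (Cmult (RtoC s) h))) h HGm).
    cbv beta in D. rewrite Cmult_0_l, Cmult_1_l, Cplus_0_r in D. apply D.
    + intros s Hs'.
      replace (Cplus z (Cmult (RtoC s) h)) with
        (Re (Cplus z (Cmult (RtoC s) h)), Im (Cplus z (Cmult (RtoC s) h)))
        by (symmetry; apply surjective_pairing).
      apply (HMm _ (fun t => U (t, Im (Cplus z (Cmult (RtoC s) h))))).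
      * apply Hsol. pose proof (Hseg s Hs'). lra.
      * intros t. apply HU7. pose proof (Hseg s Hs').
        change (Rabs (Im (Cplus z (Cmult (RtoC s) h))) <= r). lra.
    + intros s k Hs'. pose proof (Cmod_ge_0 h) as h0.
      (* The radius keeps [q * h] within the margin [r / 2], and the 4 is the square of 2 in
         [|Re h| + |Im h| <= 2 |h|]. *)
      apply (dC_of_quad _ _ _ (12 * M1 / r ^ 2 * (4 * Cmod h ^ 2)) (r / 2 / (Cmod h + 1))).
      * pose proof (pow2_ge_0 (Cmod h)). nra.
      * apply Rdiv_lt_0_compat; lra.
      * intros q Hq.
        set (z' := Cplus z (Cmult (RtoC s) h)).
        pose proof (Hquad z' (Cmult (RtoC q) h) k) as H.
        destruct (Re_Im_scal q h) as [E1 E2]. rewrite E1, E2 in H.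
        pose proof (Hseg s Hs') as Hz'. fold z' in Hz'.
        replace (Cplus z (Cmult (RtoC (s + q)) h)) with (Cplus z' (Cmult (RtoC q) h))
          by (unfold z'; rewrite RtoC_plus; ring).
        replace (Cmult (RtoC q) (Cmult h (rhs nu kap g (U z') k))) with
          (Cmult (Cmult (RtoC q) h) (rhs nu kap g (U z') k)) by ring.
        pose proof (Re_le_Cmod h). pose proof (Im_le_Cmod h). pose proof (Rabs_pos q).
        eapply Rle_trans; [apply H|].
        -- lra.
        -- assert (Rabs q * (Cmod h + 1) <= r / 2).
           { apply Rmult_le_compat_r with (r := Cmod h + 1) in Hq; [|lra].
             unfold Rdiv in Hq at 1. rewrite Rmult_assoc, Rinv_l in Hq by lra. lra. }
           eapply Rle_trans; [apply Rabs_triang|]. rewrite Rabs_mult.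
           assert (Rabs q * Rabs (Im h) <= Rabs q * Cmod h) by (apply Rmult_le_compat_l; lra). lra.
        -- rewrite !Rabs_mult, Rmult_assoc. apply Rmult_le_compat_l; [exact Q0|].
           replace (4 * Cmod h ^ 2 * q ^ 2) with ((Rabs q * (2 * Cmod h)) ^ 2)
             by (rewrite Rpow_mult_distr, pow2_abs; ring).
           pose proof (Rabs_pos (Re h)). pose proof (Rabs_pos (Im h)).
           apply pow_incr. split; [nra|].
           rewrite <- Rmult_plus_distr_l. apply Rmult_le_compat_l; lra.
Qed.

(** * Scalar form of divergence-free fields *)

(** Component of a vector along [k^perp / |k|]; the inverse of [nrm (0,0)] is [0]. *)
Definition proj (k : Z * Z) (x : C2) : C :=
  Cmult (RtoC (/ nrm k)) (Cplus (Cmult (RtoC (- IZR (snd k))) (fst x))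
                                (Cmult (RtoC (IZR (fst k))) (snd x))).
Definition lift (k : Z * Z) (c : C) : C2 :=
  (Cmult (RtoC (- IZR (snd k) * / nrm k)) c, Cmult (RtoC (IZR (fst k) * / nrm k)) c).

Lemma C2_eq (x y : C2) : fst x = fst y -> snd x = snd y -> x = y.
Proof. destruct x, y; simpl; congruence. Qed.

Lemma proj_0 x : proj (0, 0)%Z x = RtoC 0.
Proof. unfold proj. rewrite nrm0, Rinv_0. ring. Qed.

Lemma lift_0 c : lift (0, 0)%Z c = c2zero.
Proof. unfold lift, c2zero. rewrite nrm0, Rinv_0, !Rmult_0_r. f_equal; ring. Qed.

Lemma RtoC_neq0 x : x <> 0 -> RtoC x <> RtoC 0.
Proof. intros H E. apply RtoC_inj in E. auto. Qed.

Lemma nrm_sq_C k : Cplus (Cmult (RtoC (IZR (fst k))) (RtoC (IZR (fst k))))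
   (Cmult (RtoC (IZR (snd k))) (RtoC (IZR (snd k)))) = Cmult (RtoC (nrm k)) (RtoC (nrm k)).
Proof.
  rewrite <- !RtoC_mult, <- RtoC_plus. f_equal.
  pose proof (nrm_sq k). unfold ksq in H. lra.
Qed.

Lemma proj_lift k c : k <> (0, 0)%Z -> proj k (lift k c) = c.
Proof.
  intros H. assert (Hn := nrm_ge1 k H).
  assert (N0 : RtoC (nrm k) <> RtoC 0) by (apply RtoC_neq0; lra).
  unfold proj, lift; cbn [fst snd].
  rewrite !RtoC_mult, !RtoC_opp, RtoC_inv by lra.
  set (k1 := RtoC (IZR (fst k))). set (k2 := RtoC (IZR (snd k))). set (n := RtoC (nrm k)) in *.
  pose proof (nrm_sq_C k) as E. fold k1 k2 n in E.
  transitivity (Cmult (Cdiv (Cplus (Cmult k1 k1) (Cmult k2 k2)) (Cmult n n)) c).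
  - field. exact N0.
  - rewrite E. field. exact N0.
Qed.

Lemma eqb_origin k : k <> (0, 0)%Z -> (Z.eqb (fst k) 0 && Z.eqb (snd k) 0)%bool = false.
Proof.
  intros H. apply Bool.not_true_iff_false. rewrite Bool.andb_true_iff, !Z.eqb_eq.
  intros [e1 e2]. apply H. destruct k; simpl in *; congruence.
Qed.

(** In two dimensions removing the component along [k] leaves exactly the component along [k^perp],
    so a single scalar describes each projected mode. *)
Lemma leray_lift k s : leray k s = lift k (proj k s).
Proof.
  unfold leray. destruct (zz_eq_dec k (0, 0)%Z) as [->|H].
  - simpl. now rewrite lift_0.
  - rewrite (eqb_origin k H).
    assert (Hn := nrm_ge1 k H).
    assert (N0 : RtoC (nrm k) <> RtoC 0) by (apply RtoC_neq0; lra).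
    rewrite <- nrm_sq. replace (nrm k ^ 2) with (nrm k * nrm k) by ring.
    unfold proj, lift, c2sub, c2scal, c2dot, kvec; cbn [fst snd].
    rewrite !RtoC_mult, !RtoC_opp, RtoC_inv by lra.
    pose proof (nrm_sq_C k) as E.
    set (k1 := RtoC (IZR (fst k))) in *. set (k2 := RtoC (IZR (snd k))) in *.
    set (n := RtoC (nrm k)) in *.
    apply C2_eq; cbn [fst snd].
    + transitivity (Cmult (Cdiv (Cplus (Cmult k1 k1) (Cmult k2 k2)) (Cmult n n)) (fst s)
        - Cmult (Cdiv (Cplus (Cmult k1 (fst s)) (Cmult k2 (snd s))) (Cmult n n)) k1)%C.
      * rewrite E. field. exact N0.
      * field. exact N0.
    + transitivity (Cmult (Cdiv (Cplus (Cmult k1 k1) (Cmult k2 k2)) (Cmult n n)) (snd s)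
        - Cmult (Cdiv (Cplus (Cmult k1 (fst s)) (Cmult k2 (snd s))) (Cmult n n)) k2)%C.
      * rewrite E. field. exact N0.
      * field. exact N0.
Qed.

Lemma lift_proj k x : c2dot (kvec k) x = RtoC 0 -> (k = (0, 0)%Z -> x = c2zero) ->
  lift k (proj k x) = x.
Proof.
  intros Hd H0. destruct (zz_eq_dec k (0, 0)%Z) as [e|H].
  - rewrite e, lift_0. symmetry. auto.
  - rewrite <- leray_lift. unfold leray. rewrite (eqb_origin k H).
    rewrite Hd. unfold Cdiv. rewrite Cmult_0_l. unfold c2sub, c2scal.
    apply C2_eq; cbn [fst snd]; ring.
Qed.

Lemma lift_div_free k c : c2dot (kvec k) (lift k c) = RtoC 0.
Proof.
  unfold c2dot, kvec, lift; cbn [fst snd]. rewrite !RtoC_mult, RtoC_opp. ring.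
Qed.

Lemma c2norm2_lift k c : k <> (0, 0)%Z -> c2norm2 (lift k c) = Cmod c ^ 2.
Proof.
  intros H. assert (Hn := nrm_ge1 k H). unfold c2norm2, lift; cbn [fst snd].
  rewrite !Cmod_mult, !Cmod_R, !Rpow_mult_distr, !pow2_abs.
  replace ((- IZR (snd k) * / nrm k) ^ 2) with (IZR (snd k) ^ 2 / nrm k ^ 2) by (field; lra).
  replace ((IZR (fst k) * / nrm k) ^ 2) with (IZR (fst k) ^ 2 / nrm k ^ 2) by (field; lra).
  replace (IZR (snd k) ^ 2) with (nrm k ^ 2 - IZR (fst k) ^ 2) by (rewrite nrm_sq; unfold ksq; ring).
  field. lra.
Qed.

Lemma c2norm2_zero : c2norm2 c2zero = 0.
Proof. unfold c2norm2, c2zero; cbn [fst snd]. rewrite Cmod_0. ring. Qed.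

Lemma c2norm2_lift_le k c : c2norm2 (lift k c) <= Cmod c ^ 2.
Proof.
  destruct (zz_eq_dec k (0, 0)%Z) as [->|H].
  - rewrite lift_0, c2norm2_zero. apply pow2_ge_0.
  - rewrite c2norm2_lift by exact H. lra.
Qed.

Lemma c2norm2_scal a x : c2norm2 (c2scal a x) = Cmod a ^ 2 * c2norm2 x.
Proof. unfold c2norm2, c2scal; cbn [fst snd]. rewrite !Cmod_mult. ring. Qed.

Lemma c2norm2_nonneg x : 0 <= c2norm2 x.
Proof. unfold c2norm2. pose proof (pow2_ge_0 (Cmod (fst x))). pose proof (pow2_ge_0 (Cmod (snd x))). lra. Qed.

Lemma proj_add k x y : proj k (c2add x y) = Cplus (proj k x) (proj k y).
Proof. unfold proj, c2add; cbn [fst snd]. ring. Qed.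

Lemma proj_sub k x y : proj k (c2sub x y) = Cminus (proj k x) (proj k y).
Proof. unfold proj, c2sub; cbn [fst snd]. ring. Qed.

Lemma proj_scal k a x : proj k (c2scal a x) = Cmult a (proj k x).
Proof. unfold proj, c2scal; cbn [fst snd]. ring. Qed.

Lemma lift_add k x y : lift k (Cplus x y) = c2add (lift k x) (lift k y).
Proof. unfold lift, c2add; cbn [fst snd]. f_equal; ring. Qed.

Lemma lift_sub k x y : lift k (Cminus x y) = c2sub (lift k x) (lift k y).
Proof. unfold lift, c2sub; cbn [fst snd]. f_equal; ring. Qed.

Lemma lift_scal k a x : lift k (Cmult a x) = c2scal a (lift k x).
Proof. unfold lift, c2scal; cbn [fst snd]. f_equal; ring. Qed.

Lemma proj_csum2 k f l : proj k (csum2 f l) = csum (fun j => proj k (f j)) l.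
Proof.
  induction l as [|j l IH]; simpl.
  - unfold proj, c2zero; cbn [fst snd]. ring.
  - rewrite proj_add. now rewrite <- IH.
Qed.

Lemma proj_advect kap w v k j :
  proj k (advect_term kap (fun i => lift i (w i)) (fun i => lift i (v i)) k j) = Bterm kap w v k j.
Proof.
  unfold advect_term. rewrite proj_scal.
  unfold Bterm, tau, proj, lift, c2dot, c2scal, kvec. cbn [fst snd]. set (l := zsub k j).
  assert (Ep : perp j k = perp j l) by (unfold perp, l, zsub; simpl; rewrite !minus_IZR; ring).
  rewrite Ep. unfold perp, dot.
  replace (0, kap * (IZR (fst j) * IZR (snd l) - IZR (snd j) * IZR (fst l)) *
      (IZR (fst k) * IZR (fst l) + IZR (snd k) * IZR (snd l)) * / nrm k * / nrm j * / nrm l) with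
    (Cmult (0, 1) (RtoC (kap * (IZR (fst j) * IZR (snd l) - IZR (snd j) * IZR (fst l)) *
      (IZR (fst k) * IZR (fst l) + IZR (snd k) * IZR (snd l)) * / nrm k * / nrm j * / nrm l))).
  2:{ unfold Cmult, RtoC; simpl. f_equal; ring. }
  repeat (rewrite RtoC_mult || rewrite RtoC_plus || rewrite RtoC_minus || rewrite RtoC_opp).
  ring.
Qed.

(** * From solutions of the equations to scalar solutions *)

Lemma clim_of_eps u l :
  (forall eps, 0 < eps -> exists N0, forall N, (N0 <= N)%nat -> Cmod (Cminus (u N) l) ^ 2 < eps) ->
  clim u l.
Proof.
  intros H.
  assert (H' : forall eps : posreal, exists N0, forall N, (N0 <= N)%nat -> Cmod (Cminus (u N) l) < eps).
  { intros eps. pose proof (cond_pos eps) as Ep. destruct (H (eps ^ 2)) as [N0 HN0].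
    - apply pow_lt, Ep.
    - exists N0. intros N HN. pose proof (HN0 N HN). pose proof (Cmod_ge_0 (Cminus (u N) l)). nra. }
  split; apply is_lim_seq_spec; intros eps; destruct (H' eps) as [N0 HN0]; exists N0; intros N HN;
  (eapply Rle_lt_trans; [|apply (HN0 N HN)]).
  - exact (Re_le_Cmod (Cminus (u N) l)).
  - exact (Im_le_Cmod (Cminus (u N) l)).
Qed.

Lemma c2norm2_fst x : Cmod (fst x) ^ 2 <= c2norm2 x.
Proof. unfold c2norm2. pose proof (pow2_ge_0 (Cmod (snd x))). lra. Qed.

Lemma c2norm2_snd x : Cmod (snd x) ^ 2 <= c2norm2 x.
Proof. unfold c2norm2. pose proof (pow2_ge_0 (Cmod (fst x))). lra. Qed.

Lemma series_to_proj f s k : series_to f s ->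
  clim (fun N => csum (fun j => proj k (f j)) (box N)) (proj k s).
Proof.
  intros [_ H].
  apply (clim_ext (fun N => proj k (csum2 f (box N)))); [intros; apply proj_csum2|].
  unfold proj. apply clim_scal, clim_plus; apply clim_scal; apply clim_of_eps; intros eps He;
  destruct (H eps He) as [N0 HN0]; exists N0; intros N HN; (eapply Rle_lt_trans; [|apply (HN0 N HN)]).
  - apply (c2norm2_fst (c2sub (csum2 f (box N)) s)).
  - apply (c2norm2_snd (c2sub (csum2 f (box N)) s)).
Qed.

Lemma is_derive_of_eps (f : R -> R) t d :
  (forall eps, 0 < eps -> exists eta, 0 < eta /\ forall h, h <> 0 -> Rabs h < eta ->
     (/ h * (f (t + h) - f t) - d) ^ 2 < eps) -> is_derive f t d.
Proof.
  intros H. apply is_derive_Reals. intros eps He.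
  destruct (H (eps ^ 2)) as (eta & Heta & HH); [now apply pow_lt|].
  exists (mkposreal eta Heta). intros h Hh0 Hh. simpl in Hh.
  pose proof (HH h Hh0 Hh) as Q. rewrite <- pow2_abs in Q.
  replace ((f (t + h) - f t) / h - d) with (/ h * (f (t + h) - f t) - d) by (unfold Rdiv; ring).
  pose proof (Rabs_pos (/ h * (f (t + h) - f t) - d)). nra.
Qed.

Lemma has_deriv_R_dC f t d : has_deriv_R f t d ->
  dC (fun s => fst (f s)) t (fst d) /\ dC (fun s => snd (f s)) t (snd d).
Proof.
  intros H.
  assert (R1 : forall z : C, Re z ^ 2 <= Cmod z ^ 2)
    by (intros z; rewrite Cmod2; pose proof (pow2_ge_0 (Im z)); lra).
  assert (I1 : forall z : C, Im z ^ 2 <= Cmod z ^ 2)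
    by (intros z; rewrite Cmod2; pose proof (pow2_ge_0 (Re z)); lra).
  split; split; apply is_derive_of_eps; intros eps He; destruct (H eps He) as (eta & Heta & HH);
  exists eta; (split; [exact Heta|]); intros h Hh0 Hh;
  (eapply Rle_lt_trans; [|apply (HH h Hh0 Hh)]).
  - eapply Rle_trans; [|apply c2norm2_fst]. eapply Rle_trans; [|apply R1].
    apply Req_le. unfold c2sub, c2scal, Re; simpl. ring.
  - eapply Rle_trans; [|apply c2norm2_fst]. eapply Rle_trans; [|apply I1].
    apply Req_le. unfold c2sub, c2scal, Im; simpl. ring.
  - eapply Rle_trans; [|apply c2norm2_snd]. eapply Rle_trans; [|apply R1].
    apply Req_le. unfold c2sub, c2scal, Re; simpl. ring.
  - eapply Rle_trans; [|apply c2norm2_snd]. eapply Rle_trans; [|apply I1].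
    apply Req_le. unfold c2sub, c2scal, Im; simpl. ring.
Qed.

Lemma has_deriv_R_proj f t d k : has_deriv_R f t d -> dC (fun s => proj k (f s)) t (proj k d).
Proof.
  intros H. destruct (has_deriv_R_dC f t d H) as [[a1 a2] [b1 b2]].
  assert (L : forall (x y : R -> R) x' y' c p q, is_derive x t x' -> is_derive y t y' ->
    is_derive (fun s => c * (p * x s + q * y s)) t (c * (p * x' + q * y'))).
  { intros x y x' y' c p q Hx Hy. apply (is_derive_scal (fun s => p * x s + q * y s)).
    apply (is_derive_plus (fun s => p * x s) (fun s => q * y s)).
    - now apply (is_derive_scal x).
    - now apply (is_derive_scal y). }
  set (c := / nrm k). set (p := - IZR (snd k)). set (q := IZR (fst k)).
  assert (ER : forall x, Re (proj k x) = c * (p * Re (fst x) + q * Re (snd x))).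
  { intros x. unfold proj, Re; simpl. fold c p q. ring. }
  assert (EI : forall x, Im (proj k x) = c * (p * Im (fst x) + q * Im (snd x))).
  { intros x. unfold proj, Im; simpl. fold c p q. ring. }
  split.
  - rewrite ER. apply (is_derive_ext (fun s => c * (p * Re (fst (f s)) + q * Re (snd (f s))))).
    + intros s. symmetry. apply ER.
    + now apply (L (fun s => Re (fst (f s))) (fun s => Re (snd (f s)))).
  - rewrite EI. apply (is_derive_ext (fun s => c * (p * Im (fst (f s)) + q * Im (snd (f s))))).
    + intros s. symmetry. apply EI.
    + now apply (L (fun s => Im (fst (f s))) (fun s => Im (snd (f s)))).
Qed.

Definition scalar_of (w : FC) (k : Z * Z) : C := proj k (w k).

Lemma lift_scalar_of w : inHC w -> (fun k => lift k (scalar_of w k)) = w.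
Proof.
  intros (H0 & Hd & _). apply functional_extensionality. intros k.
  apply lift_proj; [apply Hd|]. intros ->. exact H0.
Qed.

Lemma scalar_of_norm w k : inHC w -> Cmod (scalar_of w k) ^ 2 = c2norm2 (w k).
Proof.
  intros H. destruct (zz_eq_dec k (0, 0)%Z) as [->|hk].
  - unfold scalar_of. rewrite proj_0, Cmod_0. destruct H as (-> & _). rewrite c2norm2_zero. ring.
  - rewrite <- (c2norm2_lift k _ hk). f_equal. exact (f_equal (fun F => F k) (lift_scalar_of w H)).
Qed.

Lemma scalar_of_antireal w : inH w -> antireal (scalar_of w).
Proof.
  intros [_ H] k. unfold scalar_of. rewrite H. unfold proj, c2conj; cbn [fst snd].
  rewrite nrm_neg. unfold zneg; cbn [fst snd]. rewrite !opp_IZR.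
  rewrite !Cmult_conj, !Cplus_conj, !Cmult_conj.
  assert (E : forall x : R, Cconj (RtoC x) = RtoC x).
  { intros x. unfold Cconj, RtoC; simpl. f_equal. ring. }
  rewrite !E, !RtoC_opp. ring.
Qed.

Lemma NSE_solution_sol nu L g u : inH g -> is_NSE_solution nu L g u ->
  sol nu (2 * PI / L) (scalar_of g) (fun t => scalar_of (u t)).
Proof.
  intros Hg (Hu & _ & He). set (kap := 2 * PI / L) in *. split.
  - intros t. apply proj_0.
  - intros t k. destruct (He t k) as (b & (s & Hs & Hb) & HD).
    assert (EB : Bf kap (scalar_of (u t)) (scalar_of (u t)) k = proj k s).
    { apply Csum_unique. apply (series_to_proj _ _ k) in Hs.
      refine (clim_ext _ _ _ _ Hs). intros N. apply csum_ext. intros j _.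
      rewrite <- proj_advect.
      now replace (fun i => lift i (scalar_of (u t) i)) with (u t)
        by (symmetry; apply lift_scalar_of, Hu). }
    pose proof (has_deriv_R_proj _ _ _ k HD) as D.
    replace (rhs nu kap (scalar_of g) (scalar_of (u t)) k) with
      (proj k (c2sub (c2sub (g k) (c2scal (RtoC nu) (Amode kap (u t) k))) b)); [exact D|].
    rewrite !proj_sub, proj_scal. unfold Amode. rewrite proj_scal. unfold rhs. rewrite EB.
    assert (Eb : proj k b = proj k s).
    { rewrite Hb, leray_lift. destruct (zz_eq_dec k (0, 0)%Z) as [->|hk].
      - now rewrite !proj_0.
      - now apply proj_lift. }
    rewrite Eb. unfold scalar_of, lam. rewrite Cmult_assoc, <- RtoC_mult.
    do 4 f_equal. ring.
Qed.

Lemma Hnorm_le_wsum L w M N : 0 < L -> inHC w -> Hnorm_le L w M ->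
  wsum (fun _ => 1) N (scalar_of w) <= M ^ 2 / L ^ 2.
Proof.
  intros HL Hw [_ H]. pose proof (pow_lt L 2 HL).
  apply Rmult_le_reg_l with (L ^ 2); [lra|].
  replace (L ^ 2 * (M ^ 2 / L ^ 2)) with (M ^ 2) by (field; lra).
  eapply Rle_trans; [|apply (H N)]. apply Rmult_le_compat_l; [lra|].
  apply lsum_le. intros k _. rewrite scalar_of_norm by exact Hw. lra.
Qed.

Lemma Hnorm_le_Vbound L kap w M : 0 < L -> 0 < kap -> inHC w ->
  Hnorm_le L (Apow kap 1 w) M -> Vbound (M ^ 2 / (L ^ 2 * kap ^ 2)) (scalar_of w).
Proof.
  intros HL Hk Hw [_ H] N. pose proof (pow_lt L 2 HL). pose proof (pow_lt kap 2 Hk).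
  assert (P : 0 < L ^ 2 * kap ^ 2) by nra.
  apply Rmult_le_reg_l with (L ^ 2 * kap ^ 2); [exact P|].
  replace (L ^ 2 * kap ^ 2 * (M ^ 2 / (L ^ 2 * kap ^ 2))) with (M ^ 2) by (field; lra).
  eapply Rle_trans; [|apply (H N)]. rewrite Rmult_assoc. apply Rmult_le_compat_l; [lra|].
  rewrite <- lsum_scal. apply lsum_le. intros k _. rewrite scalar_of_norm by exact Hw.
  unfold Apow. rewrite c2norm2_scal, Cmod_R, pow2_abs, pow_1, Rpow_mult_distr.
  fold (nrm k). rewrite nrm_sq. lra.
Qed.

Lemma inHC_dec0 w : inHC w -> exists G, dec 0 G (scalar_of w).
Proof.
  intros Hw. pose proof Hw as (_ & _ & M & HM). exists (1 + M). intros k.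
  assert (Cmod (scalar_of w k) ^ 2 <= M).
  { rewrite scalar_of_norm by exact Hw. apply (lsum_box_single (fun k => c2norm2 (w k))).
    - intros; apply c2norm2_nonneg.
    - exact HM. }
  simpl. unfold Rdiv. rewrite Rinv_1, Rmult_1_r. pose proof (Cmod_ge_0 (scalar_of w k)). nra.
Qed.

(** * From scalar solutions back to solutions of the equations *)

Definition field_of (w : Z * Z -> C) : FC := fun k => lift k (w k).

(** The operator costs [|k|^al <= rho^(2 al)]; the three orders left over become [rho^-6] after
    squaring, whose lattice sum is at most 100. *)
Lemma Apow_field_bound kap al X w N : 0 <= kap -> dec (2 * al + 3) X w ->
  rsum (fun k => c2norm2 (Apow kap al (field_of w) k)) (box N) <= 100 * (kap ^ al * X) ^ 2.
Proof.
  intros Hk Hw.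
  apply Rle_trans with (lsum (fun k => (kap ^ al * X) ^ 2 * / rho k ^ 6) (box N)).
  - apply lsum_le. intros k _. unfold Apow, field_of. rewrite c2norm2_scal, Cmod_R, pow2_abs.
    pose proof (c2norm2_lift_le k (w k)). pose proof (Hw k). pose proof (rho_ge1 k).
    fold (nrm k). rewrite Rpow_mult_distr.
    pose proof (nrm_le_pk k). pose proof (nrm_nonneg k). rewrite <- rho_sq in H2.
    assert (N1 : nrm k ^ al <= rho k ^ (2 * al)) by (rewrite pow_mult; now apply pow_incr).
    assert (N0 : 0 <= nrm k ^ al) by now apply pow_le.
    assert (C2' : Cmod (w k) ^ 2 <= (X / rho k ^ (2 * al + 3)) ^ 2).
    { apply pow_incr. split; [apply Cmod_ge_0|exact H0]. }
    assert (K0 : 0 <= kap ^ al) by now apply pow_le.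
    apply Rle_trans with ((kap ^ al * rho k ^ (2 * al)) ^ 2 * (X / rho k ^ (2 * al + 3)) ^ 2).
    + apply Rmult_le_compat; [apply pow2_ge_0|apply c2norm2_nonneg| |lra].
      apply pow_incr. split; [nra|]. now apply Rmult_le_compat_l.
    + apply Req_le. rewrite pow_add. assert (0 < rho k ^ (2 * al)) by (apply pow_lt; lra).
      field. lra.
  - rewrite lsum_scal, (Rmult_comm 100). apply Rmult_le_compat_l; [apply pow2_ge_0|].
    apply lsum_inv_rho. lia.
Qed.

Lemma inHC_Apow_field kap al X w : 0 <= kap -> dec (2 * al + 3) X w ->
  inHC (Apow kap al (field_of w)).
Proof.
  intros Hk Hw. split; [|split].
  - unfold Apow, field_of. rewrite lift_0. unfold c2scal, c2zero; cbn [fst snd]. f_equal; ring.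
  - intros k. unfold Apow, field_of. pose proof (lift_div_free k (w k)) as H.
    transitivity (Cmult (RtoC ((kap * sqrt (ksq k)) ^ al)) (c2dot (kvec k) (lift k (w k)))).
    + unfold c2dot, c2scal; cbn [fst snd]. ring.
    + rewrite H. ring.
  - eexists. intros N. now apply (Apow_field_bound kap al X).
Qed.

Lemma Apow_field_sub kap al w v w' (c : C) k :
  c2sub (c2scal c (c2sub (Apow kap al (field_of w) k) (Apow kap al (field_of v) k)))
        (Apow kap al (field_of w') k) =
  Apow kap al (field_of (fun k => Cminus (Cmult c (Cminus (w k) (v k))) (w' k))) k.
Proof.
  unfold Apow, field_of. rewrite lift_sub, lift_scal, lift_sub.
  unfold c2sub, c2scal; cbn [fst snd]. apply C2_eq; cbn [fst snd]; ring.
Qed.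

(** Dividing the quadratic remainder by [h] leaves [K |h|] in the weighted norm, hence [Q |h|^2] in
    the squared norm used by [has_deriv_HC]; for [|h| < 1] the choice [eps / (Q + 1)] suffices. *)
Lemma has_deriv_field kap al (U : C -> Z * Z -> C) z D X K eta : 0 <= kap -> 0 < eta -> 0 <= K ->
  dec (2 * al + 3) X D ->
  (forall h, Cmod h < eta -> dec (2 * al + 3) (K * Cmod h ^ 2)
     (fun k => Cminus (Cminus (U (Cplus z h) k) (U z k)) (Cmult h (D k)))) ->
  has_deriv_HC (fun z => Apow kap al (field_of (U z))) z (Apow kap al (field_of D)).
Proof.
  intros Hk Heta HK HD HR. split; [now apply (inHC_Apow_field kap al X)|].
  intros eps Heps.
  set (Q := 100 * (kap ^ al * K) ^ 2).
  assert (Q0 : 0 <= Q) by (unfold Q; pose proof (pow2_ge_0 (kap ^ al * K)); lra).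
  exists (Rmin eta (Rmin 1 (eps / (Q + 1)))).
  split.
  { repeat apply Rmin_pos; try lra. apply Rdiv_lt_0_compat; lra. }
  intros h Hh0 Hh N.
  assert (h1 : Cmod h < eta) by (eapply Rlt_le_trans; [exact Hh|apply Rmin_l]).
  assert (h2 : Cmod h < Rmin 1 (eps / (Q + 1))) by (eapply Rlt_le_trans; [exact Hh|apply Rmin_r]).
  assert (h3 : Cmod h < 1) by (eapply Rlt_le_trans; [exact h2|apply Rmin_l]).
  assert (h4 : Cmod h < eps / (Q + 1)) by (eapply Rlt_le_trans; [exact h2|apply Rmin_r]).
  assert (hp : 0 < Cmod h) by now apply Cmod_gt_0.
  eapply Rle_trans.
  - apply Req_le. apply lsum_ext. intros k _. now rewrite Apow_field_sub.
  - eapply Rle_trans.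
    + apply (Apow_field_bound kap al (K * Cmod h)); [exact Hk|].
      apply (dec_ext _ _ (fun k => Cmult (Cinv h)
        (Cminus (Cminus (U (Cplus z h) k) (U z k)) (Cmult h (D k))))).
      * intros k. field. exact Hh0.
      * replace (K * Cmod h) with (Cmod (Cinv h) * (K * Cmod h ^ 2)).
        -- apply dec_scal. now apply HR.
        -- rewrite Cmod_inv by exact Hh0. field. lra.
    + replace (100 * (kap ^ al * (K * Cmod h)) ^ 2) with (Q * Cmod h ^ 2) by (unfold Q; ring).
      assert (HQ : Q * Cmod h * Cmod h <= Q * Cmod h * 1).
      { apply Rmult_le_compat_l; [apply Rmult_le_pos|]; lra. }
      assert ((Q + 1) * Cmod h <= (Q + 1) * (eps / (Q + 1))) by (apply Rmult_le_compat_l; lra).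
      replace ((Q + 1) * (eps / (Q + 1))) with eps in H by (field; lra). simpl. lra.
Qed.

Lemma Apow_0 kap w : Apow kap 0 w = w.
Proof.
  apply functional_extensionality. intros k. unfold Apow, c2scal. simpl pow.
  apply C2_eq; cbn [fst snd]; ring.
Qed.

Lemma eps_of_clim u l : clim u l ->
  forall eps, 0 < eps -> exists N0, forall N, (N0 <= N)%nat -> Cmod (Cminus (u N) l) ^ 2 < eps.
Proof.
  intros [H1 H2] eps He. apply is_lim_seq_spec in H1, H2.
  assert (P : 0 < sqrt (eps / 2)) by (apply sqrt_lt_R0; lra).
  destruct (H1 (mkposreal _ P)) as [N1 HN1]. destruct (H2 (mkposreal _ P)) as [N2 HN2].
  simpl in HN1, HN2.
  exists (N1 + N2)%nat. intros N HN. rewrite Cmod2.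
  pose proof (HN1 N ltac:(lia)) as A. pose proof (HN2 N ltac:(lia)) as B.
  change (Re (Cminus (u N) l)) with (Re (u N) - Re l). change (Im (Cminus (u N) l)) with (Im (u N) - Im l).
  rewrite <- (pow2_abs (Re (u N) - Re l)), <- (pow2_abs (Im (u N) - Im l)).
  pose proof (Rabs_pos (Re (u N) - Re l)). pose proof (Rabs_pos (Im (u N) - Im l)).
  pose proof (pow2_sqrt (eps / 2) ltac:(lra)). nra.
Qed.

(** [B_is] demands absolute convergence of the vector series before projection. The derivative is
    kept on the frequency [k - j], and its two orders are paid from order 7 in [B_is_field]. *)
Lemma advect_norm_le kap w k j : 0 <= kap ->
  sqrt (c2norm2 (advect_term kap (field_of w) (field_of w) k j)) <=
  kap * (Cmod (w j) * (pk (zsub k j) * Cmod (w (zsub k j)))).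
Proof.
  intros Hk. unfold advect_term. rewrite c2norm2_scal.
  set (l := zsub k j).
  rewrite sqrt_mult by (apply pow2_ge_0 || apply c2norm2_nonneg).
  rewrite sqrt_pow2 by apply Cmod_ge_0.
  assert (A : Cmod (c2dot (field_of w j) (c2scal (Cmult (RtoC kap) (0, 1)) (kvec l))) <=
    kap * (Cmod (w j) * pk l)).
  { replace (c2dot (field_of w j) (c2scal (Cmult (RtoC kap) (0, 1)) (kvec l))) with
      (Cmult (Cmult (RtoC kap) (0, perp j l * / nrm j)) (w j)).
    2:{ unfold field_of, c2dot, lift, c2scal, kvec, perp; cbn [fst snd].
        replace (0, (IZR (fst j) * IZR (snd l) - IZR (snd j) * IZR (fst l)) * / nrm j) with
          (Cmult (0, 1) (RtoC ((IZR (fst j) * IZR (snd l) - IZR (snd j) * IZR (fst l)) * / nrm j)))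
          by (unfold Cmult, RtoC; simpl; f_equal; ring).
        repeat (rewrite RtoC_mult || rewrite RtoC_minus || rewrite RtoC_opp). ring. }
    rewrite !Cmod_mult, Cmod_imag, Cmod_R, (Rabs_pos_eq kap) by exact Hk.
    rewrite Rabs_mult, (Rabs_pos_eq (/ nrm j)) by apply inv_nonneg, nrm_nonneg.
    pose proof (perp_le j l). pose proof (mult_inv_le1 (nrm j) (nrm_nonneg j)).
    pose proof (nrm_le_pk l). pose proof (nrm_nonneg l). pose proof (Cmod_ge_0 (w j)).
    pose proof (inv_nonneg _ (nrm_nonneg j)). pose proof (Rabs_pos (perp j l)).
    assert (Rabs (perp j l) * / nrm j <= pk l).
    { apply Rle_trans with ((nrm j * nrm l) * / nrm j); [apply Rmult_le_compat_r; lra|].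
      replace (nrm j * nrm l * / nrm j) with (nrm l * (nrm j * / nrm j)) by ring. nra. }
    rewrite Rmult_assoc. apply Rmult_le_compat_l; [exact Hk|].
    rewrite Rmult_comm. apply Rmult_le_compat_l; lra. }
  assert (B : sqrt (c2norm2 (field_of w l)) <= Cmod (w l)).
  { rewrite <- (sqrt_pow2 (Cmod (w l))) by apply Cmod_ge_0. apply sqrt_le_1_alt, c2norm2_lift_le. }
  replace (kap * (Cmod (w j) * (pk l * Cmod (w l)))) with ((kap * (Cmod (w j) * pk l)) * Cmod (w l)) by ring.
  apply Rmult_le_compat; auto; [apply Cmod_ge_0|apply sqrt_pos].
Qed.

Lemma csum2_fst f l : fst (csum2 f l) = csum (fun j => fst (f j)) l.
Proof. induction l as [|j l IH]; simpl; [reflexivity|]. now rewrite <- IH. Qed.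

Lemma csum2_snd f l : snd (csum2 f l) = csum (fun j => snd (f j)) l.
Proof. induction l as [|j l IH]; simpl; [reflexivity|]. now rewrite <- IH. Qed.

Lemma Cmod_fst_le x : Cmod (fst x) <= sqrt (c2norm2 x).
Proof. rewrite <- (sqrt_pow2 (Cmod (fst x))) by apply Cmod_ge_0. apply sqrt_le_1_alt, c2norm2_fst. Qed.

Lemma Cmod_snd_le x : Cmod (snd x) <= sqrt (c2norm2 x).
Proof. rewrite <- (sqrt_pow2 (Cmod (snd x))) by apply Cmod_ge_0. apply sqrt_le_1_alt, c2norm2_snd. Qed.

Lemma B_is_field kap w M k : 0 <= kap -> dec 7 M w ->
  B_is kap (field_of w) (field_of w) k (lift k (Bf kap w w k)).
Proof.
  intros Hk Hw.
  set (f := advect_term kap (field_of w) (field_of w) k).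
  assert (S : exists S, forall N, lsum (fun j => sqrt (c2norm2 (f j))) (box N) <= S).
  { exists (kap * (400 * 2 ^ 5 * M * M / rho k ^ 5)). intros N.
    eapply Rle_trans; [apply lsum_le; intros j _; now apply advect_norm_le|].
    rewrite lsum_scal. apply Rmult_le_compat_l; [exact Hk|].
    apply (conv_bound 5 5 k N (fun j => Cmod (w j)) (fun j => pk j * Cmod (w j))); try lia.
    - intros j. split; [apply Cmod_ge_0|]. apply (dec_weaken 7); [lia|exact Hw].
    - intros j. pose proof (pk_ge1 j). pose proof (Cmod_ge_0 (w j)). split; [nra|].
      pose proof (Hw j). rewrite <- rho_sq in *. pose proof (rho_ge1 j).
      replace (M / rho j ^ 5) with (rho j ^ 2 * (M / rho j ^ 7)) by (field; lra).
      apply Rmult_le_compat_l; lra. }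
  destruct S as [S HS].
  assert (L1 : clim (fun N => csum (fun j => fst (f j)) (box N)) (Csum box (fun j => fst (f j)))).
  { apply (Csum_correct _ _ S exhaust_box). apply (abs_bounded_lsum _ _ (fun j => sqrt (c2norm2 (f j)))).
    - intros j. apply Cmod_fst_le.
    - exact HS. }
  assert (L2 : clim (fun N => csum (fun j => snd (f j)) (box N)) (Csum box (fun j => snd (f j)))).
  { apply (Csum_correct _ _ S exhaust_box). apply (abs_bounded_lsum _ _ (fun j => sqrt (c2norm2 (f j)))).
    - intros j. apply Cmod_snd_le.
    - exact HS. }
  set (s := (Csum box (fun j => fst (f j)), Csum box (fun j => snd (f j))) : C2).
  assert (Hs : series_to f s).
  { split.
    - exists S. exact HS.
    - intros eps He.
      destruct (eps_of_clim _ _ L1 (eps / 2) ltac:(lra)) as [N1 HN1].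
      destruct (eps_of_clim _ _ L2 (eps / 2) ltac:(lra)) as [N2 HN2].
      exists (N1 + N2)%nat. intros N HN. unfold c2norm2, c2sub; cbn [fst snd].
      rewrite csum2_fst, csum2_snd.
      pose proof (HN1 N ltac:(lia)). pose proof (HN2 N ltac:(lia)). unfold s; cbn [fst snd]. lra. }
  exists s. split; [exact Hs|].
  rewrite leray_lift. f_equal. apply Csum_unique.
  apply (series_to_proj _ _ k) in Hs. refine (clim_ext _ _ _ _ Hs). intros N.
  apply csum_ext. intros j _. apply proj_advect.
Qed.

Lemma NSE_solution_locally_V nu L g u : 0 < L -> is_NSE_solution nu L g u ->
  locally_V (fun t => scalar_of (u t)).
Proof.
  intros HL (Hu & HV & _) T.
  assert (Hk : 0 < 2 * PI / L) by (apply Rdiv_lt_0_compat; [pose proof PI_RGT_0|]; lra).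
  destruct (HV T) as [M HM]. exists (M ^ 2 / (L ^ 2 * (2 * PI / L) ^ 2)). intros t Ht.
  apply Hnorm_le_Vbound; auto. apply Hu.
Qed.

(** * Uniform analyticity of the attractor in a strip *)

Theorem theorem2p1 (nu L : R) (g : FC)
  (hnu : 0 < nu) (hL : 0 < L) (hg : inH g)
  (h0 : in_attractor nu L g fczero) :
  exists delta : R, 0 < delta /\
  exists Rt : nat -> R, (forall alpha : nat, 0 <= Rt alpha) /\
  forall u : R -> FC, solution_in_attractor nu L g u ->
  exists U : C -> FC,
    (forall t : R, U (RtoC t) = u t) /\
    (forall alpha : nat,
       HC_analytic_on_strip delta (fun z => Apow (2 * PI / L) alpha (U z))) /\
    (forall (alpha : nat) (z : C), in_strip delta z ->
       Hnorm_le L (Apow (2 * PI / L) alpha (U z))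
                (Rt alpha * nu * (2 * PI / L) ^ alpha)) /\
    (forall z : C, in_strip delta z ->
       exists D : FC, has_deriv_HC U z D /\
       forall k : Z * Z, exists b : C2,
         B_is (2 * PI / L) (U z) (U z) k b /\
         c2add (c2add (D k) (c2scal (RtoC nu) (Amode (2 * PI / L) (U z) k))) b = g k).
Proof.
  set (kap := 2 * PI / L).
  assert (hk : 0 < kap) by (apply Rdiv_lt_0_compat; [pose proof PI_RGT_0|]; lra).
  set (g' := scalar_of g).
  assert (Hg0 : g' (0, 0)%Z = RtoC 0) by apply proj_0.
  assert (HgC : inHC g) by apply hg.
  assert (Hrapid : rapid g').
  { destruct h0 as (v & [Hv _] & Hv0).
    apply (sol_through_zero_rapid nu kap g' (fun t => scalar_of (v t))); auto.
    - now apply NSE_solution_sol.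
    - now apply inHC_dec0.
    - now apply (NSE_solution_locally_V nu L g).
    - intros k. rewrite Hv0. unfold scalar_of, fczero, proj, c2zero; cbn [fst snd]. ring. }
  assert (HG0 : exists G0, forall N, lsum (fun k => Cmod (g' k) ^ 2) (box N) <= G0).
  { pose proof HgC as (_ & _ & G0 & HG0). exists G0. intros N. eapply Rle_trans; [|apply (HG0 N)].
    apply lsum_le. intros k _. unfold g'. rewrite scalar_of_norm by exact HgC. lra. }
  destruct HG0 as [G0 HG0].
  destruct (sol_V_uniform nu kap g' G0 hnu hk HG0) as [K HK].
  pose proof (sol_uniform_rapid nu kap g' K hnu hk Hrapid) as HU.
  destruct (HU 7%nat) as [M7 HM7].
  destruct (sol_strip_extension nu kap g' M7 hnu hk Hrapid Hg0) as (delta & Hdelta & Mm & HMm).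
  exists delta. split; [exact Hdelta|].
  (* The 10 is the square root of the lattice constant 100, [L] comes from the normalization of the
     norm, [2 * al + 3] is the order needed in [Apow_field_bound], and the division by [nu] cancels
     the factor [nu] of the claimed bound. *)
  exists (fun al => 10 * L * Rabs (Mm (2 * al + 3)%nat) / nu). split.
  { intros al. apply Rmult_le_pos; [|apply inv_nonneg; lra].
    apply Rmult_le_pos; [lra|apply Rabs_pos]. }
  intros u [Hu [M HM]].
  set (v := fun t => scalar_of (u t)).
  assert (Hs : sol nu kap g' v) by now apply NSE_solution_sol.
  assert (HuC : forall t, inHC (u t)) by (intros t; apply Hu).
  assert (HV : forall t, Vbound K (v t)).
  { apply HK; auto.
    - intros t. apply scalar_of_antireal, Hu.
    - apply (sol_locally_rapid nu kap g'); auto. now apply (NSE_solution_locally_V nu L g).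
    - exists (M ^ 2 / L ^ 2). intros t N. now apply Hnorm_le_wsum. }
  assert (Hb : bdd v).
  { intros m. destruct (HU m) as [Mb HMb]. exists Mb. now apply HMb. }
  destruct (HMm v Hs Hb (HM7 v Hs HV)) as (U & HUr & HUd & HUq).
  exists (fun z => field_of (U z)).
  assert (HD : forall al z, in_strip delta z ->
    has_deriv_HC (fun z => Apow kap al (field_of (U z))) z (Apow kap al (field_of (rhs nu kap g' (U z))))).
  { intros al z Hz. destruct (Hrapid (2 * al + 3)%nat) as [G HG].
    destruct (HUq (2 * al + 3)%nat) as (Q & Q0 & HQ).
    (* The radius is the distance from [z] to the boundary of the strip. *)
    eapply (has_deriv_field kap al U z _ _ Q (delta - Rabs (Im z))); try lra.
    - unfold in_strip in Hz. lra.
    - exact (dec_rhs nu kap _ _ _ g' (U z) hnu hk HG (HUd _ z Hz)).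
    - intros h Hh. apply HQ; [exact Hz|].
      change (Im (Cplus z h)) with (Im z + Im h).
      pose proof (Rabs_triang (Im z) (Im h)). pose proof (Im_le_Cmod h). lra. }
  repeat split.
  - intros t. rewrite <- (lift_scalar_of (u t)) by apply HuC.
    apply functional_extensionality. intros k. unfold field_of. now rewrite HUr.
  - exact (proj1 (inHC_Apow_field kap alpha _ (U z) ltac:(lra) (HUd _ z H))).
  - exact (proj1 (proj2 (inHC_Apow_field kap alpha _ (U z) ltac:(lra) (HUd _ z H)))).
  - exact (proj2 (proj2 (inHC_Apow_field kap alpha _ (U z) ltac:(lra) (HUd _ z H)))).
  - eexists. now apply HD.
  - apply Rmult_le_pos; [|apply pow_le; lra].
    replace (10 * L * Rabs (Mm (2 * alpha + 3)%nat) / nu * nu) with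
      (10 * L * Rabs (Mm (2 * alpha + 3)%nat)) by (field; lra).
    apply Rmult_le_pos; [lra|apply Rabs_pos].
  - intros N.
    pose proof (Apow_field_bound kap alpha _ (U z) N ltac:(lra) (HUd _ z H)) as A.
    replace ((10 * L * Rabs (Mm (2 * alpha + 3)%nat) / nu * nu * kap ^ alpha) ^ 2) with
      (L ^ 2 * (100 * (kap ^ alpha * Mm (2 * alpha + 3)%nat) ^ 2)).
    + apply Rmult_le_compat_l; [apply pow2_ge_0|exact A].
    + rewrite (Rpow_mult_distr (kap ^ alpha)), <- (pow2_abs (Mm (2 * alpha + 3)%nat)). field. lra.
  - intros z Hz. exists (field_of (rhs nu kap g' (U z))). split.
    (* The derivative of the field itself is the case of exponent 0. *)
    + pose proof (HD 0%nat z Hz) as D. rewrite Apow_0 in D.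
      replace (fun z => Apow kap 0 (field_of (U z))) with (fun z => field_of (U z)) in D; [exact D|].
      apply functional_extensionality. intros z'. symmetry. apply Apow_0.
    + intros k. exists (lift k (Bf kap (U z) (U z) k)). split.
      * apply (B_is_field kap (U z) (Mm 7%nat)); [lra|now apply HUd].
      * transitivity (lift k (g' k)).
        -- unfold Amode, field_of. rewrite <- !lift_scal, <- !lift_add. f_equal.
           unfold rhs, lam.
           replace (nu * kap ^ 2 * ksq k) with (nu * (kap ^ 2 * ksq k)) by ring.
           rewrite RtoC_mult. ring.
        -- exact (f_equal (fun F => F k) (lift_scalar_of g HgC)).
Qed.
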